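(* Let $P\subset\mathbb{R}^{d+1}$ be a convex polyhedron of dimension $d+1$, let $S=\partial P$, and let $v$ be a source point in the relative interior of a facet of $S$. Fix a facet $F$ of $S$, and let $V_{d-1}\subseteq T_F$ be the union of the closed cells of dimension $d-1$ in the Voronoi diagram $\mathcal{V}(\mathrm{src}_F)$ of the set $\mathrm{src}_F$ of source images for $F$ in $T_F$. If $F^\circ$ is the relative interior of $F$, then the set $F^\circ\cap K_v$ of cut points in $F^\circ$ coincides with $F^\circ\cap V_{d-1}$. Moreover, if $R^\circ$ is the relative interior of a ridge $R\subset F$, then the set $R^\circ\cap K_v$ of cut points in $R^\circ$ coincides with $R^\circ\cap V_{d-1}$.
   Context: A convex polyhedron of dimension $k$ is a finite intersection of closed half-spaces in $\mathbb{R}^k$ (possibly unbounded) not lying in a proper affine subspace. $S=\partial P$ is a $d$-dimensional polyhedral cell complex with its intrinsic piecewise Euclidean metric $\mu$ ($\mu(a,b)$ is the length of a shortest path in $S$ from $a$ to $b$). Facets are the $d$-dimensional faces of $S$, ridges the $(d-1)$-dimensional faces; $S_{d-2}$ is the union of all faces of dimension at most $d-2$. A shortest path is a path in $S$ whose length equals the distance between its endpoints; a geodesic is a path that is locally a shortest path. For a facet $F$, $T_F$ is its affine span. If facets $F\neq F'$ share a ridge $R$, the folding map $\Phi_{F,F'}:T_F\to T_{F'}$ is the isometry that fixes $R$ pointwise and for which $\Phi_{F,F'}(F)$ does not meet the interior of $F'$. A shortest path $\gamma$ starting at $v$ traverses, in order, the interiors of a well-defined sequence $\mathcal{L}_\gamma=(F_1,\dots,F_\ell)$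 of facets (its facet sequence). For such a sequence put $\Phi_{\mathcal L}=\Phi_{F_{\ell-1},F_\ell}\circ\cdots\circ\Phi_{F_1,F_2}:T_{F_1}\to T_{F_\ell}$; with $\mathcal{L}_i=(F_1,\dots,F_i)$, the sequential unfolding of $\gamma$ into $T_{F_1}$ is $\bigcup_i\Phi_{\mathcal{L}_i}^{-1}(\gamma\cap F_i)$, and its sequential unfolding into $T_{F_\ell}$ is the image of this set under $\Phi_{\mathcal L}$. Cut points: $x\in S$ is a cut point if it has more than one shortest path to $v$; $K_v$ is the set of cut points. Source images: suppose $v$ connects by a shortest path $\gamma$ to a point $x$ that lies on a facet $F$ or on one of its ridges $R\subset F$, but not on any face of dimension $\le d-2$. If the sequential unfolding of $\gamma$ into $T_F$ is the segment $[\nu,x]$, then $\nu\in T_F$ is a source image for $F$. (If $x$ lies on a ridge of $F$ and the last facet traversed by $\gamma$ is the other facet containing that ridge, $F$ is appended to the facet sequence.) $\mathrm{src}_F$ is the set of source images for $F$; it is finite. For a closed discrete set $\Upsilon$ in $T_F\cong\mathbb{R}^d$, the Voronoi diagram $\mathcal{V}(\Upsilon)$ is the subdivision whose closed cells (of full dimension) are $V(\Upsilon,\nu)=\{\zeta : |\zeta-\nu|\le|\zeta-\nu'|\text{ for all }\nu'\in\Upsilon\}$, $\nu\in\Upsilon$, together with their faces. *)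

(* Defs.v *)
From HB Require Import structures.
From mathcomp Require Import all_boot all_order all_algebra.
From mathcomp Require Import all_classical all_reals all_analysis.
Import Order.TTheory GRing.Theory Num.Theory.
Import numFieldNormedType.Exports.

Set Implicit Arguments.
Unset Strict Implicit.
Unset Printing Implicit Defensive.

Local Open Scope classical_set_scope.
Local Open Scope ring_scope.

Section Euclidean.
Context {R : realType} {n : nat}.
Local Notation E := 'rV[R]_n.
Implicit Types (A C G : set E) (x y : E).

Definition edot x y : R := (x *m y^T) 0 0.

(* The library norm on 'rV[R]_n is the sup norm; it induces the same topology
   as [enorm], but lengths and distances below must be Euclidean. *)
Definition enorm x : R := Num.sqrt (edot x x).

Definition segment x y : set E :=
  [set (1 - t) *: x + t *: y | t in `[0, 1]%classic].

Definition affine_hull A : set E :=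
  [set x | exists (m : nat) (p : 'I_m -> E) (w : 'I_m -> R),
    [/\ forall i, A (p i), \sum_i w i = 1 & x = \sum_i w i *: p i]].

(* The affine hull of [A] is a translate of the row space of a matrix of
   rank [k]; the empty set has no dimension. *)
Definition has_dim A (k : nat) : Prop :=
  exists (x0 : E) (U : 'M[R]_n),
    [/\ A x0, affine_hull A = [set x | (x - x0 <= U)%MS] & \rank U = k].

Definition relint A : set E :=
  [set x | A x /\ within (affine_hull A) (nbhs x) A].

(* Nonempty intersections of a convex set [C] with a supporting hyperplane.
   The normal [a] may vanish on the directions of [C] (or be zero), so that
   [C] is a face of itself. *)
Definition is_face C G : Prop :=
  G !=set0 /\ exists (a : E) (b : R),
    (forall x, C x -> edot a x <= b) /\ G = C `&` [set x | edot a x = b].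

Definition convex_polyhedron (P : set E) : Prop :=
  (exists (m : nat) (a : 'I_m -> E) (b : 'I_m -> R),
     (forall i, a i != 0) /\ P = [set x | forall i, edot (a i) x <= b i]) /\
  affine_hull P = setT.

Definition voronoi_cell (T Y : set E) (nu : E) : set E :=
  [set z | T z /\ forall nu', Y nu' -> enorm (z - nu) <= enorm (z - nu')].

(* Closed cells, of all dimensions, of the Voronoi diagram of [Y] in the
   affine subspace [T]. *)
Definition voronoi_diagram (T Y : set E) : set (set E) :=
  [set C | exists2 nu, Y nu & is_face (voronoi_cell T Y nu) C].

Definition polygonal_length (g : R -> E) (s : seq R) : R :=
  \sum_(0 <= i < size s) enorm (g (nth 0 (0 :: s) i.+1) - g (nth 0 (0 :: s) i)).

Definition path_length (g : R -> E) : \bar R :=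
  ereal_sup [set (polygonal_length g s)%:E | s in itv_partition 0 1].

Definition trace (g : R -> E) : set E := g @` `[0, 1]%classic.

Definition path_in (S : set E) (g : R -> E) (x y : E) : Prop :=
  [/\ {within `[0, 1]%classic, continuous g}, trace g `<=` S, g 0 = x & g 1 = y].

Definition intrinsic_dist (S : set E) (x y : E) : \bar R :=
  ereal_inf [set path_length g | g in [set g | path_in S g x y]].

Definition shortest_path (S : set E) (g : R -> E) (x y : E) : Prop :=
  [/\ path_in S g x y, path_length g = intrinsic_dist S x y
    & path_length g \is a fin_num].

End Euclidean.

(* [P] is a convex polyhedron in R^(d+1). Conditions "dimension j" with
   j = d - 1 or j <= d - 2 are written additively, since truncated subtraction
   would be wrong for small [d]. *)
Section PolyhedralSurface.
Context {R : realType} {d : nat}.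
Local Notation E := 'rV[R]_d.+1.
Variable P : set E.
Implicit Types (F G : set E) (L : seq (set E)) (v x nu : E).

Definition surface : set E := closure P `\` interior P.

Definition facet F : Prop := is_face P F /\ has_dim F d.

Definition ridge G : Prop := is_face P G /\ exists2 k, has_dim G k & k.+1 = d.

Definition low_skeleton : set E :=
  [set x | exists G k, [/\ is_face P G, has_dim G k, (k.+2 <= d)%N & G x]].

Definition share_ridge F F' : Prop :=
  [/\ facet F, facet F', F <> F'
    & exists G, [/\ ridge G, G `<=` F & G `<=` F']].

Definition is_folding F F' (phi : E -> E) : Prop :=
  [/\ phi @` affine_hull F = affine_hull F',
      forall x y, affine_hull F x -> affine_hull F y ->
        enorm (phi x - phi y) = enorm (x - y),
      exists G, [/\ ridge G, G `<=` F, G `<=` F' & forall x, G x -> phi x = x]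
    & phi @` F `&` relint F' = set0].

(* For facets sharing a ridge, [is_folding] determines the map on
   [affine_hull F]; only its values there are meaningful. *)
Definition folding F F' : E -> E :=
  if pselect (exists phi, is_folding F F' phi) is left h then projT1 (cid h)
  else id.

Fixpoint folding_seq L : E -> E :=
  if L is F :: ((F' :: _) as L') then folding_seq L' \o folding F F' else id.

(* Consecutive stretches of [g] lie in the facets of [L] and meet their
   interiors. Closed stretches are used since a parametrization may pause
   while it crosses a ridge. *)
Definition facet_sequence (g : R -> E) L : Prop :=
  exists t : nat -> R,
    [/\ t 0%N = 0, t (size L) = 1,
        forall i, (i < size L)%N ->
          [/\ facet (nth set0 L i), t i < t i.+1,
              g @` `[t i, t i.+1]%classic `<=` nth set0 L i
            & g @` `[t i, t i.+1]%classic `&` relint (nth set0 L i) !=set0]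
      & forall i, (i.+1 < size L)%N ->
          share_ridge (nth set0 L i) (nth set0 L i.+1)].

Definition unfolding_first (g : R -> E) L : set E :=
  [set y | affine_hull (head set0 L) y /\
     exists2 i, (i < size L)%N &
       (trace g `&` nth set0 L i) (folding_seq (take i.+1 L) y)].

Definition unfolding_last (g : R -> E) L : set E :=
  folding_seq L @` unfolding_first g L.

(* Facet sequence of a path ending at [x] in [F], with [F] appended if the path
   reaches [x] on a ridge of [F] from the other facet containing it. *)
Definition facet_sequence_to (g : R -> E) F x L : Prop :=
  (facet_sequence g L /\ last set0 L = F) \/
  exists L', [/\ facet_sequence g L', last set0 L' <> F, L = rcons L' F
    & exists G, [/\ ridge G, G x, G `<=` F & G `<=` last set0 L']].

Definition source_images v F : set E :=
  [set nu | affine_hull F nu /\ exists x g L,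
    [/\ F x /\ ~ low_skeleton x, shortest_path surface g v x,
        facet_sequence_to g F x L & unfolding_last g L = segment nu x]].

Definition cut_points v : set E :=
  [set x | surface x /\ exists g h,
    [/\ shortest_path surface g v x, shortest_path surface h v x
      & trace g <> trace h]].

Definition voronoi_codim1 (T Y : set E) : set E :=
  \bigcup_(C in [set C | voronoi_diagram T Y C /\
                         exists2 k, has_dim C k & k.+1 = d]) C.

End PolyhedralSurface.

(* Main.v *)
Require Import Defs.
From mathcomp Require Import all_boot all_order all_algebra.
From mathcomp Require Import all_classical all_reals all_analysis.
From mathcomp Require Import ring lra.
Import Order.TTheory GRing.Theory Num.Theory.
Import numFieldNormedType.Exports.

(** Fix a facet [F] and call a point of [F] good if it lies in the relative
    interior of [F] or of a ridge of [F].  At a good point [w] the distance to the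
    source [v] along the surface is the least Euclidean distance from [w] to a
    source image for [F], and shortest paths from [v] to [w] correspond to the
    source images where this least distance is attained.  So [w] is a cut point
    iff it has two nearest source images, that is, iff it lies on a cell of
    codimension 1 of their Voronoi diagram.  Four facts carry this.

    - Each shortest path to [w] unrolls to a straight segment from a source image
      to [w].  It crosses ridges in their relative interiors ([corner_on_ridge]):
      at a point of a face of smaller dimension the path could be shortened
      through the complement of the polyhedron and, since the nearest-point
      projection to the polyhedron does not increase lengths
      ([polyhedron_retraction]), also on the surface.  At a ridge, unrolling
      straightens the path ([unrolled_spec]).  This gives [source_image_exists].
      Conversely the image and [w] determine the polygon that is unrolled, by
      tracing the segment backwards ([visible_unique]).

    - No source image is closer to a point [y] of [F] than [v] is ([image_dist]),
      even if the segment from the image does not fold back into the surface.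
      Along a segment in [F] the squared distance to an image is the squared
      length of the segment travelled plus an affine function.  Near each point of
      the segment the squared distance to [v] is bounded above by the squared
      distance to the image seen from that point; after subtracting the common
      quadratic term it is concave, and thus stays below its support at a point
      where the given image is seen ([below_left_support]).

    - A nearest source image [o] comes from a shortest path that arrives at [w]
      from the direction of [o] ([image_step_back]).  By the previous bound, the
      points just before [w] on the segment from [o] are at the right distance,
      if they lie in [F].  If [w] is on a ridge and [o] lies beyond it, the
      segment has to be folded to the other facet, and [o] must be shown to fold
      to an image for that facet ([image_across]).  Different images yield
      different arrival points ([step_back_inj]), which excludes a common path as
      a shortest path has only one point at each distance from [v].

    - For finitely many sites in a hyperplane, the union of the Voronoi cells of
      codimension 1 is the set of points with two nearest sites
      ([equidistant_voronoi], [voronoi_equidistant]); finiteness is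
      [source_images_finite].

    Distances are taken in the complement of the interior of the polyhedron,
    where estimates may use segments that leave the surface, and shortest paths
    exist by compactness and induction on the number of facets. *)

Set Implicit Arguments.
Unset Strict Implicit.
Unset Printing Implicit Defensive.

Local Open Scope classical_set_scope.
Local Open Scope ring_scope.

(** * The Euclidean norm and segments *)

Section EuclideanGeometry.
Context {R : realType} {n : nat}.
Local Notation E := 'rV[R]_n.
Implicit Types (a x y z p q : E) (k : R).

Lemma edotE x y : edot x y = \sum_i x 0 i * y 0 i.
Proof. by rewrite /edot mxE; apply: eq_bigr => i _; rewrite mxE. Qed.

Lemma edotC x y : edot x y = edot y x.
Proof. by rewrite !edotE; apply: eq_bigr => i _; rewrite mulrC. Qed.

Lemma edotDl x y z : edot (x + y) z = edot x z + edot y z.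
Proof. by rewrite /edot mulmxDl mxE. Qed.

Lemma edotZl k x y : edot (k *: x) y = k * edot x y.
Proof. by rewrite /edot -scalemxAl mxE. Qed.

Lemma edotNl x y : edot (- x) y = - edot x y.
Proof. by rewrite -scaleN1r edotZl mulN1r. Qed.

Lemma edotBl x y z : edot (x - y) z = edot x z - edot y z.
Proof. by rewrite edotDl edotNl. Qed.

Lemma edotDr x y z : edot x (y + z) = edot x y + edot x z.
Proof. by rewrite edotC edotDl !(edotC x). Qed.

Lemma edotZr k x y : edot x (k *: y) = k * edot x y.
Proof. by rewrite edotC edotZl edotC. Qed.

Lemma edotNr x y : edot x (- y) = - edot x y.
Proof. by rewrite edotC edotNl edotC. Qed.

Lemma edotBr x y z : edot x (y - z) = edot x y - edot x z.
Proof. by rewrite edotDr edotNr. Qed.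

Lemma edot0l x : edot 0 x = 0.
Proof. by rewrite -(scale0r x) edotZl mul0r. Qed.

Lemma edot0r x : edot x 0 = 0.
Proof. by rewrite edotC edot0l. Qed.

Definition edotrE := (edotDr, edotBr, edotZr, edotNr, edot0r).
Definition edotlrE := (edotDl, edotBl, edotZl, edotNl, edot0l, edotrE).

Lemma edot_ge0 x : 0 <= edot x x.
Proof. by rewrite edotE; apply: sumr_ge0 => i _; rewrite -expr2 sqr_ge0. Qed.

Lemma edot_eq0 x : edot x x = 0 -> x = 0.
Proof.
rewrite edotE => /eqP; rewrite psumr_eq0; last first.
  by move=> i _; rewrite -expr2 sqr_ge0.
move=> /allP h; apply/rowP => i; rewrite mxE.
by have := h i (mem_index_enum _) => /=; rewrite mulf_eq0 orbb => /eqP.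
Qed.

Lemma edot_gt0 x : x != 0 -> 0 < edot x x.
Proof.
by move=> x0; rewrite lt0r edot_ge0 andbT; apply: contra_neq x0 => /edot_eq0.
Qed.

Lemma enorm_ge0 x : 0 <= enorm x. Proof. exact: sqrtr_ge0. Qed.

Lemma enorm_sqr x : enorm x ^+ 2 = edot x x.
Proof. by rewrite sqr_sqrtr// edot_ge0. Qed.

Lemma enorm0 : enorm (0 : E) = 0.
Proof. by rewrite /enorm edot0l sqrtr0. Qed.

Lemma enorm_eq0 x : enorm x = 0 -> x = 0.
Proof. by move=> x0; apply: edot_eq0; rewrite -enorm_sqr x0 expr0n. Qed.

Lemma enorm_gt0 x : x != 0 -> 0 < enorm x.
Proof.
by move=> x0; rewrite lt0r enorm_ge0 andbT; apply: contra_neq x0 => /enorm_eq0.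
Qed.

Lemma enormN x : enorm (- x) = enorm x.
Proof. by rewrite /enorm edotNl edotNr opprK. Qed.

Lemma enormB x y : enorm (x - y) = enorm (y - x).
Proof. by rewrite -enormN opprB. Qed.

Lemma enormZ k x : enorm (k *: x) = `|k| * enorm x.
Proof.
by rewrite /enorm edotZl edotZr mulrA -expr2 sqrtrM ?sqr_ge0// sqrtr_sqr.
Qed.

Lemma enorm_eq x y : edot x x = edot y y -> enorm x = enorm y.
Proof. by rewrite /enorm => ->. Qed.

Lemma enorm_le_sqr x y : edot x x <= edot y y -> enorm x <= enorm y.
Proof. by move=> h; rewrite /enorm ler_wsqrtr. Qed.

(** Expand the square of [|y| x - |x| y]; the same identity gives the case of
    equality below. *)
Lemma edot_le_enorm x y : edot x y <= enorm x * enorm y.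
Proof.
have [->|x0] := eqVneq x 0; first by rewrite edot0l enorm0 mul0r.
have [->|y0] := eqVneq y 0; first by rewrite edot0r enorm0 mulr0.
have := edot_ge0 (enorm y *: x - enorm x *: y).
rewrite !edotlrE -!enorm_sqr (edotC y x).
have := enorm_gt0 x0; have := enorm_gt0 y0.
set u := enorm x; set w := enorm y => w0 u0 h.
have uw : 0 < u * w by rewrite mulr_gt0.
rewrite -(ler_pM2l uw); nra.
Qed.

Lemma edot_enorm_eq x y :
  edot x y = enorm x * enorm y -> enorm y *: x = enorm x *: y.
Proof.
move=> h; apply/eqP; rewrite -subr_eq0; apply/eqP/edot_eq0.
by rewrite !edotlrE -!enorm_sqr (edotC y x) h; ring.
Qed.

Lemma edot_ge_enorm x y : - (enorm x * enorm y) <= edot x y.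
Proof. by rewrite lerNl -edotNl -(enormN x) edot_le_enorm. Qed.

Lemma enormD x y : enorm (x + y) <= enorm x + enorm y.
Proof.
rewrite -(ler_pXn2r (n := 2)) ?nnegrE ?addr_ge0 ?enorm_ge0//.
rewrite enorm_sqr !edotlrE -!enorm_sqr (edotC y x).
have := edot_le_enorm x y; nra.
Qed.

Lemma enorm_tri y x z : enorm (x - z) <= enorm (x - y) + enorm (y - z).
Proof. by apply: le_trans (enormD _ _); rewrite addrA subrK. Qed.

Lemma segmentP x y z : segment x y z <->
  exists t, [/\ 0 <= t, t <= 1 & z = (1 - t) *: x + t *: y].
Proof.
split=> [[t]|[t [t0 t1 ->]]]; last by exists t; rewrite //= in_itv/= t0.
by rewrite /= in_itv/= => /andP[t0 t1] <-; exists t.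
Qed.

Lemma segment_sym x y : segment x y = segment y x.
Proof.
by apply/seteqP; split=> z /segmentP[t [t0 t1 ->]]; apply/segmentP;
  exists (1 - t); split; rewrite ?subr_ge0 ?gerBl// subKr addrC.
Qed.

Lemma segment_l x y : segment x y x.
Proof. by apply/segmentP; exists 0; split; rewrite ?subr0 ?scale1r ?scale0r ?addr0. Qed.

Lemma segment_r x y : segment x y y.
Proof. by rewrite segment_sym; exact: segment_l. Qed.

Lemma segmentxx x : segment x x = [set x].
Proof.
apply/seteqP; split=> z; last by move=> ->; exact: segment_l.
by case/segmentP=> t [_ _ ->]; rewrite -scalerDl subrK scale1r.
Qed.

Lemma segment_dist x y z :
  segment x y z -> enorm (x - z) + enorm (z - y) = enorm (x - y).
Proof.
case/segmentP=> t [t0 t1 ->].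
have -> : x - ((1 - t) *: x + t *: y) = t *: (x - y).
  by apply/rowP => i; rewrite !mxE; ring.
have -> : (1 - t) *: x + t *: y - y = (1 - t) *: (x - y).
  by apply/rowP => i; rewrite !mxE; ring.
by rewrite !enormZ !ger0_norm ?subr_ge0//; ring.
Qed.

Lemma dist_segment x y z :
  enorm (x - z) + enorm (z - y) <= enorm (x - y) -> segment x y z.
Proof.
move=> h.
have {}h : enorm (x - z) + enorm (z - y) = enorm (x - y).
  by apply/eqP; rewrite eq_le h enorm_tri.
have [xy|xy] := eqVneq x y.
  have := enorm_ge0 (x - z); have := enorm_ge0 (z - y).
  move: h; rewrite -xy subrr enorm0 => h u0 w0.
  have : enorm (x - z) = 0 by lra.
  by move/enorm_eq0/eqP; rewrite subr_eq0 => /eqP ->; exact: segment_l.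
have d0 : 0 < enorm (x - y) by rewrite enorm_gt0// subr_eq0.
have /edot_enorm_eq e : edot (x - z) (z - y) = enorm (x - z) * enorm (z - y).
  have e : x - y = (x - z) + (z - y) by rewrite addrA subrK.
  have := enorm_sqr (x - y); rewrite -h [in RHS]e.
  rewrite edotDl !(edotDr _ (x - z)) -!enorm_sqr (edotC (z - y)) sqrrD; lra.
apply/segmentP; exists (enorm (x - z) / enorm (x - y)); split.
- by rewrite divr_ge0 ?enorm_ge0.
- by rewrite ler_pdivrMr// mul1r -h lerDl enorm_ge0.
- apply: (scalerI (a := enorm (x - y))); first by rewrite gt_eqF.
  have e2 : 1 - enorm (x - z) / enorm (x - y) = enorm (z - y) / enorm (x - y).
    apply: (mulIf (lt0r_neq0 d0)); rewrite mulrBl mul1r !divfK ?lt0r_neq0//; lra.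
  rewrite e2 scalerDr !scalerA !mulrA ![enorm (x - y) * _]mulrC !mulfK ?gt_eqF//.
  apply/rowP => i; move/rowP: e => /(_ i); rewrite !mxE -h; lra.
Qed.

(** This continues a straight path across a corner: both pieces contain the
    segment from [m] to [q], which must not be a point. *)
Lemma segment_extend x m q p :
  segment x q m -> m != q -> segment m p q -> segment x p q.
Proof.
case/segmentP=> s [s0 s1 em] mq /segmentP[u [u0 u1 eq]].
have s1' : s < 1.
  rewrite lt_neqAle s1 andbT; apply: contra_neq mq => s1'.
  by rewrite em s1' subrr scale0r add0r scale1r.
have us : 0 <= (1 - u) * (1 - s) by rewrite mulr_ge0// subr_ge0// ltW.
have d0 : 0 < 1 - (1 - u) * s by nra.
apply/segmentP; exists (u / (1 - (1 - u) * s)); split.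
- by rewrite divr_ge0// ltW.
- by rewrite ler_pdivrMr// mul1r; lra.
- apply/rowP => i; move/rowP: eq => /(_ i); rewrite em !mxE => {em}.
  set q1 := q 0 i; set x1 := x 0 i; set p1 := p 0 i => e.
  apply: (mulfI (lt0r_neq0 d0)).
  have -> : (1 - (1 - u) * s) * ((1 - u / (1 - (1 - u) * s)) * x1 +
      u / (1 - (1 - u) * s) * p1) = (1 - (1 - u) * s - u) * x1 + u * p1.
    by field; rewrite lt0r_neq0.
  lra.
Qed.

Lemma segment_sub x y z : segment x y z -> segment x z `<=` segment x y.
Proof.
case/segmentP=> t [t0 t1 ->] w /segmentP[s [s0 s1 ->]].
apply/segmentP; exists (s * t); split; [nra|nra|].
by apply/rowP => i; rewrite !mxE; ring.
Qed.

Lemma segment_cat x y z : segment x y z -> segment x y = segment x z `|` segment z y.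
Proof.
move=> xyz; apply/seteqP; split=> w; last first.
  case; first exact: segment_sub.
  by rewrite segment_sym (segment_sym x); apply: segment_sub; rewrite segment_sym.
case/segmentP: xyz => t [t0 t1 ->] /segmentP[s [s0 s1 ->]].
have [st|ts] := leP s t.
  left; have [t00|t00] := eqVneq t 0.
    have -> : s = 0 by lra.
    by rewrite subr0 scale1r scale0r addr0; exact: segment_l.
  have tp : 0 < t by rewrite lt0r t00.
  apply/segmentP; exists (s / t); split.
  - by rewrite divr_ge0.
  - by rewrite ler_pdivrMr// mul1r.
  - by apply/rowP => i; rewrite !mxE; field.
right; have tp : 0 < 1 - t by lra.
apply/segmentP; exists ((s - t) / (1 - t)); split.
- by rewrite divr_ge0; lra.
- by rewrite ler_pdivrMr//; lra.
- by apply/rowP => i; rewrite !mxE; field; rewrite gt_eqF.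
Qed.

Lemma segment_same_dist x y z z' : segment x y z -> segment x y z' ->
  enorm (z - y) = enorm (z' - y) -> z = z'.
Proof.
case/segmentP=> t [t0 t1 ->] /segmentP[s [s0 s1 ->]].
have e u : (1 - u) *: x + u *: y - y = (1 - u) *: (x - y).
  by apply/rowP => i; rewrite !mxE; ring.
rewrite !e !enormZ !ger0_norm ?subr_ge0// => h.
have [->|xy] := eqVneq x y; first by rewrite -!scalerDl !subrK.
have d0 : 0 < enorm (x - y) by rewrite enorm_gt0// subr_eq0.
by have -> : t = s by nra.
Qed.

End EuclideanGeometry.

(** * The topology of the Euclidean norm *)

Section EuclideanTopology.
Context {R : realType} {n : nat}.
Local Notation E := 'rV[R]_n.
Implicit Types (a x y z p q : E) (k : R).

Lemma norm_le_enorm x : `|x| <= enorm x.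
Proof.
rewrite [leLHS]/Num.norm /= mx_normrE; apply/bigmax_leP; split=> [|[i j] _ /=].
  exact: enorm_ge0.
rewrite (ord1 i) -(ler_pXn2r (n := 2)) ?nnegrE ?enorm_ge0// real_normK ?num_real//.
rewrite enorm_sqr edotE (bigD1 j)//= -expr2 lerDl.
by apply: sumr_ge0 => l _; rewrite -expr2 sqr_ge0.
Qed.

Lemma coord_le_norm x i : `|x 0 i| <= `|x|.
Proof.
rewrite [leRHS]/Num.norm /= mx_normrE.
by apply/bigmax_geP; right => /=; exists (0, i).
Qed.

Lemma enorm_le_norm x : enorm x <= n%:R * `|x|.
Proof.
rewrite {1}(row_sum_delta x).
apply: (@le_trans _ _ (\sum_(i < n) enorm (x 0 i *: delta_mx 0 i : E))).
  elim/big_ind2: _ => [|u c w e hu hw|//]; first by rewrite enorm0.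
  by apply: le_trans (enormD _ _) _; exact: lerD.
apply: (@le_trans _ _ (\sum_(i < n) `|x|)).
  apply: ler_sum => i _; rewrite enormZ.
  suff -> : enorm (delta_mx 0 i : E) = 1 by rewrite mulr1 coord_le_norm.
  rewrite /enorm edotE (bigD1 i)//= !mxE !eqxx mulr1 big1 ?addr0 ?sqrtr1//.
  by move=> j ji; rewrite !mxE (negbTE ji) mulr0.
by rewrite sumr_const card_ord mulr_natl.
Qed.

Lemma nbhs_enormP x (A : set E) :
  nbhs x A <-> exists2 r, 0 < r & forall y, enorm (y - x) < r -> A y.
Proof.
split=> [/nbhs_ballP[r /= r0 h]|[r r0 h]].
  exists r => // y yr; apply: h; rewrite -ball_normE /ball_ /=.
  by rewrite -normrN opprB; apply: le_lt_trans (norm_le_enorm _) yr.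
have n0 : 0 < n.+1%:R :> R by rewrite ltr0n.
apply/nbhs_ballP; exists (r / n.+1%:R) => /=; first by rewrite divr_gt0.
move=> y; rewrite -ball_normE /ball_ /= => yr; apply: h.
rewrite enormB; apply: le_lt_trans (enorm_le_norm _) _.
rewrite ltr_pdivlMr// mulrC in yr; apply: le_lt_trans yr.
by rewrite ler_wpM2r// ler_nat.
Qed.

Lemma continuous_edot a : continuous (edot a : E -> R).
Proof.
move=> x A /nbhs_ballP[e /= e0 hA].
suff : nbhs x (edot a @^-1` A) by [].
apply/nbhs_enormP.
exists (e / (enorm a + 1)); first by rewrite divr_gt0// ltr_wpDl ?enorm_ge0.
move=> y; rewrite ltr_pdivlMr ?ltr_wpDl ?enorm_ge0// => h.
apply: hA; rewrite -ball_normE /ball_ /= -edotBr; apply: le_lt_trans h.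
have := edot_le_enorm a (x - y); have := edot_ge_enorm a (x - y).
have := enorm_ge0 (x - y); rewrite (enormB y) => *; rewrite ler_norml; nra.
Qed.

Lemma closed_halfspace a k : closed [set x | edot a x <= k].
Proof.
apply: (@closed_comp _ _ (edot a) [set z | z <= k]); last exact: closed_le.
by move=> x _; exact: continuous_edot.
Qed.

Lemma closed_hyperplane a k : closed [set x | edot a x = k].
Proof.
apply: (@closed_comp _ _ (edot a) [set z | z = k]); last exact: closed_eq.
by move=> x _; exact: continuous_edot.
Qed.

Lemma within_continuousP (g : R -> E) (A : set R) :
  {within A, continuous g} <->
  forall t : R, A t -> forall e : R, 0 < e -> exists2 dl : R, 0 < dl &
    forall s : R, A s -> `|s - t| < dl -> enorm (g s - g t) < e.
Proof.
rewrite continuous_subspace_in; split=> h t At.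
  move=> e e0.
  have /h : t \in A by rewrite inE.
  rewrite /continuous_at /= => /(_ [set y | enorm (y - g t) < e]) /=.
  have ne : nbhs (g t) [set y | enorm (y - g t) < e].
    by apply/nbhs_enormP; exists e.
  move/(_ ne); rewrite /= nbhs_simpl /=.
  rewrite {1}/nbhs /= /nbhs_subspace; case: ifPn => [_|]; last first.
    by rewrite notin_setE.
  rewrite /within /= => /nbhs_ballP[d /= d0 hd].
  exists d => // s As sd; apply: (hd s) => //.
  by rewrite -ball_normE /ball_ /= -normrN opprB.
rewrite inE in At; rewrite /continuous_at => B /nbhs_enormP[e e0 hB].
have [d d0 hd] := h t At e e0.
rewrite nbhs_simpl /= {1}/nbhs /= /nbhs_subspace; case: ifPn => [_|]; last first.
  by rewrite notin_setE.
apply/nbhs_ballP; exists d => //= s; rewrite -ball_normE /ball_ /= => ts As.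
by apply/hB/hd => //; rewrite -normrN opprB.
Qed.

Lemma continuous_enorm_comp (g : R -> E) (A : set R) z :
  {within A, continuous g} -> {within A, continuous (fun t => enorm (g t - z))}.
Proof.
move=> /within_continuousP h; rewrite continuous_subspace_in => t.
rewrite inE => At; apply/cvgrPdist_lt => e e0 /=.
have [d d0 hd] := h t At e e0.
rewrite near_simpl /prop_near1 {1}/nbhs /= /nbhs_subspace.
case: ifPn => [_|]; last by rewrite notin_setE.
apply/nbhs_ballP; exists d => //= s; rewrite -ball_normE /ball_ /= => ts As.
have := hd s As; rewrite distrC => /(_ ts).
have := enorm_tri (g s) (g t) z; have := enorm_tri (g t) (g s) z.
rewrite (enormB (g t) (g s)) => u w l.
by rewrite ltr_norml /from_subspace; lra.
Qed.

End EuclideanTopology.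

(** * Lengths of curves and intrinsic distances *)

Section PathLength.
Context {R : realType} {n : nat}.
Local Notation E := 'rV[R]_n.
Implicit Types (x y z v w : E) (g h k : R -> E) (s : seq R) (S : set E).

Fixpoint plen g (t : R) s : R :=
  if s is u :: s' then enorm (g u - g t) + plen g u s' else 0.

Lemma polygonal_lengthE g s : polygonal_length g s = plen g 0 s.
Proof.
rewrite /polygonal_length.
suff H t : \sum_(0 <= i < size s)
   enorm (g (nth 0 (t :: s) i.+1) - g (nth 0 (t :: s) i)) = plen g t s by exact: H.
by elim: s t => [|u s ih] r; rewrite ?big_nil// big_nat_recl//= ih.
Qed.

Lemma plen_cat g t s s' :
  plen g t (s ++ s') = plen g t s + plen g (last t s) s'.
Proof. by elim: s t => [|u s ih] t /=; rewrite ?add0r// ih addrA. Qed.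

Lemma plen_map g (f : R -> R) t s :
  plen (g \o f) t s = plen g (f t) (map f s).
Proof. by elim: s t => //= u s ih t; rewrite ih. Qed.

Lemma plen_le g h t s : (forall u r, enorm (g u - g r) <= enorm (h u - h r)) ->
  plen g t s <= plen h t s.
Proof. by move=> gh; elim: s t => //= u s ih t; apply: lerD. Qed.

Lemma plen_leD g h k t s :
  (forall u r, enorm (g u - g r) <= enorm (h u - h r) + enorm (k u - k r)) ->
  plen g t s <= plen h t s + plen k t s.
Proof.
move=> gh; elim: s t => /= [|u s ih] t; first by rewrite addr0.
by apply: le_trans (lerD (gh _ _) (ih _)) _; rewrite addrACA.
Qed.

Lemma path_le_map (f : R -> R) t s : {homo f : a b / a <= b} ->
  path <=%R t s -> path <=%R (f t) (map f s).
Proof. by move=> hf; elim: s t => //= u s ih t /andP[tu /ih ->]; rewrite hf. Qed.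

Lemma plen_strict g t s : path <=%R t s -> exists s',
  [/\ path <%R t s', last t s' = last t s & plen g t s' = plen g t s].
Proof.
elim: s t => [|u s ih] t /=; first by exists [::].
case/andP; rewrite le_eqVlt => /predU1P[<-|tu] /ih[s' [h1 h2 h3]].
  by exists s'; split=> //; rewrite h3 subrr enorm0 add0r.
by exists (u :: s'); split; rewrite /= ?tu ?h3.
Qed.

(** Weakly increasing sample times are enough to bound a length from below. *)
Lemma plen_le_length g t s : 0 <= t -> path <=%R t s -> last t s <= 1 ->
  ((plen g t s)%:E <= path_length g)%E.
Proof.
move=> t0 ts l1.
have /(plen_strict g)[s' [h1 h2 h3]] : path <=%R 0 (rcons (t :: s) 1).
  by rewrite rcons_path /= t0 ts.
apply: (@le_trans _ _ (plen g 0 s')%:E).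
  rewrite lee_fin h3 -cats1 plen_cat /= addr0.
  have := enorm_ge0 (g t - g 0); have := enorm_ge0 (g 1 - g (last t s)); lra.
apply: ereal_sup_ubound => /=; exists s'; last by rewrite polygonal_lengthE.
by split=> //; rewrite h2 last_rcons.
Qed.

Lemma length_le g (l : R) :
  (forall s, path <=%R 0 s -> last 0 s = 1 -> plen g 0 s <= l) ->
  (path_length g <= l%:E)%E.
Proof.
move=> h; apply: ge_ereal_sup => _ [s [h1 /eqP h2] <-].
rewrite lee_fin polygonal_lengthE h//; apply: sub_path h1 => a b; exact: ltW.
Qed.

Lemma enorm_le_length g t u : 0 <= t -> t <= u -> u <= 1 ->
  ((enorm (g u - g t))%:E <= path_length g)%E.
Proof.
move=> t0 tu u1; have := @plen_le_length g t [:: u] t0.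
by rewrite /= tu u1 addr0 => /(_ isT isT).
Qed.

Lemma length_ge0 g : (0%:E <= path_length g)%E.
Proof.
have := @enorm_le_length g 0 0 (lexx _) (lexx _) ler01.
by rewrite subrr enorm0.
Qed.

Definition subpath g (a b : R) : R -> E := fun t => g (a + t * (b - a)).

(** Replacing the part between the times [a] and [b] by its chord does not
    lengthen a curve. *)
Lemma length_subpaths g (a b : R) (l : R) : 0 <= a -> a <= b -> b <= 1 ->
  path_length g = l%:E ->
  (path_length (subpath g 0 a) + (enorm (g b - g a))%:E +
   path_length (subpath g b 1) <= l%:E)%E.
Proof.
move=> a0 ab b1 gl.
have key s s' : path <=%R 0 s -> last 0 s = 1 -> path <=%R 0 s' ->
    last 0 s' = 1 ->
    plen (subpath g 0 a) 0 s + enorm (g b - g a) + plen (subpath g b 1) 0 s' <= l.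
  move=> p1 l1 p2 l2; rewrite -lee_fin -gl.
  pose f := fun t : R => 0 + t * (a - 0); pose f' := fun t : R => b + t * (1 - b).
  have hf : {homo f : c d / c <= d}.
    by move=> c d cd; rewrite /f; nra.
  have hf' : {homo f' : c d / c <= d}.
    by move=> c d cd; rewrite /f'; nra.
  have := @plen_le_length g (f 0) (map f s ++ f' 0 :: map f' s').
  rewrite -[plen (subpath g 0 a) _ _]/(plen (g \o f) 0 s).
  rewrite -[plen (subpath g b 1) _ _]/(plen (g \o f') 0 s') (plen_map g f) (plen_map g f').
  rewrite plen_cat cat_path last_cat /= !last_map l1 l2 !path_le_map//.
  have -> : f 1 = a by rewrite /f; ring.
  have -> : f' 0 = b by rewrite /f'; ring.
  have -> : f' 1 = 1 by rewrite /f'; ring.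
  have -> : f 0 = 0 by rewrite /f; ring.
  by rewrite ab !addrA !lexx => /(_ isT isT isT).
have le s : path <=%R 0 s -> last 0 s = 1 -> (path_length (subpath g b 1) <=
    (l - enorm (g b - g a) - plen (subpath g 0 a) 0 s)%:E)%E.
  move=> p1 l1; apply: length_le => s' p2 l2.
  by have := key s s' p1 l1 p2 l2; lra.
have Lb : path_length (subpath g b 1) \is a fin_num.
  rewrite ge0_fin_numE ?length_ge0//.
  apply: le_lt_trans (le [:: 1] _ _) (ltry _) => //=.
  by rewrite ler01.
rewrite -(fineK Lb) -leeBrDr// -leeBrDr// -!EFinB.
apply: length_le => s p1 l1; have := le s p1 l1.
by rewrite -(fineK Lb) lee_fin; lra.
Qed.

(** The first path for times in [0, 1/2], the second for [1/2, 1].  Written as a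
    sum, so that chords of the concatenation are bounded by sums of chords, with
    no case distinction on the times. *)
Definition concat_path h k : R -> E := fun t =>
  h (Num.min 1 (2 * t)) + k (Num.max 0 (2 * t - 1)) - k 0.

Lemma length_concat h k (l l' : R) : (path_length h <= l%:E)%E ->
  (path_length k <= l'%:E)%E ->
  (path_length (concat_path h k) <= (l + l')%:E)%E.
Proof.
move=> hl kl; apply: length_le => s p1 l1.
pose al (t : R) := Num.min 1 (2 * t); pose be (t : R) := Num.max 0 (2 * t - 1).
have hal : {homo al : c d / c <= d}.
  by move=> c d cd; rewrite /al le_min !ge_min lexx/= ler_pM2l// cd orbT.
have hbe : {homo be : c d / c <= d}.
  by move=> c d cd; rewrite /be ge_max !le_max lexx/= lerD2r ler_pM2l// cd orbT.
apply: (@le_trans _ _ (plen (h \o al) 0 s + plen (k \o be) 0 s)).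
  apply: plen_leD => u r; apply: le_trans _ (enormD _ _).
  by rewrite /concat_path /= -/(al u) -/(al r) -/(be u) -/(be r) opprB addrA subrK addrACA opprD.
rewrite (plen_map h) (plen_map k); apply: lerD.
  rewrite -lee_fin; apply: le_trans hl; apply: plen_le_length.
  - by rewrite /al mulr0 min_r// ler01.
  - exact: path_le_map.
  - by rewrite last_map l1 /al ge_min lexx.
rewrite -lee_fin; apply: le_trans kl; apply: plen_le_length.
- by rewrite /be le_max lexx.
- exact: path_le_map.
- by rewrite last_map l1 /be ge_max ler01/=; lra.
Qed.

Lemma concat_path_in S h k x y z :
  path_in S h x y -> path_in S k y z -> path_in S (concat_path h k) x z.
Proof.
move=> [ch hS h0 h1] [ck kS k0 k1].
have l2 (t : R) : t <= 2^-1 -> concat_path h k t = h (2 * t).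
  move=> t2; rewrite /concat_path min_r ?max_l; [|lra|lra].
  by rewrite addrK.
have r2 (t : R) : 2^-1 <= t -> concat_path h k t = k (2 * t - 1).
  move=> t2; rewrite /concat_path min_l ?max_r; [|lra|lra].
  by rewrite h1 k0 addrAC subrr add0r.
split; last first.
- by rewrite r2; [rewrite (_ : 2 * 1 - 1 = 1 :> R)//; lra|lra].
- by rewrite l2 ?mulr0//; lra.
- move=> _ [t /= +] <-; rewrite in_itv/= => /andP[t0 t1].
  have [tl|tr] := leP t 2^-1.
    by rewrite l2//; apply: hS; exists (2 * t) => //=; rewrite in_itv/=; lra.
  rewrite r2; last exact: ltW.
  by apply: kS; exists (2 * t - 1) => //=; rewrite in_itv/=; lra.
apply/within_continuousP => t; rewrite /= in_itv/= => /andP[t0 t1] e e0.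
have e20 : 0 < e / 2 by rewrite divr_gt0.
have al (u : R) : 0 <= u -> u <= 1 -> `[0, 1]%classic (Num.min 1 (2 * u)).
  by move=> u0 u1; rewrite /= in_itv/= le_min ge_min lexx/= ler01/= mulr_ge0.
have be (u : R) : 0 <= u -> u <= 1 -> `[0, 1]%classic (Num.max 0 (2 * u - 1)).
  by move=> u0 u1; rewrite /= in_itv/= le_max ge_max lexx/= ler01/=; lra.
have /within_continuousP /(_ _ (al t t0 t1) _ e20)[d d0 hd] := ch.
have /within_continuousP /(_ _ (be t t0 t1) _ e20)[d' d'0 hd'] := ck.
exists (Num.min d d' / 2).
  by rewrite divr_gt0// lt_min d0 d'0.
move=> s /=; rewrite in_itv/= => /andP[s0 s1].
rewrite ltr_pdivlMr// lt_min => /andP[sd sd'].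
have st : s - t <= `|s - t| by exact: ler_norm.
have ts : t - s <= `|s - t| by rewrite distrC ler_norm.
have lt1 : enorm (h (Num.min 1 (2 * s)) - h (Num.min 1 (2 * t))) < e / 2.
  apply: hd; first exact: al.
  by rewrite ltr_norml; case: (leP 1 (2 * s)) => ?; case: (leP 1 (2 * t)) => ?; lra.
have lt2 : enorm (k (Num.max 0 (2 * s - 1)) - k (Num.max 0 (2 * t - 1))) < e / 2.
  apply: hd'; first exact: be.
  by rewrite ltr_norml; case: (leP 0 (2 * s - 1)) => ?; case: (leP 0 (2 * t - 1)) => ?; lra.
rewrite [ltRHS]splitr; apply: le_lt_trans (ltrD lt1 lt2).
apply: le_trans _ (enormD _ _).
by rewrite /concat_path opprB addrA subrK addrACA opprD.
Qed.

Definition line_path x y : R -> E := fun t => (1 - t) *: x + t *: y.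

Lemma line_pathB x y t u : line_path x y u - line_path x y t = (u - t) *: (y - x).
Proof. by apply/rowP => i; rewrite !mxE; ring. Qed.

Lemma line_path_in S x y : segment x y `<=` S -> path_in S (line_path x y) x y.
Proof.
move=> xyS; split.
- apply/within_continuousP => t _ e e0.
  exists (e / (enorm (y - x) + 1)); first by rewrite divr_gt0// ltr_wpDl ?enorm_ge0.
  move=> s _; rewrite line_pathB enormZ ltr_pdivlMr ?ltr_wpDl ?enorm_ge0//.
  by apply: le_lt_trans; rewrite ler_wpM2l// lerDl.
- by move=> _ [t t01 <-]; apply: xyS; exists t.
- by rewrite /line_path subr0 scale1r scale0r addr0.
- by rewrite /line_path subrr scale1r scale0r add0r.
Qed.

Lemma length_line x y : (path_length (line_path x y) <= (enorm (x - y))%:E)%E.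
Proof.
apply: length_le => s p1 l1.
suff H t : path <=%R t s ->
    plen (line_path x y) t s = (last t s - t) * enorm (x - y).
  by rewrite H// l1 subr0 mul1r.
elim: s t {p1 l1} => [|u s ih] t /=; first by rewrite subrr mul0r.
case/andP=> tu /ih ->; rewrite line_pathB enormZ ger0_norm ?subr_ge0//.
by rewrite enormB; ring.
Qed.

Lemma idist_ge0 S v x : (0%:E <= intrinsic_dist S v x)%E.
Proof. by apply: le_ereal_inf_tmp => _ [g _ <-]; exact: length_ge0. Qed.

Lemma idist_le S v x g : path_in S g v x ->
  (intrinsic_dist S v x <= path_length g)%E.
Proof. by move=> pg; apply: ereal_inf_lbound; exists g. Qed.

Lemma idist_ge S v x : ((enorm (x - v))%:E <= intrinsic_dist S v x)%E.
Proof.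
apply: le_ereal_inf_tmp => _ [g [_ _ <- <-] <-].
exact: (@enorm_le_length g 0 1 (lexx _) ler01 (lexx _)).
Qed.

Lemma idist_path S v x y k (l : R) : path_in S k x y ->
  (path_length k <= l%:E)%E ->
  (intrinsic_dist S v y <= intrinsic_dist S v x + l%:E)%E.
Proof.
move=> pk kl; rewrite -leeBlDr//; apply: le_ereal_inf_tmp => _ [h ph <-].
rewrite leeBlDr//.
have [hfin|/negP hinf] := boolP (path_length h \is a fin_num); last first.
  suff -> : path_length h = +oo%E by rewrite addye// leey.
  apply/eqP; rewrite -leye_eq leNgt; apply/negP => hy; apply: hinf.
  by rewrite ge0_fin_numE ?length_ge0.
apply: le_trans (idist_le (concat_path_in ph pk)) _.
by rewrite -(fineK hfin) -EFinD length_concat// fineK.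
Qed.

Lemma idist_segment S v x y : segment x y `<=` S ->
  (intrinsic_dist S v y <= intrinsic_dist S v x + (enorm (x - y))%:E)%E.
Proof. by move=> xy; apply: idist_path (line_path_in xy) (length_line x y). Qed.

Lemma idist_subset S S' v x : S `<=` S' ->
  (intrinsic_dist S' v x <= intrinsic_dist S v x)%E.
Proof.
move=> SS'; apply: le_ereal_inf_tmp => _ [g [c gS g0 g1] <-].
by apply: idist_le; split=> // y /gS /SS'.
Qed.

(** Compose each curve in [S'] with [f]: this does not lengthen it. *)
Lemma idist_retract S S' v x (f : E -> E) :
  (forall y z, enorm (f y - f z) <= enorm (y - z)) ->
  (forall y, S' y -> S (f y)) -> f v = v -> f x = x ->
  (intrinsic_dist S v x <= intrinsic_dist S' v x)%E.
Proof.
move=> lf fS fv fx; apply: le_ereal_inf_tmp => _ [g [c gS g0 g1] <-].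
apply: (@le_trans _ _ (path_length (f \o g))).
  apply: idist_le; split; rewrite /= ?g0 ?g1//; last first.
    by move=> _ [t t01 <-]; apply/fS/gS; exists t.
  apply/within_continuousP => t t01 e e0.
  have /within_continuousP /(_ t t01 e e0) [d d0 hd] := c.
  by exists d => // s s01 /(hd s s01); apply: le_lt_trans; exact: lf.
apply: ge_ereal_sup => _ [s [p1 /eqP l1] <-].
apply: (@le_trans _ _ (plen g 0 s)%:E).
  by rewrite polygonal_lengthE lee_fin; apply: plen_le => u r; exact: lf.
apply: plen_le_length; rewrite ?l1//.
by apply: sub_path p1 => a b; exact: ltW.
Qed.

Lemma subpath_in S g x y (a b : R) : path_in S g x y -> 0 <= a -> a <= b -> b <= 1 ->
  path_in S (subpath g a b) (g a) (g b).
Proof.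
move=> [c gS _ _] a0 ab b1.
have in01 (t : R) : 0 <= t -> t <= 1 -> `[0, 1]%classic (a + t * (b - a)).
  by move=> t0 t1; rewrite /= in_itv/=; nra.
split; rewrite /subpath ?mul0r ?addr0 ?mul1r ?subrKC//; last first.
  move=> _ [t /= + <-]; rewrite in_itv/= => /andP[t0 t1].
  by apply: gS; exists (a + t * (b - a)) => //; exact: in01.
apply/within_continuousP => t; rewrite /= in_itv/= => /andP[t0 t1] e e0.
have /within_continuousP /(_ _ (in01 t t0 t1) e e0) [d d0 hd] := c.
exists d => // s /=; rewrite in_itv/= => /andP[s0 s1] sd; apply: hd.
  exact: in01.
have -> : a + s * (b - a) - (a + t * (b - a)) = (s - t) * (b - a) by ring.
rewrite normrM; apply: le_lt_trans sd; rewrite ler_piMr// ger0_norm; lra.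
Qed.

(** The parts of the path before [a] and after [b], and the chord, add up to at
    most its length, while the last part leads from [g b] to the end. *)
Lemma shortest_tight S v x g (a b : R) : shortest_path S g v x ->
  0 <= a -> a <= b -> b <= 1 ->
  (intrinsic_dist S v (g a) + (enorm (g b - g a))%:E <=
   intrinsic_dist S v (g b))%E.
Proof.
move=> [pg ge gfin] a0 ab b1.
have gl : path_length g = (fine (path_length g))%:E by rewrite fineK.
have := length_subpaths a0 ab b1 gl; set l := fine _ in gl *.
have [_ _ g0 g1] := pg.
have p0 := subpath_in pg (lexx 0) a0 (le_trans ab b1).
have p1 := subpath_in pg (le_trans a0 ab) b1 (lexx 1).
move: p0 p1; rewrite g0 g1 => /idist_le d0 /idist_path d1 key.
have L1fin : path_length (subpath g b 1) \is a fin_num.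
  rewrite ge0_fin_numE ?length_ge0//; apply: le_lt_trans (ltry l).
  by apply: le_trans key; rewrite leeDr// adde_ge0 ?length_ge0// lee_fin enorm_ge0.
have := d1 v (fine (path_length (subpath g b 1))).
rewrite fineK// -ge gl => /(_ (lexx _)) le1.
rewrite -(leeD2rE _ _ L1fin); apply: le_trans le1; apply: le_trans key.
by rewrite leeD2r// leeD2r.
Qed.

Lemma shortest_fin S v x g (a : R) : shortest_path S g v x ->
  0 <= a -> a <= 1 -> intrinsic_dist S v (g a) \is a fin_num.
Proof.
move=> sg a0 a1; have [[_ _ g0 g1] ge gfin] := sg.
rewrite ge0_fin_numE ?idist_ge0//.
have := shortest_tight sg a0 a1 (lexx 1); rewrite g1 -ge => h.
apply: le_lt_trans (_ : _ < +oo)%E; first apply: le_trans h.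
  by rewrite leeDl// lee_fin enorm_ge0.
by rewrite -ge0_fin_numE ?length_ge0.
Qed.

(** This turns the distance estimates below into shortest paths that arrive along
    a prescribed segment. *)
Lemma shortest_extend S v x y g : shortest_path S g v x -> segment x y `<=` S ->
  (intrinsic_dist S v x + (enorm (x - y))%:E <= intrinsic_dist S v y)%E ->
  exists2 h, shortest_path S h v y & trace g `<=` trace h.
Proof.
move=> [pg ge gfin] xyS le.
exists (concat_path g (line_path x y)).
  have pc := concat_path_in pg (line_path_in xyS).
  have ln : (path_length (concat_path g (line_path x y)) <=
      path_length g + (enorm (x - y))%:E)%E.
    by rewrite -(fineK gfin) -EFinD length_concat// ?fineK// length_line.
  have le' : path_length (concat_path g (line_path x y)) = intrinsic_dist S v y.
    by apply/eqP; rewrite eq_le idist_le// andbT (le_trans ln)// ge.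
  split=> //; rewrite ge0_fin_numE ?length_ge0//.
  by apply: le_lt_trans ln _; rewrite -(fineK gfin) -EFinD ltry.
move=> _ [t /= + <-]; rewrite in_itv/= => /andP[t0 t1].
exists (t / 2); first by rewrite /= in_itv/=; lra.
have [_ _ _ g1] := pg.
rewrite /concat_path mulrC divfK// min_r// max_l; last by lra.
by rewrite addrK.
Qed.

End PathLength.

(** * Affine hulls and dimension *)

Section AffineSets.
Context {R : realType} {n : nat}.
Local Notation E := 'rV[R]_n.
Implicit Types (a c x y z p q w : E) (b k : R) (A T : set E) (l : seq (E * R)).

Lemma affine_hull_sub A : A `<=` affine_hull A.
Proof.
move=> x Ax; exists 1%N, (fun=> x), (fun=> 1); split=> //.
  by rewrite big_ord1.
by rewrite big_ord1 scale1r.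
Qed.

Lemma affine_hull_hyperplane A a b :
  (forall x, A x -> edot a x = b) -> forall x, affine_hull A x -> edot a x = b.
Proof.
move=> Aab _ [m [p [w [Ap w1 ->]]]].
transitivity (\sum_i w i * edot a (p i)).
  elim/big_rec2: _ => [|i y z _ <-]; first by rewrite edot0r.
  by rewrite edotDr edotZr.
under eq_bigr do rewrite (Aab _ (Ap _)).
by rewrite -mulr_suml w1 mul1r.
Qed.

(** A small multiple of any direction of the subspace stays in the neighbourhood. *)
Lemma affine_hull_nbhd A z (U : 'M[R]_n) (r : R) : A z ->
  (forall x, A x -> (x - z <= U)%MS) -> 0 < r ->
  (forall y, (y - z <= U)%MS -> enorm (y - z) < r -> A y) ->
  affine_hull A = [set x | (x - z <= U)%MS].
Proof.
move=> Az AU r0 UA; apply/seteqP; split=> [_ [m [p [w [Ap w1 ->]]]] /=|x /= xU].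
  have -> : \sum_i w i *: p i - z = \sum_i w i *: (p i - z).
    under [RHS]eq_bigr do rewrite scalerBr.
    by rewrite sumrB -scaler_suml w1 scale1r.
  by apply: summx_sub => i _; apply: scalemx_sub; exact: AU.
have d0 : 0 < enorm (x - z) + 1 by rewrite ltr_wpDl ?enorm_ge0.
pose s := r / 2 / (enorm (x - z) + 1).
have s0 : 0 < s by rewrite !divr_gt0.
pose y := z + s *: (x - z).
have yz : y - z = s *: (x - z) by rewrite /y addrAC subrr add0r.
have Ay : A y.
  apply: UA; first by rewrite yz scalemx_sub.
  rewrite yz enormZ gtr0_norm// /s mulrAC ltr_pdivrMr//.
  have := enorm_ge0 (x - z); nra.
exists 2%N, (fun i : 'I_2 => if i == 0 then z else y),
  (fun i : 'I_2 => if i == 0 then 1 - s^-1 else s^-1); split.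
- by move=> i; case: ifP.
- by rewrite big_ord_recr big_ord1 /= subrK.
- rewrite big_ord_recr big_ord1 /=; apply/rowP => j; rewrite !mxE; field.
  by rewrite gt_eqF.
Qed.

Lemma has_dim_nbhd A z (U : 'M[R]_n) (r : R) : A z ->
  (forall x, A x -> (x - z <= U)%MS) -> 0 < r ->
  (forall y, (y - z <= U)%MS -> enorm (y - z) < r -> A y) ->
  has_dim A (\rank U).
Proof. by move=> Az AU r0 UA; exists z, U; split=> //; exact: affine_hull_nbhd UA. Qed.

Lemma has_dim_le A A' (k k' : nat) : has_dim A k -> has_dim A' k' ->
  affine_hull A `<=` affine_hull A' -> (k <= k')%N.
Proof.
move=> [x [U [Ax AU <-]]] [x' [U' [Ax' AU' <-]]]; rewrite AU AU' => h.
apply: mxrankS; apply/rV_subP => u uU.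
have := h (x + u); rewrite /= addrAC subrr add0r => /(_ uU) h1.
have := h x; rewrite /= subrr sub0mx => /(_ isT) h2.
have -> : u = (x + u - x') - (x - x').
  by apply/rowP => i; rewrite !mxE; ring.
by rewrite addmx_sub// eqmx_opp.
Qed.

Lemma has_dim_inj A (k k' : nat) : has_dim A k -> has_dim A k' -> k = k'.
Proof. by move=> h h'; apply/eqP; rewrite eqn_leq (has_dim_le h h')// (has_dim_le h' h). Qed.

Lemma edot_trmx a x : (x *m a^T = 0) <-> edot a x = 0.
Proof.
rewrite edotC /edot; split=> [->|h]; first by rewrite mxE.
by apply/matrixP => i j; rewrite !ord1 h mxE.
Qed.

Lemma kermx1P a x : (x <= kermx a^T)%MS <-> edot a x = 0.
Proof. by rewrite -edot_trmx; split=> [/sub_kermxP//|/sub_kermxP]. Qed.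

Lemma kermx2P a c x :
  (x <= kermx (row_mx a^T c^T))%MS <-> edot a x = 0 /\ edot c x = 0.
Proof.
rewrite -!edot_trmx; split=> [/sub_kermxP|[xa xc]].
  by rewrite mul_mx_row -row_mx0 => /eq_row_mx.
by apply/sub_kermxP; rewrite mul_mx_row xa xc row_mx0.
Qed.

Lemma rank_kermx1 a : a != 0 -> \rank (kermx a^T) = n.-1.
Proof. by move=> a0; rewrite mxrank_ker mxrank_tr rank_rV a0 subn1. Qed.

Definition independent a c := forall s t : R, s *: a + t *: c = 0 -> s = 0 /\ t = 0.

Lemma rank_col_mx2 a c : independent a c -> \rank (col_mx a c) = 2%N.
Proof.
move=> ac; apply/eqP; apply: inj_row_free => u.
rewrite -[u]hsubmxK mul_row_col.
rewrite (mx11_scalar (lsubmx u)) (mx11_scalar (rsubmx u)) !mul_scalar_mx.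
by move=> /ac[-> ->]; rewrite -[0%:M]/(scalar_mx 0) !raddf0 row_mx0.
Qed.

Lemma rank_kermx2 a c : independent a c -> \rank (kermx (row_mx a^T c^T)) = n.-2.
Proof.
by move=> ac; rewrite mxrank_ker -tr_col_mx mxrank_tr rank_col_mx2// subn2.
Qed.

(** The orthogonal complement of a codimension-2 direction space is spanned by
    any two independent normals. *)
Lemma orthogonal_codim2 a c (U : 'M[R]_n) y : independent a c ->
  (\rank U + 2 = n)%N -> (forall u, (u <= U)%MS -> edot a u = 0 /\ edot c u = 0) ->
  (forall u, (u <= U)%MS -> edot y u = 0) ->
  exists s t, y = s *: a + t *: c.
Proof.
move=> ac rU hac hy.
have sub x : (forall u, (u <= U)%MS -> edot x u = 0) -> (x <= kermx U^T)%MS.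
  move=> h; apply/sub_kermxP/matrixP => i j; rewrite ord1 !mxE.
  have := h (row j U) (row_sub _ _); rewrite edotE => e; rewrite -[RHS]e.
  by apply: eq_bigr => l _; rewrite !mxE.
have colsub : (col_mx a c <= kermx U^T)%MS.
  by rewrite col_mx_sub !sub// => u /hac[].
have : (y <= col_mx a c)%MS.
  apply: submx_trans (sub _ hy) _.
  rewrite -(geq_leqif (mxrank_leqif_sup colsub)).
  by rewrite rank_col_mx2// mxrank_ker mxrank_tr leq_subLR rU.
case/submxP=> v ->; rewrite -[v]hsubmxK mul_row_col.
rewrite (mx11_scalar (lsubmx v)) (mx11_scalar (rsubmx v)) !mul_scalar_mx.
by eexists; eexists.
Qed.

Lemma hyperplane_dim A a b (k : nat) : a != 0 -> has_dim A k -> k = n.-1 ->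
  (forall x, A x -> edot a x = b) -> affine_hull A = [set x | edot a x = b].
Proof.
move=> a0 [x0 [U [Ax0 AU rU]]] kn Aab; rewrite AU.
have UK : (U <= kermx a^T)%MS.
  apply/rV_subP => u uU; apply/kermx1P.
  have : affine_hull A (x0 + u) by rewrite AU /= addrAC subrr add0r.
  by move/(affine_hull_hyperplane Aab); rewrite edotDr Aab//; lra.
have KU : (kermx a^T <= U)%MS.
  by rewrite -(geq_leqif (mxrank_leqif_sup UK)) rank_kermx1// rU kn.
apply/seteqP; split=> x /= h.
  by have /kermx1P := submx_trans h UK; rewrite edotBr (Aab _ Ax0); lra.
by apply: submx_trans KU; apply/kermx1P; rewrite edotBr h Aab// subrr.
Qed.

(** Otherwise the component of [c] orthogonal to [a] is a direction inside the
    hyperplane along which [c] increases. *)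
Lemma hyperplane_local a b c k x (r : R) : edot a a = 1 -> edot a x = b ->
  edot c x = k -> 0 < r ->
  (forall y, edot a y = b -> enorm (y - x) < r -> edot c y <= k) ->
  c = edot c a *: a.
Proof.
move=> a1 ax cx r0 h.
have [e eE] : exists e, e = c - edot c a *: a by eexists.
have ae : edot a e = 0 by rewrite eE !edotlrE a1 (edotC a c) mulr1 subrr.
have e0 : 0 < enorm e + 1 by rewrite ltr_wpDl ?enorm_ge0.
pose s := r / 2 / (enorm e + 1).
have s0 : 0 < s by rewrite !divr_gt0.
have := h (x + s *: e); rewrite !edotrE ax ae mulr0 addr0 => /(_ erefl).
rewrite addrAC subrr add0r enormZ gtr0_norm//.
have -> : s * enorm e < r.
  by rewrite /s mulrAC ltr_pdivrMr//; have := enorm_ge0 e; nra.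
move=> /(_ isT); rewrite cx gerDl pmulr_rle0// => ce.
have ee : edot e e = edot c e.
  by rewrite {1}eE edotBl edotZl ae mulr0 subr0.
have : e = 0.
  by apply/edot_eq0/eqP; rewrite eq_le edot_ge0 ee andbT.
by move/eqP; rewrite eE subr_eq0 => /eqP.
Qed.

End AffineSets.

(** * Systems of linear inequalities *)

Section ConstraintLists.
Context {R : realType} {n : nat}.
Local Notation E := 'rV[R]_n.
Implicit Types (x y z p q w : E) (c e f : E * R) (T C : set E) (l : seq (E * R)).

Definition polyhedron l : set E := [set x | {in l, forall c, edot c.1 x <= c.2}].

Lemma polyhedron_cons c l x :
  polyhedron (c :: l) x <-> edot c.1 x <= c.2 /\ polyhedron l x.
Proof.
split=> [h|[h1 h2] e]; last by rewrite inE => /predU1P[->//|/h2].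
split=> [|e el]; first by apply: h; rewrite inE eqxx.
by apply: h; rewrite inE el orbT.
Qed.

Lemma polyhedron_convex l x y (t : R) : 0 <= t -> t <= 1 ->
  polyhedron l x -> polyhedron l y -> polyhedron l ((1 - t) *: x + t *: y).
Proof.
move=> t0 t1 lx ly c cl; have := lx c cl; have := ly c cl.
by rewrite /= !edotrE; nra.
Qed.

Lemma strict_nbhd l x : {in l, forall c, edot c.1 x < c.2} ->
  exists2 r : R, 0 < r &
    forall y, enorm (y - x) < r -> {in l, forall c, edot c.1 y < c.2}.
Proof.
elim: l => [|c l ih] h; first by exists 1.
have [|r r0 hr] := ih.
  by move=> e el; apply: h; rewrite inE el orbT.
have := h c; rewrite inE eqxx => /(_ isT) cx.
have c0 : 0 < enorm c.1 + 1 by rewrite ltr_wpDl ?enorm_ge0.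
exists (Num.min r ((c.2 - edot c.1 x) / (enorm c.1 + 1))).
  by rewrite lt_min r0/= divr_gt0// subr_gt0.
move=> y; rewrite lt_min => /andP[yr]; rewrite ltr_pdivlMr// => yx e.
rewrite inE => /predU1P[->|]; last exact: hr.
have := edot_le_enorm c.1 (y - x); rewrite edotBr.
have := enorm_ge0 (y - x); nra.
Qed.

(** Average points where the individual inequalities are strict. *)
Lemma strict_average l C : C !=set0 ->
  (forall x y, C x -> C y -> C (2^-1 *: x + 2^-1 *: y)) -> C `<=` polyhedron l ->
  {in l, forall c, exists2 x, C x & edot c.1 x < c.2} ->
  exists2 x, C x & {in l, forall c, edot c.1 x < c.2}.
Proof.
move=> C0 Cc; elim: l => [|c l ih] Cl hl; first by case: C0 => x; exists x.
have [||x Cx xl] := ih.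
- by move=> y /Cl /polyhedron_cons[].
- by move=> e el; apply: hl; rewrite inE el orbT.
have [|y Cy cy] := hl c; first by rewrite inE eqxx.
exists (2^-1 *: x + 2^-1 *: y); first exact: Cc.
have /polyhedron_cons[cx _] := Cl x Cx.
have /polyhedron_cons[_ ly] := Cl y Cy.
move=> e; rewrite inE !edotrE => /predU1P[->|el]; first lra.
by have := xl e el; have := ly e el; rewrite /=; lra.
Qed.

(** Every boundary point of a polyhedron lies on one of its facets.  [T] is the
    ambient affine space.  Add the inequalities one at a time: the new one
    either leaves a piece of the old facet, or cuts it off, and then its own
    hyperplane meets the interior of the old polyhedron. *)
Lemma facet_through T l w p :
  (forall x y (t : R), T x -> T y -> T ((1 - t) *: x + t *: y)) ->
  T w -> T p -> polyhedron l w ->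
  {in l, forall c, edot c.1 w = c.2 -> edot c.1 p < c.2} ->
  (exists2 c, c \in l & edot c.1 w = c.2) ->
  exists c z (r : R), [/\ c \in l, edot c.1 w = c.2, T z, edot c.1 z = c.2 & 0 < r /\
    forall y, T y -> edot c.1 y = c.2 -> enorm (y - z) < r -> polyhedron l y].
Proof.
move=> aff Tw Tp; elim: l => [|c l ih] /=; first by move=> _ _ [].
move=> /polyhedron_cons[cw lw] hp act.
have hpl : {in l, forall c, edot c.1 w = c.2 -> edot c.1 p < c.2}.
  by move=> e el; apply: hp; rewrite inE el orbT.
have hpc : edot c.1 w = c.2 -> edot c.1 p < c.2 by apply: hp; rewrite inE eqxx.
have [actl|nact] := pselect (exists2 e, e \in l & edot e.1 w = e.2); last first.
  have cw' : edot c.1 w = c.2.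
    by case: act => e; rewrite inE => /predU1P[->//|el] ew; case: nact; exists e.
  have [r r0 hr] : exists2 r : R, 0 < r &
      forall y, enorm (y - w) < r -> {in l, forall c, edot c.1 y < c.2}.
    apply: strict_nbhd => e el; rewrite lt_neqAle lw// andbT.
    by apply/eqP => ew; apply: nact; exists e.
  exists c, w, r; rewrite inE eqxx; split=> //; split=> // y Ty cy yr.
  by apply/polyhedron_cons; split; [rewrite cy|move=> e el; apply/ltW/hr].
have [e [z [r [el ew Tz ez [r0 hr]]]]] := ih lw hpl actl.
(* The new inequality is strict at [w]: shrink the old piece towards [w]. *)
have [cw'|cw'] := eqVneq (edot c.1 w) c.2; last first.
  have {}cw : edot c.1 w < c.2 by rewrite lt_neqAle cw'.
  have d0 : 0 < `|edot c.1 z - edot c.1 w| + 1 by rewrite ltr_wpDl.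
  pose s := Num.min 1 ((c.2 - edot c.1 w) / 2 / (`|edot c.1 z - edot c.1 w| + 1)).
  have s0 : 0 < s by rewrite lt_min ltr01 !divr_gt0// subr_gt0.
  have s1 : s <= 1 by rewrite ge_min lexx.
  have sz : s * (edot c.1 z - edot c.1 w) < c.2 - edot c.1 w.
    have : s <= (c.2 - edot c.1 w) / 2 / (`|edot c.1 z - edot c.1 w| + 1).
      by rewrite ge_min lexx orbT.
    rewrite ler_pdivlMr// => h.
    by have := ler_wpM2l (ltW s0) (ler_norm (edot c.1 z - edot c.1 w)); lra.
  pose z' := (1 - s) *: w + s *: z.
  have [r' r'0 hr'] : exists2 r : R, 0 < r &
      forall y, enorm (y - z') < r -> {in [:: c], forall c, edot c.1 y < c.2}.
    by apply: strict_nbhd => f; rewrite inE => /eqP ->; rewrite /z' !edotrE; lra.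
  exists e, z', (Num.min r' (s * r)); rewrite inE el orbT; split=> //.
  - exact: aff.
  - by rewrite /z' !edotrE ew ez; ring.
  split; first by rewrite lt_min r'0 mulr_gt0.
  move=> y Ty ey; rewrite lt_min => /andP[yr' yr].
  apply/polyhedron_cons; split.
    by apply/ltW/(hr' y yr'); rewrite inE.
  pose y' := (1 - s^-1) *: w + s^-1 *: y.
  have -> : y = (1 - s) *: w + s *: y'.
    by apply/rowP => i; rewrite !mxE; field; rewrite gt_eqF.
  apply: polyhedron_convex => //; first exact: ltW.
  apply: hr; first exact: aff.
    by rewrite /y' !edotrE ew ey; ring.
  have -> : y' - z = s^-1 *: (y - z').
    by apply/rowP => i; rewrite !mxE; field; rewrite gt_eqF.
  by rewrite enormZ gtr0_norm ?invr_gt0// mulrC ltr_pdivrMr// mulrC.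
(* Both hyperplanes pass through [w]: see on which side of [c] the old piece is. *)
have cp := hpc cw'.
have [cz|cz|cz] := ltgtP (edot c.1 z) c.2.
- have [r' r'0 hr'] : exists2 r : R, 0 < r &
      forall y, enorm (y - z) < r -> {in [:: c], forall c, edot c.1 y < c.2}.
    by apply: strict_nbhd => f; rewrite inE => /eqP ->.
  exists e, z, (Num.min r r'); rewrite inE el orbT; split=> //.
  split; first by rewrite lt_min r0.
  move=> y Ty ey; rewrite lt_min => /andP[yr yr']; apply/polyhedron_cons.
  by split; [apply/ltW/(hr' y yr'); rewrite inE|exact: hr].
(* The old piece is cut off at [z].  On the way to [z] from a point [p'] where all
   old inequalities are strict, the hyperplane of [c] is crossed. *)
- have [s [r' [s0 r'0 hr']]] : exists s r' : R, [/\ 0 < s < 1, 0 < r' &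
      forall y, enorm (y - ((1 - s) *: w + s *: p)) < r' ->
        {in l, forall c, edot c.1 y < c.2}].
    pose l' := [seq f <- l | edot f.1 w != f.2].
    have [r1 r10 hr1] : exists2 r : R, 0 < r &
        forall y, enorm (y - w) < r -> {in l', forall c, edot c.1 y < c.2}.
      apply: strict_nbhd => f; rewrite mem_filter => /andP[fw fl].
      by rewrite lt_neqAle fw lw.
    have d0 : 0 < enorm (p - w) + 1 by rewrite ltr_wpDl ?enorm_ge0.
    pose s := Num.min 2^-1 (r1 / 2 / (enorm (p - w) + 1)).
    have s0 : 0 < s by rewrite lt_min invr_gt0 ltr0n/= !divr_gt0.
    have s1 : s < 1 by apply: (@le_lt_trans _ _ 2^-1); [rewrite ge_min lexx|lra].
    have [r' r'0 hr'] : exists2 r : R, 0 < r &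
       forall y, enorm (y - ((1 - s) *: w + s *: p)) < r ->
        {in l, forall c, edot c.1 y < c.2}.
      apply: strict_nbhd => f fl.
      have [fw|fw] := eqVneq (edot f.1 w) f.2.
        by have := hpl f fl fw; rewrite !edotrE fw; nra.
      apply: hr1; last by rewrite mem_filter fw.
      have -> : (1 - s) *: w + s *: p - w = s *: (p - w).
        by apply/rowP => i; rewrite !mxE; ring.
      rewrite enormZ gtr0_norm//.
      have : s <= r1 / 2 / (enorm (p - w) + 1) by rewrite ge_min lexx orbT.
      rewrite ler_pdivlMr//; have := enorm_ge0 (p - w); nra.
    by exists s, r'; split=> //; rewrite s0 s1.
  case/andP: s0 => s0 s1.
  have [p' p'E] : exists p', p' = (1 - s) *: w + s *: p by eexists.
  have cp' : edot c.1 p' < c.2 by rewrite p'E !edotrE cw'; nra.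
  have Tp' : T p' by rewrite p'E; exact: aff.
  rewrite -p'E in hr' => {p'E}.
  have d0 : 0 < edot c.1 z - edot c.1 p' by lra.
  pose u := (c.2 - edot c.1 p') / (edot c.1 z - edot c.1 p').
  have u0 : 0 < u by rewrite divr_gt0// subr_gt0.
  have u1 : u < 1 by rewrite ltr_pdivrMr// mul1r ltrD2r.
  exists c, ((1 - u) *: p' + u *: z), ((1 - u) * r'); rewrite inE eqxx; split=> //.
  + exact: aff.
  + rewrite !edotrE.
    have : u * (edot c.1 z - edot c.1 p') = c.2 - edot c.1 p' by rewrite divfK// gt_eqF.
    lra.
  split; first by rewrite mulr_gt0// subr_gt0.
  move=> y Ty cy yr; apply/polyhedron_cons; split; first by rewrite cy.
  pose y' := p' + (1 - u)^-1 *: (y - ((1 - u) *: p' + u *: z)).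
  have u1' : 0 < 1 - u by rewrite subr_gt0.
  have -> : y = (1 - u) *: y' + u *: z.
    by apply/rowP => i; rewrite !mxE; field; rewrite gt_eqF.
  apply: polyhedron_convex; [exact: ltW|exact: ltW| |].
  + move=> f fl; apply/ltW/hr' => //; rewrite /y' addrAC subrr add0r.
    by rewrite enormZ gtr0_norm ?invr_gt0// mulrC ltr_pdivrMr// mulrC.
  + by apply: hr => //; rewrite subrr enorm0.
(* [z] is on both hyperplanes.  Either [c] is tight on the old piece too, or moving
   [z] inside it makes [c] strict. *)
- have [hc|] := pselect (forall y, T y -> edot e.1 y = e.2 -> edot c.1 y = c.2).
    exists e, z, r; rewrite inE el orbT; split=> //; split=> // y Ty ey yr.
    by apply/polyhedron_cons; split; [rewrite hc|exact: hr].
  move=> /existsNP[y /not_implyP[Ty /not_implyP[ey /eqP cy]]].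
  have d0 : 0 < enorm (y - z) + 1 by rewrite ltr_wpDl ?enorm_ge0.
  pose t := (if edot c.1 y < c.2 then 1 else - 1) * (r / 2 / (enorm (y - z) + 1)).
  have t0 : 0 < r / 2 / (enorm (y - z) + 1) by rewrite !divr_gt0.
  pose z' := (1 - t) *: z + t *: y.
  have cz' : edot c.1 z' < c.2.
    rewrite /z' !edotrE cz /t; set q := r / 2 / _ in t0 *.
    case: ifP => [h|/negbT]; [nra|rewrite -leNgt => h].
    have : c.2 < edot c.1 y by rewrite lt_neqAle h eq_sym cy.
    nra.
  have zz' : enorm (z' - z) <= r / 2.
    have -> : z' - z = t *: (y - z) by apply/rowP => i; rewrite !mxE; ring.
    rewrite enormZ /t normrM (gtr0_norm t0).
    have -> : `|if edot c.1 y < c.2 then 1 else - 1| = 1 :> R.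
      by case: ifP => _; rewrite ?normrN normr1.
    rewrite mul1r mulrAC ler_pdivrMr//; have := enorm_ge0 (y - z); nra.
  have [r' r'0 hr'] : exists2 r : R, 0 < r &
      forall y, enorm (y - z') < r -> {in [:: c], forall c, edot c.1 y < c.2}.
    by apply: strict_nbhd => f; rewrite inE => /eqP ->.
  exists e, z', (Num.min (r / 2) r'); rewrite inE el orbT; split=> //.
  + exact: aff.
  + by rewrite /z' !edotrE ey ez; ring.
  split; first by rewrite lt_min r'0 divr_gt0.
  move=> x Tx ex; rewrite lt_min => /andP[xr xr']; apply/polyhedron_cons; split.
    by apply/ltW/(hr' x xr'); rewrite inE.
  apply: hr => //; apply: le_lt_trans (enorm_tri z' _ _) _; lra.
Qed.

End ConstraintLists.

(** * Facets of a convex polyhedron *)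

Section Facets.
Context {R : realType} {d : nat}.
Local Notation E := 'rV[R]_d.+1.
Implicit Types (x y z p q w : E) (P F : set E).

(** The outer unit normal of a facet and the value it takes there.  They are
    chosen, as the facet is given only as a set; the value at other sets is
    meaningless. *)
Definition facet_data P F : E * R := xget (0, 0) [set c | [/\ edot c.1 c.1 = 1,
  forall x, P x -> edot c.1 x <= c.2, F = P `&` [set x | edot c.1 x = c.2] &
  affine_hull F = [set x | edot c.1 x = c.2]]].

Definition normal P F : E := (facet_data P F).1.

(** The distance to the hyperplane of a facet, signed so as to be nonnegative on
    the polyhedron. *)
Definition gap P F x : R := (facet_data P F).2 - edot (normal P F) x.

(** Unfolds [gap] also where [P] is hidden by a local abbreviation. *)
Lemma gapE P F x : gap P F x = (facet_data P F).2 - edot (normal P F) x.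
Proof. by []. Qed.

Lemma gap_line P F x y (t : R) :
  gap P F ((1 - t) *: x + t *: y) = (1 - t) * gap P F x + t * gap P F y.
Proof. by rewrite /gap !edotrE; ring. Qed.

Lemma gapD P F x y : gap P F (x + y) = gap P F x - edot (normal P F) y.
Proof. by rewrite /gap edotDr; ring. Qed.

Lemma gapB P F x y : gap P F x - gap P F y = edot (normal P F) (y - x).
Proof. by rewrite /gap edotBr; ring. Qed.

Lemma gap_segment0 P F x y z : gap P F x = 0 -> gap P F y = 0 ->
  segment x y z -> gap P F z = 0.
Proof. by move=> x0 y0 /segmentP[t [_ _ ->]]; rewrite gap_line x0 y0 !mulr0 addr0. Qed.

Lemma gap_segment_strict P F x y z : segment x y z -> 0 <= gap P F x ->
  0 < gap P F y -> gap P F z = 0 -> z = x.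
Proof.
case/segmentP=> t [t0 t1 ->]; rewrite gap_line => hx hy h.
suff -> : t = 0 by rewrite subr0 scale1r scale0r addr0.
nra.
Qed.

Lemma polyhedron_list P : convex_polyhedron P -> exists l : seq (E * R),
  [/\ P = polyhedron l, {in l, forall c, c.1 != 0} & affine_hull P = setT].
Proof.
move=> [[m [a [b [a0 ->]]]] hull].
exists [seq (a i, b i) | i <- enum 'I_m]; split=> //; last first.
  by move=> _ /mapP[i _ ->]; exact: a0.
apply/seteqP; split=> x /= h; last first.
  by move=> i; apply: (h (a i, b i)); apply/mapP; exists i; rewrite ?mem_enum.
by move=> _ /mapP[i _ ->]; exact: h.
Qed.

Section OnePolyhedron.
Context {P : set E} (HP : convex_polyhedron P).

Lemma polyhedronT_convex x y (t : R) : 0 <= t -> t <= 1 ->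
  P x -> P y -> P ((1 - t) *: x + t *: y).
Proof. by have [l [-> _ _]] := polyhedron_list HP; exact: polyhedron_convex. Qed.

Lemma polyhedron_segment x y : P x -> P y -> segment x y `<=` P.
Proof. by move=> Px Py z /segmentP[t [t0 t1 ->]]; exact: polyhedronT_convex. Qed.

Lemma polyhedron_closed : closed P.
Proof.
have [[m [a [b [_ ->]]]] _] := HP.
have -> : [set x | forall i, edot (a i) x <= b i] =
    \bigcap_(i in [set: 'I_m]) [set x | edot (a i) x <= b i].
  by apply/seteqP; split=> x h i; [move=> _; exact: h|exact: h].
by apply: closed_bigI => i _; exact: closed_halfspace.
Qed.

Lemma polyhedron_off_hyperplane (a : E) (b : R) : a != 0 ->
  (forall x, P x -> edot a x <= b) -> exists2 x, P x & edot a x < b.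
Proof.
move=> a0 aP; apply: contrapT => h.
have aE x : P x -> edot a x = b.
  move=> Px; apply/eqP; rewrite eq_le aP//= leNgt; apply/negP => ab.
  by apply: h; exists x.
have HT x : edot a x = b.
  by apply: (affine_hull_hyperplane aE); rewrite (proj2 HP).
have := edot_gt0 a0; have := HT 0; have := HT a; rewrite edot0r; lra.
Qed.

Lemma interior_polyhedronP x : interior P x <->
  exists2 r : R, 0 < r & forall y, enorm (y - x) < r -> P y.
Proof. exact: nbhs_enormP. Qed.

Lemma surfaceP x : surface P x <-> P x /\ ~ interior P x.
Proof.
rewrite /surface /setD /=.
by have /closure_id <- := polyhedron_closed.
Qed.

Lemma surface_sub : surface P `<=` P. Proof. by move=> x /surfaceP[]. Qed.

(** A small step along the normal [a] leaves [P]. *)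
Lemma supporting_not_interior (a : E) (b : R) x : a != 0 ->
  (forall y, P y -> edot a y <= b) -> b <= edot a x -> ~ interior P x.
Proof.
move=> a0 aP bx /interior_polyhedronP[r r0 h].
have e0 := enorm_gt0 a0.
have /h/aP : enorm (x + (r / 2 / enorm a) *: a - x) < r.
  rewrite addrAC subrr add0r enormZ gtr0_norm ?divr_gt0// divfK ?gt_eqF//; lra.
rewrite !edotrE -enorm_sqr.
have : 0 < r / 2 / enorm a * enorm a ^+ 2 by rewrite !mulr_gt0// ?invr_gt0.
lra.
Qed.

Lemma hyperplane_facet_data F : facet P F -> exists a (b : R),
  [/\ edot a a = 1,
  forall x, P x -> edot a x <= b, F = P `&` [set x | edot a x = b] &
  affine_hull F = [set x | edot a x = b]].
Proof.
move=> [[[x0 Fx0] [a [b [aP FE]]]] dF].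
have a0 : a != 0.
  apply/eqP => a0.
  have FP : F = P.
    rewrite FE; apply/seteqP; split=> [x []//|x Px]; split=> //=.
    by move: Fx0; rewrite FE a0 /= !edot0l => -[_ <-].
  have [x [U [_ hU rU]]] := dF.
  have /(congr1 (fun A : set E => A x)) hx : [set y | (y - x <= U)%MS] = setT.
    by rewrite -hU FP (proj2 HP).
  have fU : (1%:M <= U)%MS.
    apply/rV_subP => u _; have : [set y | (y - x <= U)%MS] (x + u).
      by rewrite -hU FP (proj2 HP).
    by rewrite /= addrAC subrr add0r.
  by have := mxrankS fU; rewrite mxrank1 rU ltnn.
have e0 := enorm_gt0 a0; have ei0 : 0 < (enorm a)^-1 by rewrite invr_gt0.
have FE' : forall x, F x -> edot a x = b by move=> x; rewrite FE => -[].
exists ((enorm a)^-1 *: a), ((enorm a)^-1 * b); split.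
- rewrite edotZl edotZr -enorm_sqr; field; exact: lt0r_neq0.
- by move=> x /aP; rewrite edotZl ler_pM2l.
- rewrite FE; apply/seteqP; split=> x [Px /= h]; split=> //=.
    by rewrite edotZl h.
  by move: h; rewrite edotZl => /(mulfI (lt0r_neq0 ei0)).
- rewrite (hyperplane_dim a0 dF erefl FE'); apply/seteqP; split=> x /= h.
    by rewrite edotZl h.
  by move: h; rewrite edotZl => /(mulfI (lt0r_neq0 ei0)).
Qed.

Lemma facet_dataP F : facet P F -> [/\ edot (normal P F) (normal P F) = 1,
  forall x, P x -> 0 <= gap P F x, forall x, F x <-> P x /\ gap P F x = 0 &
  affine_hull F = [set x | gap P F x = 0]].
Proof.
move=> /hyperplane_facet_data[a [b h]].
have [h1 h2 h3 h4] : [set c : E * R | [/\ edot c.1 c.1 = 1,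
  forall x, P x -> edot c.1 x <= c.2, F = P `&` [set x | edot c.1 x = c.2] &
  affine_hull F = [set x | edot c.1 x = c.2]]] (facet_data P F).
  by apply: xgetPex; exists (a, b).
split=> //.
- by move=> x /h2; rewrite /gap subr_ge0.
- move=> x; rewrite {1}h3 /gap /=.
  by split=> -[Px]; [move=> ->; rewrite subrr|move/eqP; rewrite subr_eq0 => /eqP <-].
- rewrite h4 /gap; apply/seteqP; split=> x /=; first by move=> ->; rewrite subrr.
  by move/eqP; rewrite subr_eq0 => /eqP <-.
Qed.

Lemma segment_mid x y : segment x y (2^-1 *: x + 2^-1 *: y).
Proof.
by apply/segmentP; exists 2^-1; split; [lra|lra|congr (_ *: _ + _); lra].
Qed.

(** A convex part of a polyhedron has relative interior points: average witnesses
    of the inequalities that are not equalities on it. *)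
Lemma convex_relint (C : set E) : C !=set0 ->
  (forall x y, C x -> C y -> C (2^-1 *: x + 2^-1 *: y)) -> C `<=` P ->
  exists2 x, C x & exists2 r : R, 0 < r &
    forall y, affine_hull C y -> enorm (y - x) < r -> P y.
Proof.
move=> C0 Cc CP; have [l [PE l0 _]] := polyhedron_list HP.
pose l' := [seq c <- l | `[< exists2 x, C x & edot c.1 x < c.2 >]].
have Cl x : C x -> {in l, forall c, edot c.1 x <= c.2}.
  by move/CP; rewrite PE.
have [||x Cx hx] := @strict_average _ _ l' C C0 Cc.
- by move=> x /Cl h c; rewrite mem_filter => /andP[_ /h].
- by move=> c; rewrite mem_filter => /andP[/asboolP].
exists x => //; have [r r0 hr] := strict_nbhd hx; exists r => // y yC yr.
rewrite PE => c cl; have [cF|] := boolP (c \in l'); first exact/ltW/hr.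
rewrite mem_filter cl andbT => /asboolPn h.
have cE z : C z -> edot c.1 z = c.2.
  move=> Cz; apply/eqP; rewrite eq_le Cl//= leNgt; apply/negP => cz.
  by apply: h; exists z.
by rewrite (affine_hull_hyperplane cE).
Qed.

Section OneFacet.
Context {F : set E} (fF : facet P F).

Lemma normal_unit : edot (normal P F) (normal P F) = 1.
Proof. by have [] := facet_dataP fF. Qed.

Lemma normal_neq0 : normal P F != 0.
Proof. by apply/eqP => h; have := normal_unit; rewrite h edot0l; lra. Qed.

Lemma gap_ge0 x : P x -> 0 <= gap P F x.
Proof. by have [_ + _ _] := facet_dataP fF; exact. Qed.

Lemma facetE x : F x <-> P x /\ gap P F x = 0.
Proof. by have [_ _ + _] := facet_dataP fF; exact. Qed.

Lemma facet_hull : affine_hull F = [set x | gap P F x = 0].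
Proof. by have [_ _ _ +] := facet_dataP fF; exact. Qed.

Lemma facet_sub x : F x -> P x. Proof. by move/facetE => []. Qed.

Lemma facet_gap x : F x -> gap P F x = 0. Proof. by move/facetE => []. Qed.

Lemma gap_le0_not_interior x : gap P F x <= 0 -> ~ interior P x.
Proof.
move=> h; apply: (supporting_not_interior normal_neq0 (b := (facet_data P F).2)).
  by move=> y /gap_ge0; rewrite subr_ge0.
by move: h; rewrite /gap subr_le0.
Qed.

Lemma facet_surface : F `<=` surface P.
Proof.
move=> x /facetE[Px x0]; apply/surfaceP; split=> //.
by apply: gap_le0_not_interior; rewrite x0.
Qed.

Lemma facet_segment x y : F x -> F y -> segment x y `<=` F.
Proof.
move=> /facetE[Px x0] /facetE[Py y0] z xyz; apply/facetE; split.
  exact: polyhedron_segment xyz.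
exact: gap_segment0 xyz.
Qed.

Lemma facet_closed : closed F.
Proof.
have [a [b [_ _ -> _]]] := hyperplane_facet_data fF.
by apply: closedI; [exact: polyhedron_closed|exact: closed_hyperplane].
Qed.

Lemma gap_pos_point : exists2 x, P x & 0 < gap P F x.
Proof.
have [|x Px hx] := polyhedron_off_hyperplane normal_neq0 (b := (facet_data P F).2).
  by move=> y /gap_ge0; rewrite subr_ge0.
by exists x; rewrite ?subr_gt0.
Qed.

Lemma relint_facetP x : relint F x <-> F x /\ exists2 r : R, 0 < r &
  forall y, gap P F y = 0 -> enorm (y - x) < r -> P y.
Proof.
rewrite /relint facet_hull /= /within /=; split=> -[Fx].
  move=> /nbhs_enormP[r r0 h]; split=> //; exists r => // y y0 yr.
  exact/facet_sub/h.
move=> [r r0 h]; split=> //; apply/nbhs_enormP; exists r => // y yr y0.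
by apply/facetE; split=> //; exact: h.
Qed.

Lemma relint_sub x : relint F x -> F x. Proof. by case. Qed.

Lemma facet_relint_point : exists x, relint F x.
Proof.
have [|||x Fx [r r0 h]] := @convex_relint F.
- by case: fF => -[].
- by move=> x y Fx Fy; apply: (facet_segment Fx Fy); exact: segment_mid.
- exact: facet_sub.
exists x; apply/relint_facetP; split=> //; exists r => // y y0.
by apply: h; rewrite facet_hull.
Qed.

(** The ball around [x] shrinks to a ball around the new point under the
    contraction towards [y], and [P] is convex. *)
Lemma relint_line x y (t : R) : relint F x -> F y -> 0 <= t -> t < 1 ->
  relint F ((1 - t) *: x + t *: y).
Proof.
move=> /relint_facetP[Fx [r r0 h]] Fy t0 t1; apply/relint_facetP; split.
  by apply: (@facet_segment x y) => //; apply/segmentP; exists t; split=> //; exact: ltW.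
have t1' : 0 < 1 - t by rewrite subr_gt0.
exists ((1 - t) * r); first by rewrite mulr_gt0.
move=> z z0 zr; pose z' := x + (1 - t)^-1 *: (z - ((1 - t) *: x + t *: y)).
have -> : z = (1 - t) *: z' + t *: y.
  by apply/rowP => i; rewrite !mxE; field; rewrite gt_eqF.
apply: polyhedronT_convex => //; [exact: ltW| |exact: facet_sub].
apply: h.
  rewrite gapD edotZr -gapB gap_line z0 !facet_gap//; lra.
by rewrite addrAC subrr add0r enormZ gtr0_norm ?invr_gt0// mulrC ltr_pdivrMr// mulrC.
Qed.

End OneFacet.

Lemma relint_facet_eq F F' x : facet P F -> facet P F' -> relint F x -> F' x ->
  F = F'.
Proof.
move=> fF fF' /(relint_facetP fF)[Fx [r r0 h]] F'x.
have e : normal P F' = edot (normal P F') (normal P F) *: normal P F.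
  apply: (@hyperplane_local _ _ _ (facet_data P F).2 _ (facet_data P F').2 x r) => //.
  - exact: normal_unit.
  - by have /eqP := facet_gap fF Fx; rewrite subr_eq0 => /eqP.
  - by have /eqP := facet_gap fF' F'x; rewrite subr_eq0 => /eqP.
  - move=> y y0 yr; rewrite -subr_ge0; apply: (gap_ge0 fF'); apply: h => //.
    by rewrite /gap y0 subrr.
set k := edot (normal P F') (normal P F) in e.
have k0 : k != 0.
  by apply/eqP => k0; have := normal_neq0 fF'; rewrite e k0 scale0r eqxx.
have gapE y : gap P F' y = k * gap P F y.
  have := gapB P F' y x; have := gapB P F y x.
  by rewrite (facet_gap fF' F'x) (facet_gap fF Fx) !subr0 e edotZl => -> ->.
apply/seteqP; split=> y.
  move=> Fy; apply/(facetE fF'); split; first exact: facet_sub Fy.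
  by rewrite gapE (facet_gap fF Fy) mulr0.
move=> Fy; apply/(facetE fF); split; first exact: facet_sub Fy.
by apply: (mulfI k0); rewrite -gapE mulr0 (facet_gap fF' Fy).
Qed.

Lemma constraint_facet (c : E * R) z (r : R) : c.1 != 0 ->
  (forall x, P x -> edot c.1 x <= c.2) -> edot c.1 z = c.2 -> 0 < r ->
  (forall y, edot c.1 y = c.2 -> enorm (y - z) < r -> P y) ->
  facet P (P `&` [set x | edot c.1 x = c.2]).
Proof.
move=> c0 cP cz r0 h.
have Pz : P z by apply: h => //; rewrite subrr enorm0.
split; first by split; [exists z|exists c.1, c.2].
rewrite -[d in has_dim _ d]/(d.+1.-1) -(rank_kermx1 c0).
apply: (@has_dim_nbhd _ _ _ z _ r) => //.
  by move=> x [_ /= cx]; apply/kermx1P; rewrite edotBr cx cz subrr.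
move=> y /kermx1P; rewrite edotBr cz => /eqP; rewrite subr_eq0 => /eqP cy yr.
by split=> //; exact: h.
Qed.

(** The inequalities that are tight on a facet already account for the whole
    boundary: at a boundary point some inequality is tight, so [facet_through]
    gives a facet there. *)
Lemma facet_list : exists s : seq (E * R), [/\ {in s, forall c,
    facet P (P `&` [set x | edot c.1 x = c.2])}, P `<=` polyhedron s &
  forall x, surface P x -> exists2 c, c \in s & edot c.1 x = c.2].
Proof.
have [l [PE l0 hull]] := polyhedron_list HP.
pose s := [seq c <- l | `[< facet P (P `&` [set x | edot c.1 x = c.2]) >]].
exists s; split; first by move=> c; rewrite mem_filter => /andP[/asboolP].
  by move=> x; rewrite PE => h c; rewrite mem_filter => /andP[_ /h].
move=> x /surfaceP[Px nx].
have lP c : c \in l -> forall y, P y -> edot c.1 y <= c.2.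
  by move=> cl y; rewrite PE; exact.
have [||||p Pp hp] := @strict_average _ _ l P.
- by exists x.
- move=> y z Py Pz; have := @polyhedronT_convex y z 2^-1 _ _ Py Pz.
  by rewrite (_ : 1 - 2^-1 = 2^-1 :> R); [apply; lra|lra].
- by rewrite PE.
- move=> c cl; apply: polyhedron_off_hyperplane; [exact: l0|exact: lP].
have [|||c [z [r [cl cx _ cz [r0 hr]]]]] :=
    @facet_through _ _ setT l x p (fun _ _ _ _ _ => I) I I.
- by rewrite -PE.
- by move=> c cl _; exact: hp.
- apply: contrapT => h; apply: nx; apply/interior_polyhedronP.
  have [|r r0 hr] := @strict_nbhd _ _ l x.
    move=> c cl; rewrite lt_neqAle lP// andbT; apply/eqP => cx.
    by apply: h; exists c.
  by exists r => // y yr; rewrite PE => c cl; exact/ltW/hr.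
exists c => //; rewrite mem_filter cl andbT; apply/asboolP.
apply: (@constraint_facet _ z r) => //; [exact: l0|exact: lP|].
by move=> y cy yr; rewrite PE; exact: hr.
Qed.

Lemma facet_cover x : surface P x -> exists2 F, facet P F & F x.
Proof.
have [s [sF _ sx]] := facet_list; move=> Sx; have [c cs cx] := sx x Sx.
by exists (P `&` [set x | edot c.1 x = c.2]); [exact: sF|split=> //; exact: surface_sub].
Qed.

Lemma facets_finite : exists s : seq (set E), forall F, facet P F <-> F \in s.
Proof.
have [s [sF _ sx]] := facet_list.
exists [seq P `&` [set x | edot c.1 x = c.2] | c <- s] => F; split; last first.
  by move=> /mapP[c cs ->]; exact: sF.
move=> fF; have [x xF] := facet_relint_point fF.
have Sx : surface P x by apply: (facet_surface fF); exact: relint_sub.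
have [c cs cx] := sx x Sx; apply/mapP; exists c => //.
apply: (relint_facet_eq fF _ xF); first exact: sF.
by split=> //; exact: surface_sub.
Qed.

End OnePolyhedron.
End Facets.

(** * Ridges and the two facets around them *)

Section Ridges.
Context {R : realType} {d : nat}.
Local Notation E := 'rV[R]_d.+1.
Implicit Types (x y z p q w : E) (F G : set E).
Context {P : set E} (HP : convex_polyhedron P).

Local Notation gap := (gap P).
Local Notation normal := (normal P).

(** The codimension-2 intersection of two facet hyperplanes lies in [P] around
    [q]: then [q] is in the relative interior of a common ridge. *)
Definition ridge_nbhd F F' q := exists2 r : R, 0 < r &
  forall z, gap F z = 0 -> gap F' z = 0 -> enorm (z - q) < r -> P z.

Lemma other_facet_point F F' : facet P F -> facet P F' -> F <> F' ->
  exists2 x, relint F x & 0 < gap F' x.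
Proof.
move=> fF fF' ne; have [x xF] := facet_relint_point HP fF; exists x => //.
rewrite lt0r (gap_ge0 HP fF') ?andbT; last exact/(facet_sub HP fF)/relint_sub.
apply/eqP => x0; apply: ne; apply: (relint_facet_eq HP fF fF' xF).
by apply/(facetE HP fF'); split=> //; exact/(facet_sub HP fF)/relint_sub.
Qed.

Section TwoFacets.
Context {F F' : set E} (fF : facet P F) (fF' : facet P F') (ne : F <> F').

Lemma normals_independent q : F q -> F' q -> independent (normal F) (normal F').
Proof.
move=> Fq F'q s t st.
have [x /relint_sub/(facet_gap HP fF) x0 x1] := other_facet_point fF fF' ne.
have [y /relint_sub/(facet_gap HP fF') y0 y1] :=
  other_facet_point fF' fF (fun e => ne (esym e)).
have q0 := facet_gap HP fF Fq; have q0' := facet_gap HP fF' F'q.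
have hx : s * edot (normal F) (x - q) + t * edot (normal F') (x - q) = 0.
  by rewrite -!edotZl -edotDl st edot0l.
have hy : s * edot (normal F) (y - q) + t * edot (normal F') (y - q) = 0.
  by rewrite -!edotZl -edotDl st edot0l.
move: hx hy; rewrite -!gapB q0 q0' x0 y0 !subr0 !sub0r !mulr0 add0r addr0.
move=> /eqP + /eqP; rewrite !mulf_eq0 !oppr_eq0 (gt_eqF x1) (gt_eqF y1) !orbF.
by move=> /eqP -> /eqP ->.
Qed.

Lemma normals_not_opposite q : F q -> F' q -> 0 < 1 + edot (normal F) (normal F').
Proof.
move=> Fq F'q; have ind := normals_independent Fq F'q.
have n0 : normal F + normal F' != 0.
  apply/eqP => h; have [] := ind 1 1; rewrite ?scale1r// => /eqP.
  by rewrite oner_eq0.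
have := edot_gt0 n0; rewrite !edotlrE (normal_unit HP fF) (normal_unit HP fF').
rewrite (edotC (normal F')); lra.
Qed.

Lemma normals_not_parallel q : F q -> F' q ->
  0 < 1 - edot (normal F) (normal F') ^+ 2.
Proof.
move=> Fq F'q; have ind := normals_independent Fq F'q.
set c := edot _ _.
have n0 : normal F - c *: normal F' != 0.
  apply/eqP => h; have [] := ind 1 (- c); first by rewrite scale1r scaleNr.
  by move=> /eqP; rewrite oner_eq0.
have := edot_gt0 n0; rewrite !edotlrE (normal_unit HP fF) (normal_unit HP fF').
rewrite (edotC (normal F')) -/c; lra.
Qed.

(** At a relative interior point of a ridge the polyhedron is locally the wedge
    between the two facet hyperplanes: every nearby point of the wedge is a
    convex combination of a point of the ridge and one point of each facet. *)
Lemma ridge_wedge q : F q -> F' q -> ridge_nbhd F F' q -> exists2 r : R, 0 < r &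
  forall y, enorm (y - q) < r -> 0 <= gap F y -> 0 <= gap F' y -> P y.
Proof.
move=> Fq F'q [r r0 h].
have [m /relint_sub Fm m1] := other_facet_point fF fF' ne.
have [m' /relint_sub Fm' m1'] := other_facet_point fF' fF (fun e => ne (esym e)).
have m0 := facet_gap HP fF Fm; have m0' := facet_gap HP fF' Fm'.
have q0 := facet_gap HP fF Fq; have q0' := facet_gap HP fF' F'q.
have unit_gap H x : facet P H -> H q -> gap H x <= enorm (x - q).
  move=> fH Hq; have := edot_ge_enorm (normal H) (x - q).
  have -> : enorm (normal H) = 1 by rewrite /enorm (normal_unit HP fH) sqrtr1.
  by rewrite mul1r -gapB (facet_gap HP fH Hq); lra.
pose u := (gap F' m)^-1; pose u' := (gap F m')^-1.
have u0 : 0 < u by rewrite invr_gt0.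
have u0' : 0 < u' by rewrite invr_gt0.
pose K := 1 + u * enorm (m - q) + u' * enorm (m' - q) + r * (u + u').
have K1 : 0 < K.
  have a1 := mulr_ge0 (ltW u0) (enorm_ge0 (m - q)).
  have a2 := mulr_ge0 (ltW u0') (enorm_ge0 (m' - q)).
  by have a3 := mulr_gt0 r0 (addr_gt0 u0 u0'); rewrite /K; lra.
exists (r / K); first by rewrite divr_gt0.
move=> y; rewrite ltr_pdivlMr// /K => yr y0 y0'.
have e0 := enorm_ge0 (y - q); have em := enorm_ge0 (m - q).
have em' := enorm_ge0 (m' - q).
pose s := u * gap F' y; pose s' := u' * gap F y.
have sg : s * gap F' m = gap F' y by rewrite /s mulrAC mulVf ?mul1r// gt_eqF.
have sg' : s' * gap F m' = gap F y by rewrite /s' mulrAC mulVf ?mul1r// gt_eqF.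
have s0 : 0 <= s by rewrite mulr_ge0// ltW.
have s0' : 0 <= s' by rewrite mulr_ge0// ltW.
have sl : s <= u * enorm (y - q) by rewrite ler_pM2l// unit_gap.
have sl' : s' <= u' * enorm (y - q) by rewrite ler_pM2l// unit_gap.
clearbody u u' s s'.
have p1 := mulr_ge0 e0 (mulr_ge0 (ltW u0) em).
have p2 := mulr_ge0 e0 (mulr_ge0 (ltW u0') em').
have ss : s + s' < 1.
  rewrite -(ltr_pM2l r0); nra.
have d0 : 0 < 1 - s - s' by lra.
have d1 : 0 < 1 - s by lra.
pose z := (1 - s - s')^-1 *: (y - s *: m - s' *: m').
have yE : y = (1 - s - s') *: z + s' *: m' + s *: m.
  by apply/rowP => i; rewrite !mxE; field; rewrite gt_eqF.
have gy H : gap H y = (1 - s - s') * gap H z + s' * gap H m' + s * gap H m.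
  by rewrite {1}yE !gapE !edotrE; ring.
have Pz : P z.
  apply: h.
  - by have := gy F; rewrite m0 => h'; apply: (mulfI (lt0r_neq0 d0)); lra.
  - by have := gy F'; rewrite m0' => h'; apply: (mulfI (lt0r_neq0 d0)); lra.
  have -> : z - q = (1 - s - s')^-1 *: ((y - q) + (s *: (q - m) + s' *: (q - m'))).
    by apply/rowP => i; rewrite !mxE; field; rewrite gt_eqF.
  rewrite enormZ gtr0_norm ?invr_gt0// mulrC ltr_pdivrMr//.
  apply: le_lt_trans (enormD _ _) _.
  apply: le_lt_trans (lerD (lexx _) (enormD _ _)) _.
  rewrite !enormZ !ger0_norm// (enormB q m) (enormB q m').
  have := ler_wpM2r em sl; have := ler_wpM2r em' sl'.
  nra.
have -> : y = (1 - s) *: ((1 - s' / (1 - s)) *: z + (s' / (1 - s)) *: m') + s *: m.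
  by rewrite {1}yE; apply/rowP => i; rewrite !mxE; field; rewrite !lt0r_neq0.
apply: (polyhedronT_convex HP) => //; [lra| |exact: (facet_sub HP fF)].
apply: (polyhedronT_convex HP) => //; [|rewrite ler_pdivrMr//; lra|exact: (facet_sub HP fF')].
by rewrite divr_ge0// ltW.
Qed.

(** A third facet through [q] would have relative interior points in the open
    wedge, which consists of interior points of [P]. *)
Lemma ridge_two_facets q H : F q -> F' q -> ridge_nbhd F F' q ->
  facet P H -> H q -> H = F \/ H = F'.
Proof.
move=> Fq F'q rn fH Hq.
have [r r0 hr] := ridge_wedge Fq F'q rn.
have [p pH] := facet_relint_point HP fH.
have d0 : 0 < enorm (p - q) + 1 by rewrite ltr_wpDl ?enorm_ge0.
pose t := Num.min 2^-1 (r / 2 / (enorm (p - q) + 1)).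
have t0 : 0 < t by rewrite lt_min invr_gt0 ltr0n/= !divr_gt0.
have t1 : t < 1 by apply: (@le_lt_trans _ _ 2^-1); [rewrite ge_min lexx|lra].
have yH : relint H ((1 - (1 - t)) *: p + (1 - t) *: q).
  by apply: (relint_line HP fH) => //; lra.
set y := _ + _ in yH.
have Hy := relint_sub yH; have Py := facet_sub HP fH Hy.
have [y0|y0] := eqVneq (gap F y) 0.
  by left; apply: (relint_facet_eq HP fH fF yH); apply/(facetE HP fF).
have [y0'|y0'] := eqVneq (gap F' y) 0.
  by right; apply: (relint_facet_eq HP fH fF' yH); apply/(facetE HP fF').
have gy : 0 < gap F y by rewrite lt0r y0 (gap_ge0 HP fF).
have gy' : 0 < gap F' y by rewrite lt0r y0' (gap_ge0 HP fF').
have yq : enorm (y - q) < r.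
  have -> : y - q = t *: (p - q) by apply/rowP => i; rewrite !mxE; ring.
  rewrite enormZ gtr0_norm//.
  have : t <= r / 2 / (enorm (p - q) + 1) by rewrite ge_min lexx orbT.
  rewrite ler_pdivlMr//; have := enorm_ge0 (p - q); nra.
have /surfaceP[//|_ []] := facet_surface HP fH Hy.
apply/interior_polyhedronP.
pose c := [:: (normal F, (facet_data P F).2); (normal F', (facet_data P F').2)].
have [|r' r'0 h] := @strict_nbhd _ _ c y.
  by move=> e; rewrite !inE => /orP[] /eqP -> /=; rewrite -subr_gt0.
exists (Num.min r' (r - enorm (y - q))); first by rewrite lt_min r'0 subr_gt0.
move=> z; rewrite lt_min => /andP[zr' zr]; apply: hr.
- apply: le_lt_trans (enorm_tri y _ _) _; lra.
- by rewrite subr_ge0; apply/ltW/(h z zr' (normal F, _)); rewrite inE eqxx.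
- by rewrite subr_ge0; apply/ltW/(h z zr' (normal F', _)); rewrite !inE eqxx orbT.
Qed.

End TwoFacets.

(** The ridge is [F `&` F'], supported by the sum of the two normals. *)
Lemma ridge_nbhd_share F F' q : facet P F -> facet P F' -> F <> F' ->
  F q -> F' q -> ridge_nbhd F F' q -> share_ridge P F F' /\
  exists G, [/\ ridge P G, G `<=` F, G `<=` F' & G q].
Proof.
move=> fF fF' ne Fq F'q [r r0 h].
have ind := normals_independent fF fF' ne Fq F'q.
suff [G [h1 h2 h3 h4]] : exists G, [/\ ridge P G, G `<=` F, G `<=` F' & G q].
  by split; last exists G; split=> //; exists G.
exists (F `&` F'); split; [|by move=> x []|by move=> x []|by []].
split.
  split; first by exists q.
  exists (normal F + normal F'), ((facet_data P F).2 + (facet_data P F').2).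
  split=> [x Px|].
    have := gap_ge0 HP fF Px; have := gap_ge0 HP fF' Px.
    by rewrite !gapE edotDl; lra.
  apply/seteqP; split=> x.
    move=> [/(facetE HP fF)[Px x0] /(facetE HP fF')[_ x0']]; split=> //=.
    by move: x0 x0'; rewrite !gapE edotDl; lra.
  move=> [Px /=]; have := gap_ge0 HP fF Px; have := gap_ge0 HP fF' Px.
  rewrite edotDl => g1 g2 e; split; [apply/(facetE HP fF)|apply/(facetE HP fF')];
    by split=> //; move: g1 g2; rewrite !gapE; lra.
have d2 : (2 <= d.+1)%N by rewrite -(rank_col_mx2 ind) rank_leq_col.
exists d.-1; last by rewrite prednK.
rewrite -[d.-1]/(d.+1.-2) -(rank_kermx2 ind).
apply: (@has_dim_nbhd _ _ _ q _ r) => //.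
  move=> x [/(facet_gap HP fF) x0 /(facet_gap HP fF') x0']; apply/kermx2P.
  by rewrite -!gapB x0 x0' (facet_gap HP fF)// (facet_gap HP fF')// subrr.
move=> y /kermx2P; rewrite -!gapB (facet_gap HP fF)// (facet_gap HP fF')// !sub0r.
move=> [/eqP + /eqP]; rewrite !oppr_eq0 => /eqP y0 /eqP y0' yr.
have Py := h y y0 y0' yr.
by split; [apply/(facetE HP fF)|apply/(facetE HP fF')].
Qed.

Lemma relint_setP (G : set E) w : relint G w -> G w /\ exists2 r : R, 0 < r &
  forall y, affine_hull G y -> enorm (y - w) < r -> G y.
Proof. by move=> [Gw] /nbhs_enormP[r r0 h]; split=> //; exists r => // y hy /h; apply. Qed.

(** Use a small positive and a small negative [t]. *)
Lemma edot_local_max (a u : E) (r : R) : 0 < r ->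
  (forall t : R, enorm (t *: u) < r -> edot a (t *: u) <= 0) -> edot a u = 0.
Proof.
move=> r0 h; have d0 : 0 < enorm u + 1 by rewrite ltr_wpDl ?enorm_ge0.
pose s := r / 2 / (enorm u + 1); have s0 : 0 < s by rewrite !divr_gt0.
have su : enorm (s *: u) < r.
  by rewrite enormZ gtr0_norm// /s mulrAC ltr_pdivrMr//; have := enorm_ge0 u; nra.
have := h s su; have := h (- s); rewrite scaleNr enormN => /(_ su).
by rewrite edotNr edotZr; nra.
Qed.

(** The supporting function of a face through [w] is constant on the affine piece,
    so that the face contains the piece and has at least its dimension. *)
Lemma not_low_skeleton w (U : 'M[R]_d.+1) (r : R) : (d <= \rank U + 1)%N ->
  0 < r -> (forall u, (u <= U)%MS -> enorm u < r -> P (w + u)) -> ~ low_skeleton P w.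
Proof.
move=> dU r0 h [H [k [[_ [a [b [aP HE]]]] [x [V [Hx hV rV]]] kd Hw]]].
have aw : edot a w = b by move: Hw; rewrite HE => -[].
suff UV : (U <= V)%MS.
  by have := leq_trans dU (leq_add (mxrankS UV) (leqnn 1)); rewrite rV addn1 leqNgt kd.
apply/rV_subP => u uU.
have au : edot a u = 0.
  apply: (@edot_local_max _ _ r) => // t tr.
  by have /aP := h (t *: u) (scalemx_sub _ uU) tr; rewrite edotDr aw; lra.
have d0 : 0 < enorm u + 1 by rewrite ltr_wpDl ?enorm_ge0.
pose s := r / 2 / (enorm u + 1); have s0 : 0 < s by rewrite !divr_gt0.
have su : enorm (s *: u) < r.
  by rewrite enormZ gtr0_norm// /s mulrAC ltr_pdivrMr//; have := enorm_ge0 u; nra.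
have inH y : H y -> (y - x <= V)%MS.
  by move/affine_hull_sub; rewrite hV.
have : H (w + s *: u).
  by rewrite HE; split; [apply: h => //; exact: scalemx_sub|rewrite /= edotDr edotZr au mulr0 addr0].
move=> /inH h1; have h2 := inH _ Hw.
have -> : u = s^-1 *: ((w + s *: u - x) - (w - x)).
  by apply/rowP => i; rewrite !mxE; field; rewrite gt_eqF.
by rewrite scalemx_sub// addmx_sub// eqmx_opp.
Qed.

Lemma relint_facet_not_low F w : facet P F -> relint F w -> ~ low_skeleton P w.
Proof.
move=> fF /(relint_facetP HP fF)[Fw [r r0 h]].
apply: (@not_low_skeleton _ (kermx (normal F)^T) r) => //.
  by rewrite rank_kermx1 ?(normal_neq0 HP fF)// leq_addr.
move=> u /kermx1P u0 ur; apply: h; last by rewrite addrAC subrr add0r.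
by rewrite gapD (facet_gap HP fF Fw) u0 subrr.
Qed.

Lemma ridge_nbhd_not_low F F' w : facet P F -> facet P F' -> F <> F' ->
  F w -> F' w -> ridge_nbhd F F' w -> ~ low_skeleton P w.
Proof.
move=> fF fF' ne Fw F'w [r r0 h].
have ind := normals_independent fF fF' ne Fw F'w.
apply: (@not_low_skeleton _ (kermx (row_mx (normal F)^T (normal F')^T)) r) => //.
  by rewrite (rank_kermx2 ind) /= addn1; case: (d).
move=> u /kermx2P[u0 u0'] ur; apply: h; last by rewrite addrAC subrr add0r.
  by rewrite gapD (facet_gap HP fF Fw) u0 subrr.
by rewrite gapD (facet_gap HP fF' F'w) u0' subrr.
Qed.

(** Both sides are affine of codimension 2, as the two normals are
    independent. *)
Lemma ridge_hull F F' G : facet P F -> facet P F' -> F <> F' -> ridge P G ->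
  G `<=` F -> G `<=` F' -> affine_hull G = [set x | gap F x = 0 /\ gap F' x = 0].
Proof.
move=> fF fF' ne [[[g Gg] _] [k dG kd]] GF GF'.
have ind := normals_independent fF fF' ne (GF _ Gg) (GF' _ Gg).
case: dG => x [U [Gx hU rU]].
have x0 := facet_gap HP fF (GF _ Gx); have x0' := facet_gap HP fF' (GF' _ Gx).
have Gn (H : set E) : facet P H -> G `<=` H -> forall y, affine_hull G y -> gap H y = 0.
  move=> fH GH y; rewrite !gapE.
  move/(@affine_hull_hyperplane _ _ _ (normal H) (facet_data P H).2) => -> //.
    by rewrite subrr.
  by move=> z /GH /(facet_gap HP fH) /eqP; rewrite subr_eq0 => /eqP.
have UK : (U <= kermx (row_mx (normal F)^T (normal F')^T))%MS.
  apply/rV_subP => u uU; apply/kermx2P.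
  have hu : affine_hull G (x + u) by rewrite hU /= addrAC subrr add0r.
  have := Gn _ fF GF _ hu; have := Gn _ fF' GF' _ hu.
  by rewrite !gapD x0 x0' !sub0r => /eqP + /eqP; rewrite !oppr_eq0 => /eqP -> /eqP ->.
have KU : (kermx (row_mx (normal F)^T (normal F')^T) <= U)%MS.
  by rewrite -(geq_leqif (mxrank_leqif_sup UK)) rank_kermx2// rU -kd.
apply/seteqP; split=> y; first by move=> hy; split; exact: Gn hy.
move=> /= [y0 y0']; rewrite hU /=; apply: submx_trans KU; apply/kermx2P.
by rewrite -!gapB x0 x0' y0 y0' subrr.
Qed.

Lemma relint_ridge_nbhd F F' G w : facet P F -> facet P F' -> F <> F' -> ridge P G ->
  G `<=` F -> G `<=` F' -> relint G w -> ridge_nbhd F F' w.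
Proof.
move=> fF fF' ne rG GF GF' /relint_setP[Gw [r r0 h]]; exists r => // z z0 z0' zr.
apply/(facet_sub HP fF)/GF/h => //.
by rewrite (ridge_hull fF fF' ne rG GF GF').
Qed.

(** Take the last time in [P]. *)
Lemma exit_point p y : P p -> ~ P y -> exists t : R,
  [/\ 0 <= t, t < 1 & surface P ((1 - t) *: p + t *: y)].
Proof.
move=> Pp nPy; pose A := [set t : R | 0 <= t <= 1 /\ P ((1 - t) *: p + t *: y)].
have A0 : A 0 by split; [rewrite lexx ler01|rewrite subr0 scale1r scale0r addr0].
have Aub : ubound A 1 by move=> t [/andP[]].
have sA : has_sup A by split; [exists 0|exists 1].
pose t := sup A.
have t0 : 0 <= t by exact: sup_upper_bound.
have t1 : t <= 1 by apply: sup_le_ub => //; exists 0.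
have d0 : 0 < enorm (y - p) + 1 by rewrite ltr_wpDl ?enorm_ge0.
have le : forall s u : R, (1 - s) *: p + s *: y - ((1 - u) *: p + u *: y) = (s - u) *: (y - p).
  by move=> s u; apply/rowP => i; rewrite !mxE; ring.
have Pt : P ((1 - t) *: p + t *: y).
  have /closure_id -> := polyhedron_closed HP.
  move=> B /nbhs_enormP[r r0 hB].
  have e0 : 0 < r / (enorm (y - p) + 1) by rewrite divr_gt0.
  have [s As st] := sup_adherent e0 sA.
  exists ((1 - s) *: p + s *: y); split; first by case: As.
  apply: hB; rewrite le enormZ ler0_norm ?subr_le0 ?sup_upper_bound// opprB.
  have : t - s < r / (enorm (y - p) + 1) by rewrite ltrBlDl -ltrBlDr.
  rewrite ltr_pdivlMr//; have := enorm_ge0 (y - p).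
  have : s <= t by exact: sup_upper_bound.
  nra.
have t1' : t < 1.
  rewrite lt_neqAle t1 andbT; apply/eqP => t1'; apply: nPy.
  by move: Pt; rewrite t1' subrr scale0r add0r scale1r.
exists t; split=> //; apply/surfaceP => //; split=> // /interior_polyhedronP[r r0 h].
pose e := Num.min (1 - t) (r / 2 / (enorm (y - p) + 1)).
have e0 : 0 < e by rewrite lt_min subr_gt0 t1' !divr_gt0.
have : A (t + e).
  have et : e <= 1 - t by rewrite ge_min lexx.
  split; first by apply/andP; split; lra.
  apply: h; rewrite le addrAC subrr add0r enormZ gtr0_norm//.
  have : e <= r / 2 / (enorm (y - p) + 1) by rewrite ge_min lexx orbT.
  rewrite ler_pdivlMr//; have := enorm_ge0 (y - p); nra.
by move/(sup_upper_bound sA); rewrite -/t; lra.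
Qed.

(** A boundary point of a facet lies on a second facet: otherwise [P] would agree
    with a half-space around it. *)
Lemma second_facet F w : facet P F -> F w -> ~ relint F w ->
  exists F', [/\ facet P F', F' <> F & F' w].
Proof.
move=> fF Fw nw; apply: contrapT => none.
have only H : facet P H -> H w -> H = F.
  by move=> fH Hw; apply: contrapT => ne; apply: none; exists H.
have [s [sF sP sx]] := facet_list HP.
have [|r r0 hr] := @strict_nbhd _ _ [seq c <- s | edot c.1 w != c.2] w.
  move=> c; rewrite mem_filter => /andP[cw cs]; rewrite lt_neqAle cw.
  exact: (sP w (facet_sub HP fF Fw)).
have near e : surface P e -> enorm (e - w) < r -> gap F e = 0.
  move=> Se er; have [c cs ce] := sx e Se.
  have cw : edot c.1 w = c.2.
    apply/eqP/negPn/negP => cw; have := hr e er c.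
    by rewrite mem_filter cw cs ce ltxx => /(_ isT).
  apply: (facet_gap HP fF); rewrite -(only _ (sF c cs)); last first.
    by split=> //; exact: (facet_sub HP fF).
  by split=> //; exact: (surface_sub HP).
have [y [y0 yr nPy]] : exists y, [/\ gap F y = 0, enorm (y - w) < r & ~ P y].
  apply: contrapT => h; apply: nw; apply/(relint_facetP HP fF); split=> //.
  exists r => // y y0 yr; apply: contrapT => nPy; apply: h; by exists y.
have [p Pp p0] := gap_pos_point HP fF.
have d0 : 0 < enorm (p - w) + 1 by rewrite ltr_wpDl ?enorm_ge0.
pose t := Num.min 1 (r / 2 / (enorm (p - w) + 1)).
have t0 : 0 < t by rewrite lt_min ltr01 !divr_gt0.
have t1 : t <= 1 by rewrite ge_min lexx.
have [p1 p1E] : exists p1, p1 = (1 - t) *: w + t *: p by eexists.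
have Pp1 : P p1.
  by rewrite p1E; apply: (polyhedronT_convex HP) => //; [exact: ltW|exact: (facet_sub HP fF)].
have [u [u0 u1 Se]] := exit_point Pp1 nPy.
have gp1 : 0 < gap F p1 by rewrite p1E gap_line (facet_gap HP fF Fw); nra.
have : gap F ((1 - u) *: p1 + u *: y) = 0.
  apply: near => //.
  have -> : (1 - u) *: p1 + u *: y - w = (1 - u) *: (p1 - w) + u *: (y - w).
    by apply/rowP => i; rewrite !mxE; ring.
  apply: le_lt_trans (enormD _ _) _; rewrite !enormZ !ger0_norm ?subr_ge0 ?(ltW u1)//.
  have : enorm (p1 - w) < r.
    have -> : p1 - w = t *: (p - w) by rewrite p1E; apply/rowP => i; rewrite !mxE; ring.
    rewrite enormZ gtr0_norm//.
    have : t <= r / 2 / (enorm (p - w) + 1) by rewrite ge_min lexx orbT.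
    rewrite ler_pdivlMr//; have := enorm_ge0 (p - w); nra.
  nra.
by rewrite gap_line y0; nra.
Qed.

(** A ridge lies in exactly two facets; here the second one is produced at a
    given relative interior point. *)
Lemma ridge_other_facet F G w : facet P F -> ridge P G -> G `<=` F -> relint G w ->
  exists F', [/\ facet P F', F' <> F, G `<=` F' & ridge_nbhd F F' w].
Proof.
move=> fF rG GF rw; have [Gw [r r0 hr]] := relint_setP rw.
have Fw := GF _ Gw.
have nw : ~ relint F w.
  move=> /(relint_facetP HP fF)[_ [e e0 he]].
  have [[_ [h [c [hP GE]]]] [k dG kd]] := rG.
  have hw : edot h w = c by move: Gw; rewrite GE => -[].
  have hn : h = edot h (normal F) *: normal F.
    apply: (@hyperplane_local _ _ _ (facet_data P F).2 _ c w e) => //.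
    - exact: (normal_unit HP fF).
    - by have /eqP := facet_gap HP fF Fw; rewrite subr_eq0 => /eqP.
    - by move=> y yF ye; apply/hP/he => //; rewrite !gapE yF subrr.
  have FG : F `<=` G.
    move=> x Fx; rewrite GE; split; first exact: (facet_sub HP fF).
    have : edot h x - edot h w = 0.
      rewrite -edotBr hn edotZl -gapB (facet_gap HP fF Fx) (facet_gap HP fF Fw).
      by rewrite subrr mulr0.
    by rewrite hw /= => /eqP; rewrite subr_eq0 => /eqP.
  have FeG : F = G by apply/seteqP.
  have [_ dF] := fF; have := has_dim_inj dF; rewrite FeG => /(_ _ dG).
  by move: kd => <- /eqP; rewrite -[X in X == _]addn1 -[X in _ == X]addn0 eqn_add2l.
have [F' [fF' ne F'w]] := second_facet fF Fw nw.
have [[_ _] [k [x [U [Gx hU rU]]] kd]] := rG.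
have GF' : G `<=` F'.
  move=> y Gy; apply/(facetE HP fF').
  split; first exact/(facet_sub HP fF)/GF.
  have hull u : (u <= U)%MS -> affine_hull G (w + u).
    move=> uU; rewrite hU /= addrAC addmx_sub//.
    by have := affine_hull_sub Gw; rewrite hU.
  have yU : (y - w <= U)%MS.
    have -> : y - w = (y - x) - (w - x) by apply/rowP => i; rewrite !mxE; ring.
    rewrite addmx_sub ?eqmx_opp//.
      by have := affine_hull_sub Gy; rewrite hU.
    by have := affine_hull_sub Gw; rewrite hU.
  have e : edot (normal F') (y - w) = 0.
    apply: (@edot_local_max _ _ r) => // t tr.
    have := hr (w + t *: (y - w)) (hull _ (scalemx_sub _ yU)).
    rewrite addrAC subrr add0r => /(_ tr) /GF /(facet_sub HP fF) /(gap_ge0 HP fF').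
    by rewrite gapD (facet_gap HP fF' F'w); lra.
  by have := gapB P F' w y; rewrite e (facet_gap HP fF' F'w); lra.
exists F'; split=> //.
exact: (relint_ridge_nbhd fF fF' (fun e => ne (esym e)) rG GF GF' rw).
Qed.

End Ridges.

(** * Folding maps *)

Section Folding.
Context {R : realType} {d : nat}.
Local Notation E := 'rV[R]_d.+1.
Implicit Types (x y z p q w : E) (F G : set E).
Context {P : set E} (HP : convex_polyhedron P).

Local Notation gap := (gap P).
Local Notation normal := (normal P).

(** The rotation about the common ridge that takes the hyperplane of [F] to that
    of [F'], written without choosing a frame: on the hyperplane of [F] it moves
    points along the sum of the two normals. *)
Definition fold F F' x : E :=
  x + (gap F' x / (1 + edot (normal F) (normal F'))) *: (normal F + normal F').

Lemma foldE F F' x : fold F F' x =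
  x + (gap F' x / (1 + edot (normal F) (normal F'))) *: (normal F + normal F').
Proof. by []. Qed.

Lemma fold_line F F' x y (t : R) :
  fold F F' ((1 - t) *: x + t *: y) = (1 - t) *: fold F F' x + t *: fold F F' y.
Proof. by rewrite /fold gap_line; apply/rowP => i; rewrite !mxE; ring. Qed.

Lemma fold_fix F F' x : gap F' x = 0 -> fold F F' x = x.
Proof. by rewrite /fold => ->; rewrite mul0r scale0r addr0. Qed.

Lemma fold_segment F F' x y z : segment x y z ->
  segment (fold F F' x) (fold F F' y) (fold F F' z).
Proof.
by case/segmentP=> t [t0 t1 ->]; apply/segmentP; exists t; rewrite fold_line.
Qed.

Lemma fold_image_segment F F' x y :
  fold F F' @` segment x y = segment (fold F F' x) (fold F F' y).
Proof.
apply/seteqP; split=> [_ [z xyz <-]|z /segmentP[t [t0 t1 ->]]].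
  exact: fold_segment.
exists ((1 - t) *: x + t *: y); last exact: fold_line.
by apply/segmentP; exists t.
Qed.

Section TwoFacets.
Context {F F' : set E} (fF : facet P F) (fF' : facet P F').
Context (c0 : 0 < 1 + edot (normal F) (normal F')).

Lemma gap_fold_target x : gap F' (fold F F' x) = 0.
Proof.
rewrite /fold gapD edotZr edotDr (normal_unit HP fF') (edotC (normal F')) addrC.
by rewrite (addrC _ 1) divfK ?lt0r_neq0// addNr.
Qed.

Lemma gap_fold_source x : gap F x = 0 -> gap F (fold F F' x) = - gap F' x.
Proof.
move=> x0; rewrite /fold gapD edotZr edotDr (normal_unit HP fF) x0 sub0r.
by rewrite divfK ?lt0r_neq0.
Qed.

Lemma fold_dist x y : gap F x = 0 -> gap F y = 0 ->
  enorm (fold F F' x - fold F F' y) = enorm (x - y).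
Proof.
move=> x0 y0; apply: enorm_eq; rewrite /fold.
set k := edot (normal F) (normal F'); have k0 : 0 < 1 + k := c0; set s := normal F + normal F'.
have -> : x + (gap F' x / (1 + k)) *: s - (y + (gap F' y / (1 + k)) *: s) =
   (x - y) + ((gap F' x - gap F' y) / (1 + k)) *: s.
  by apply/rowP => i; rewrite !mxE; ring.
have e : edot (normal F) (x - y) = 0 by rewrite -gapB x0 y0 subrr.
have e' : edot (normal F') (x - y) = - (gap F' x - gap F' y).
  by rewrite -gapB; ring.
have es : edot s (x - y) = - (gap F' x - gap F' y) by rewrite /s edotDl e e' add0r.
have ss : edot s s = 2 * (1 + k).
  rewrite /s !edotlrE (normal_unit HP fF) (normal_unit HP fF').
  by rewrite (edotC (normal F')) -/k; ring.
move: (x - y) es => u es; clearbody s.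
rewrite !edotDl !edotDr !edotZl !edotZr es (edotC u s) es ss.
by field; exact: lt0r_neq0.
Qed.

End TwoFacets.

Lemma foldK F F' x : facet P F -> facet P F' ->
  0 < 1 + edot (normal F) (normal F') -> gap F x = 0 ->
  fold F' F (fold F F' x) = x.
Proof.
move=> fF fF' c0 x0; rewrite {1}/fold gap_fold_source// (edotC (normal F')).
by rewrite /fold; apply/rowP => i; rewrite !mxE; ring.
Qed.

Lemma share_ridge_sym F F' : share_ridge P F F' -> share_ridge P F' F.
Proof.
move=> [fF fF' ne [G [rG GF GF']]].
by split=> //; [exact: nesym|exists G].
Qed.

Lemma share_ridge_point F F' : share_ridge P F F' ->
  exists q, [/\ F q, F' q & ridge_nbhd (P := P) F F' q].
Proof.
move=> [fF fF' ne [G [rG GF GF']]]; have [[G0 [a [b [aP GE]]]] _] := rG.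
have [||x Gx [r r0 h]] := @convex_relint _ _ _ HP G G0.
- move=> x y; rewrite GE => -[Px ax] [Py ay]; split.
    by apply: (polyhedron_segment HP Px Py); exact: segment_mid.
  by rewrite /= !edotrE ax ay; lra.
- by rewrite GE => x [].
exists x; split; [exact: GF|exact: GF'|exists r => // z z0 z0' zr].
by apply: h => //; rewrite (ridge_hull HP fF fF' ne rG GF GF').
Qed.

Lemma share_ridge_not_opposite F F' : share_ridge P F F' ->
  0 < 1 + edot (normal F) (normal F').
Proof.
move=> sr; have [q [Fq F'q _]] := share_ridge_point sr.
by case: sr => fF fF' ne _; exact: (normals_not_opposite HP fF fF' ne Fq F'q).
Qed.

Lemma fold_is_folding F F' : share_ridge P F F' -> is_folding P F F' (fold F F').
Proof.
move=> sr; have c0 := share_ridge_not_opposite sr.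
have c0' := share_ridge_not_opposite (share_ridge_sym sr).
case: (sr) => fF fF' ne [G [rG GF GF']]; split.
- rewrite (facet_hull HP fF) (facet_hull HP fF'); apply/seteqP; split.
    by move=> _ [x _ <-]; exact: gap_fold_target.
  move=> y /= y0; exists (fold F' F y); first exact: gap_fold_target.
  exact: foldK.
- by move=> x y; rewrite (facet_hull HP fF) => x0 y0; exact: fold_dist.
- by exists G; split=> // x /GF' /(facet_gap HP fF'); exact: fold_fix.
- apply/seteqP; split=> // _ [[x Fx <-] xF']; apply: ne; apply/esym.
  apply: (relint_facet_eq HP fF' fF xF').
  have /(facetE HP fF')[Px _] := relint_sub xF'.
  apply/(facetE HP fF); split=> //; apply/eqP; rewrite eq_le (gap_ge0 HP fF)// andbT.
  have := gap_fold_source fF c0 (facet_gap HP fF Fx).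
  by have := gap_ge0 HP fF' (facet_sub HP fF Fx); lra.
Qed.

(** An isometry between the two hyperplanes fixing the ridge is the rotation
    [fold] or its mirror image; the mirror image folds [F] onto the interior of
    [F'] near the ridge. *)
Lemma is_folding_unique F F' phi : share_ridge P F F' -> is_folding P F F' phi ->
  forall x, gap F x = 0 -> phi x = fold F F' x.
Proof.
move=> sr; have c0 := share_ridge_not_opposite sr.
case: (sr) => fF fF' ne _ [hphi iso [G [rG GF GF' fixG]] disj].
rewrite (facet_hull HP fF) (facet_hull HP fF') in hphi iso.
have phi0 x : gap F x = 0 -> gap F' (phi x) = 0.
  by move=> x0; have : [set y | gap F' y = 0] (phi x) by rewrite -hphi; exists x.
have [[[g Gg] _] [k dG kd]] := rG.
have g0 := facet_gap HP fF (GF _ Gg); have g0' := facet_gap HP fF' (GF' _ Gg).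
have ind := normals_independent HP fF fF' ne (GF _ Gg) (GF' _ Gg).
have cc := normals_not_parallel HP fF fF' ne (GF _ Gg) (GF' _ Gg).
have nF := normal_unit HP fF; have nF' := normal_unit HP fF'.
set c := edot (normal F) (normal F') in c0 cc.
(* The direction in the hyperplane of [F'] orthogonal to the ridge. *)
have [m mE] : exists m, m = normal F - c *: normal F' by eexists.
have mm : edot m m = 1 - c ^+ 2.
  by rewrite mE !edotlrE nF nF' (edotC (normal F')) -/c; ring.
have mF : edot (normal F) m = 1 - c ^+ 2.
  by rewrite mE !edotlrE nF -/c; ring.
have mF' : edot (normal F') m = 0.
  by rewrite mE !edotlrE nF' (edotC (normal F')) -/c; ring.
have hG := ridge_hull HP fF fF' ne rG GF GF'.
have refl x : gap F x = 0 -> exists2 s : R, phi x = fold F F' x + s *: m &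
    s = 0 \/ s * (1 - c ^+ 2) = - 2 * gap F' x.
  move=> x0; pose e := phi x - fold F F' x.
  have eG y : G y -> edot e y =
      (edot (phi x) (phi x) - edot (fold F F' x) (fold F F' x)) / 2.
    move=> Gy; have y0 := facet_gap HP fF (GF _ Gy).
    have y0' := facet_gap HP fF' (GF' _ Gy).
    have h1 := iso x y x0 y0; rewrite (fixG _ Gy) in h1.
    have h2 := fold_dist fF fF' c0 x0 y0; rewrite (fold_fix _ y0') in h2.
    have : edot (phi x - y) (phi x - y) = edot (fold F F' x - y) (fold F F' x - y).
      by rewrite -!enorm_sqr h1 h2.
    rewrite /e; move: (fold F F' x) (phi x) => u w.
    rewrite !edotlrE (edotC y u) (edotC y w); lra.
  case: dG => g1 [U [Gg1 hU rU]].
  have inU u : (u <= U)%MS -> affine_hull G (g1 + u).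
    by move=> uU; rewrite hU /= addrAC subrr add0r.
  have [s [t est]] : exists s t, e = s *: normal F + t *: normal F'.
    apply: (orthogonal_codim2 (U := U) ind).
    - by rewrite rU addn2 kd.
    - move=> u /inU; rewrite hG /= !gapD (facet_gap HP fF (GF _ Gg1)).
      rewrite (facet_gap HP fF' (GF' _ Gg1)) !sub0r => -[/eqP + /eqP].
      by rewrite !oppr_eq0 => /eqP -> /eqP ->.
    - move=> u /inU /(affine_hull_hyperplane eG).
      by rewrite edotDr (eG _ Gg1); lra.
  have eF' : edot (normal F') e = 0.
    by rewrite -gapB (gap_fold_target fF' c0) (phi0 _ x0) subrr.
  have ts : t = - s * c.
    by move: eF'; rewrite est !edotrE nF' (edotC (normal F')) -/c; lra.
  have em : e = s *: m.
    by rewrite est ts mE; apply/rowP => i; rewrite !mxE; ring.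
  exists s; first by rewrite -em /e addrC subrK.
  have h1 := iso x g x0 g0; rewrite (fixG _ Gg) in h1.
  have h2 := fold_dist fF fF' c0 x0 g0; rewrite (fold_fix _ g0') in h2.
  have : edot (phi x - g) (phi x - g) = edot (fold F F' x - g) (fold F F' x - g).
    by rewrite -!enorm_sqr h1 h2.
  have -> : phi x - g = (fold F F' x - g) + s *: m.
    by rewrite -em /e; apply/rowP => i; rewrite !mxE; ring.
  have fm : edot (fold F F' x - g) m = gap F' x.
    rewrite edotC mE edotBl edotZl -!gapB (gap_fold_target fF' c0).
    by rewrite (gap_fold_source fF c0 x0) g0 g0'; ring.
  move: (fold F F' x - g) fm => u fm; rewrite !edotlrE mm (edotC m u) fm.
  have [->|s0] := eqVneq s 0; first by left.
  by move=> h; right; apply: (mulfI s0); lra.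
(* One point where [phi] is the rotation settles all others. *)
have [x1 [x10 x1p ph1]] : exists x1, [/\ gap F x1 = 0, 0 < gap F' x1 & phi x1 = fold F F' x1].
  have [q [Fq F'q rn]] := share_ridge_point sr.
  have [r r0 hr] := ridge_wedge HP fF fF' ne Fq F'q rn.
  have [y yF yp] := other_facet_point HP fF fF' ne.
  have d0 : 0 < enorm (y - q) + 1 by rewrite ltr_wpDl ?enorm_ge0.
  pose t := Num.min 1 (r / 2 / (enorm (y - q) + 1)).
  have t0 : 0 < t by rewrite lt_min ltr01 !divr_gt0.
  have t1 : t <= 1 by rewrite ge_min lexx.
  have [x1 x1E] : exists x1, x1 = (1 - t) *: q + t *: y by eexists.
  have q0 := facet_gap HP fF Fq; have q0' := facet_gap HP fF' F'q.
  have Fx1 : F x1.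
    rewrite x1E; apply: (facet_segment HP fF Fq (relint_sub yF)).
    by apply/segmentP; exists t; split=> //; exact: ltW.
  have x1p : 0 < gap F' x1 by rewrite x1E gap_line q0' mulr0 add0r mulr_gt0.
  have x10 := facet_gap HP fF Fx1.
  exists x1; split=> //.
  have [s se [s0|s0]] := refl x1 x10; first by rewrite se s0 scale0r addr0.
  exfalso.
  have gp : gap F (phi x1) = gap F' x1.
    by rewrite se gapD edotZr mF (gap_fold_source fF c0 x10); lra.
  have gp' := phi0 _ x10.
  have pq : enorm (phi x1 - q) < r.
    have : enorm (phi x1 - q) = enorm (x1 - q).
      have qG : affine_hull G q by rewrite hG.
      have qU := refl q q0.
      have [u ue [u0|u0]] := qU.
        by rewrite -(iso x1 q x10 q0) ue u0 scale0r addr0 (fold_fix _ q0').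
      rewrite q0' mulr0 in u0.
      have {}u0 : u = 0 by apply: (mulIf (lt0r_neq0 cc)); rewrite mul0r.
      by rewrite -(iso x1 q x10 q0) ue u0 scale0r addr0 (fold_fix _ q0').
    move=> ->; have -> : x1 - q = t *: (y - q).
      by rewrite x1E; apply/rowP => i; rewrite !mxE; ring.
    rewrite enormZ gtr0_norm//.
    have : t <= r / 2 / (enorm (y - q) + 1) by rewrite ge_min lexx orbT.
    rewrite ler_pdivlMr//; have := enorm_ge0 (y - q); nra.
  have : (phi @` F `&` relint F') (phi x1).
    split; first by exists x1.
    apply/(relint_facetP HP fF'); split.
      apply/(facetE HP fF'); split=> //; apply: hr => //.
        by rewrite gp ltW.
      by rewrite gp'.
    have [|r' r'0 h] := @strict_nbhd _ _ [:: (normal F, (facet_data P F).2)] (phi x1).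
      by move=> f; rewrite inE => /eqP -> /=; rewrite -subr_gt0 -[_ - _]/(gap F (phi x1)) gp.
    exists (Num.min r' (r - enorm (phi x1 - q))); first by rewrite lt_min r'0 subr_gt0.
    move=> z z0; rewrite lt_min => /andP[zr' zr]; apply: hr.
    - apply: le_lt_trans (enorm_tri (phi x1) _ _) _; lra.
    - by rewrite subr_ge0; apply/ltW/(h z zr' (normal F, _)); rewrite inE eqxx.
    - by rewrite z0.
  by rewrite disj.
move=> x x0; have [s se [s0|s0]] := refl x x0; first by rewrite se s0 scale0r addr0.
have h1 := iso x x1 x0 x10; rewrite ph1 in h1.
have h2 := fold_dist fF fF' c0 x0 x10.
have : edot (phi x - fold F F' x1) (phi x - fold F F' x1) =
    edot (fold F F' x - fold F F' x1) (fold F F' x - fold F F' x1).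
  by rewrite -!enorm_sqr h1 h2.
have -> : phi x - fold F F' x1 = (fold F F' x - fold F F' x1) + s *: m.
  by rewrite se; apply/rowP => i; rewrite !mxE; ring.
have fm : edot (fold F F' x - fold F F' x1) m = gap F' x - gap F' x1.
  rewrite edotC mE edotBl edotZl -!gapB !(gap_fold_target fF' c0).
  by rewrite (gap_fold_source fF c0 x0) (gap_fold_source fF c0 x10); ring.
move: (fold F F' x - fold F F' x1) fm => u fm; rewrite !edotlrE mm (edotC m u) fm => h.
have : s * gap F' x1 = 0 by nra.
by move=> /eqP; rewrite mulf_eq0 (gt_eqF x1p) orbF => /eqP s00; rewrite se s00 scale0r addr0.
Qed.

Lemma foldingE F F' x : share_ridge P F F' -> gap F x = 0 ->
  folding P F F' x = fold F F' x.
Proof.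
move=> sr x0; rewrite /folding; case: pselect => [h|[]]; last first.
  by exists (fold F F'); exact: fold_is_folding.
exact: is_folding_unique (projT2 (cid h)) _ x0.
Qed.

End Folding.

(** * Curves and closed sets *)

Section ClosedSets.
Context {R : realType} {n : nat}.
Local Notation E := 'rV[R]_n.
Implicit Types (x y z p q w : E) (A : set E) (g : R -> E).

Lemma closed_avoid A y : closed A -> ~ A y ->
  exists2 r : R, 0 < r & forall z, enorm (z - y) < r -> ~ A z.
Proof.
move=> cA nAy; have oA : open (~` A) by exact: closed_openC.
by have /nbhs_enormP[r r0 h] := open_nbhs_nbhs (conj oA nAy); exists r.
Qed.

Lemma closed_avoid_seq (J : seq (set E)) y : {in J, forall A, closed A} ->
  {in J, forall A, ~ A y} -> exists2 r : R, 0 < r &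
    forall z, enorm (z - y) < r -> {in J, forall A, ~ A z}.
Proof.
elim: J => [|A J ih] cJ nJ; first by exists 1.
have [||r r0 h] := ih.
- by move=> B BJ; apply: cJ; rewrite inE BJ orbT.
- by move=> B BJ; apply: nJ; rewrite inE BJ orbT.
have [||r' r'0 h'] := @closed_avoid A y.
- by apply: cJ; rewrite inE eqxx.
- by apply: nJ; rewrite inE eqxx.
exists (Num.min r r'); first by rewrite lt_min r0.
by move=> z; rewrite lt_min => /andP[zr zr'] B; rewrite inE => /predU1P[->|];
  [exact: h'|exact: h].
Qed.

Lemma last_time g A (s : R) : {within `[0, 1]%classic, continuous g} -> closed A ->
  0 <= s -> s <= 1 -> A (g s) -> exists b : R, [/\ s <= b, b <= 1, A (g b) &
    forall t, b < t -> t <= 1 -> ~ A (g t)].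
Proof.
move=> /within_continuousP cg cA s0 s1 As.
pose T := [set t : R | 0 <= t <= 1 /\ A (g t)].
have Ts : T s by split; rewrite ?s0.
have sT : has_sup T by split; [exists s|exists 1 => t [/andP[]]].
have b0 : s <= sup T by exact: sup_upper_bound.
have b1 : sup T <= 1 by apply: sup_le_ub; [exists s|move=> t [/andP[]]].
exists (sup T); split=> //; last first.
  move=> t bt t1 At; have : T t by split=> //; rewrite t1 andbT; lra.
  by move/(sup_upper_bound sT); rewrite leNgt bt.
apply: contrapT => /(closed_avoid cA)[r r0 h].
have [|e e0 he] := cg (sup T) _ r r0.
  by rewrite /= in_itv/= b1 andbT; lra.
have [t Tt te] := sup_adherent e0 sT.
have tT := sup_upper_bound sT Tt.
case: Tt => t01 At; apply: (h (g t)) => //; apply: he; first by rewrite /= in_itv.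
by rewrite ler0_norm ?subr_le0// opprB; lra.
Qed.

Lemma first_time g A (s : R) : {within `[0, 1]%classic, continuous g} -> closed A ->
  0 <= s -> s <= 1 -> A (g s) -> exists b : R, [/\ 0 <= b, b <= s, A (g b) &
    forall t, 0 <= t -> t < b -> ~ A (g t)].
Proof.
move=> cg cA s0 s1 As.
have cg' : {within `[0, 1]%classic, continuous (fun t : R => g (1 - t))}.
  apply/within_continuousP => t; rewrite /= in_itv/= => t01 e e0.
  move/within_continuousP : cg => /(_ (1 - t) _ e e0)[|dl d0 h].
    by rewrite /= in_itv/=; lra.
  exists dl => // u /=; rewrite in_itv/= => u01 ut; apply: h.
    by rewrite /= in_itv/=; lra.
  by rewrite (_ : 1 - u - (1 - t) = t - u); [rewrite distrC|ring].
have [|||b [h1 h2 h3 h4]] := @last_time (fun t => g (1 - t)) A (1 - s) cg' cA.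
- by lra.
- by lra.
- by rewrite subKr.
exists (1 - b); split=> //; [lra|lra|].
move=> t t0 tb; have := h4 (1 - t); rewrite subKr; apply; lra.
Qed.

(** Otherwise all the sets met later stay away from [g b], but the curve is still
    near [g b] just after the time [b]. *)
Lemma next_set g (J : seq (set E)) (b : R) :
  {within `[0, 1]%classic, continuous g} -> {in J, forall A, closed A} ->
  0 <= b -> b < 1 ->
  (forall t, b < t -> t <= 1 -> exists2 A, A \in J & A (g t)) ->
  exists A, [/\ A \in J, A (g b) & exists t, [/\ b < t, t <= 1 & A (g t)]].
Proof.
move=> /within_continuousP cg cJ b0 b1 cov.
pose J' := [seq A <- J | `[< exists t, [/\ b < t, t <= 1 & A (g t)] >]].
apply: contrapT => none.
have [||r r0 h] := @closed_avoid_seq J' (g b).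
- by move=> A; rewrite mem_filter => /andP[_ /cJ].
- move=> A; rewrite mem_filter => /andP[/asboolP hA AJ] Ab.
  by apply: none; exists A.
have [|e e0 he] := cg b _ r r0; first by rewrite /= in_itv/= b0 ltW.
pose t := Num.min 1 (b + e / 2).
have t1 : t <= 1 by rewrite ge_min lexx.
have bt : b < t by rewrite lt_min b1/=; lra.
have te : t <= b + e / 2 by rewrite ge_min lexx orbT.
have [A AJ At] := cov t bt t1.
apply: (h (g t) _ A) => //.
  apply: he; first by rewrite /= in_itv/= t1 andbT; lra.
  by rewrite gtr0_norm ?subr_gt0//; lra.
rewrite mem_filter AJ andbT; apply/asboolP; by exists t.
Qed.

Lemma continuous_enormB z : continuous (fun y : E => enorm (y - z)).
Proof.
move=> x A /nbhs_ballP[e /= e0 hA].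
suff : nbhs x ((fun y => enorm (y - z)) @^-1` A) by [].
apply/nbhs_enormP; exists e => // y yx.
apply: hA; rewrite -ball_normE /ball_ /=.
have := enorm_tri y x z; have := enorm_tri x y z.
rewrite (enormB x y) => *; rewrite ltr_norml; lra.
Qed.

(** As [f] dominates the distance to [x0], only a bounded part of [A] matters. *)
Lemma closed_min A (f : E -> R) x0 (c : R) : A x0 -> closed A ->
  (forall y z, A y -> A z -> `|f y - f z| <= c * enorm (y - z)) ->
  (forall y, A y -> enorm (y - x0) <= f y) ->
  exists2 x, A x & forall y, A y -> f x <= f y.
Proof.
move=> Ax0 cA lf cof.
pose K := A `&` [set y | enorm (y - x0) <= f x0].
have cK : closed K.
  apply: closedI => //.
  apply: (@closed_comp _ _ (fun y => enorm (y - x0)) [set z | z <= f x0]);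
    last exact: closed_le.
  by move=> y _; exact: continuous_enormB.
have bK : bounded_set K.
  exists (enorm x0 + f x0); split; first exact: num_real.
  move=> M hM y [_ /= hy]; apply: le_trans (norm_le_enorm _) _.
  apply/ltW; apply: le_lt_trans hM.
  have := enorm_tri x0 y 0; rewrite !subr0; lra.
have K0 : K x0.
  split=> //=; rewrite subrr enorm0.
  by have := cof _ Ax0; rewrite subrr enorm0.
have cf : {within K, continuous f}.
  rewrite continuous_subspace_in => y; rewrite inE => Ky.
  move=> B /nbhs_ballP[e /= e0 hB].
  rewrite nbhs_simpl /= {1}/nbhs /= /nbhs_subspace; case: ifPn => [_|]; last first.
    by rewrite notin_setE.
  have c0 : 0 < `|c| + 1 by rewrite ltr_wpDl.
  apply/nbhs_enormP; exists (e / (`|c| + 1)); first by rewrite divr_gt0.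
  move=> z; rewrite ltr_pdivlMr// => ze Kz.
  apply: hB; rewrite -ball_normE /ball_ /=; apply: le_lt_trans (lf _ _ Ky.1 Kz.1) _.
  rewrite enormB; apply: le_lt_trans ze; rewrite mulrC ler_wpM2l ?enorm_ge0//.
  by have := ler_norm c; lra.
have [x] := compact_EVT_min (ex_intro _ _ K0) (bounded_closed_compact bK cK) cf.
rewrite inE => -[Ax _] hx; exists x => // y Ay.
have [yf|yf] := leP (enorm (y - x0)) (f x0); first by apply: hx; rewrite inE.
apply: le_trans (hx x0 _) _; first by rewrite inE.
by apply/ltW; apply: lt_le_trans yf _; exact: cof.
Qed.

End ClosedSets.

(** * Nearest-point projection to the polyhedron *)

Section Projection.
Context {R : realType} {d : nat}.
Local Notation E := 'rV[R]_d.+1.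
Implicit Types (x y z p q w : E) (F G : set E).
Context {P : set E} (HP : convex_polyhedron P).

(** Nearest-point projection: curves outside the interior of [P] can be pushed to
    the surface without lengthening them. *)
Lemma polyhedron_retraction v : P v -> exists f : E -> E,
  [/\ forall y z, enorm (f y - f z) <= enorm (y - z),
      forall y, ~ interior P y -> surface P (f y) & forall y, P y -> f y = y].
Proof.
move=> Pv.
have near y : exists z, P z /\ forall w, P w -> enorm (z - y) <= enorm (w - y).
  have [||||z Pz hz] := @closed_min _ _ P (fun z => enorm (z - y) + enorm (v - y)) v 1.
  - by [].
  - exact: (polyhedron_closed HP).
  - move=> z w _ _; rewrite mul1r.
    have := enorm_tri z w y; have := enorm_tri w z y.
    by rewrite (enormB w z) => *; rewrite ler_norml; lra.
  - by move=> z _; rewrite (enormB v); exact: enorm_tri.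
  by exists z; split=> // w /hz; rewrite lerD2r.
pose f y := projT1 (cid (near y)).
have fP y : P (f y) by rewrite /f; case: cid => z [].
have fmin y w : P w -> enorm (f y - y) <= enorm (w - y).
  by rewrite /f; case: cid => z [/= _]; exact.
have var y w : P w -> edot (y - f y) (w - f y) <= 0.
  move=> Pw; rewrite leNgt; apply/negP => h.
  set e := edot _ _ in h.
  have q0 : 0 < edot (w - f y) (w - f y) + e.
    by rewrite ltr_wpDl// edot_ge0.
  pose t := e / (edot (w - f y) (w - f y) + e).
  have t0 : 0 < t by rewrite divr_gt0.
  have t1 : t <= 1 by rewrite ler_pdivrMr// mul1r lerDr edot_ge0.
  have := fmin y ((1 - t) *: f y + t *: w) (polyhedronT_convex HP (ltW t0) t1 (fP y) Pw).
  have -> : (1 - t) *: f y + t *: w - y = t *: (w - f y) - (y - f y).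
    by apply/rowP => i; rewrite !mxE; ring.
  rewrite (enormB (f y)) -(ler_pXn2r (n := 2)) ?nnegrE ?enorm_ge0//.
  rewrite !enorm_sqr; move: (w - f y) (y - f y) @e h q0 @t t0 t1 => a b e h q0 t t0 t1.
  rewrite !(edotBl _ _ (_ - _)) !(edotBr (_ *: _)) !(edotBr b) !edotZl !edotZr (edotC a b) -/e.
  have te : t * (edot a a + e) = e by rewrite /t divfK// gt_eqF.
  have : t * (t * (edot a a + e)) = t * e by rewrite te.
  have := mulr_gt0 t0 h; have := mulr_gt0 (mulr_gt0 t0 t0) h; lra.
have fid y : P y -> f y = y.
  move=> Py; have := fmin y y Py; rewrite subrr enorm0 => h.
  have /enorm_eq0/eqP : enorm (f y - y) = 0.
    by apply/eqP; rewrite eq_le h enorm_ge0.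
  by rewrite subr_eq0 => /eqP.
exists f; split=> //.
  move=> y z; have [->|ne] := eqVneq (f y) (f z); first by rewrite subrr enorm0 enorm_ge0.
  have p0 : 0 < enorm (f y - f z) by rewrite enorm_gt0// subr_eq0.
  have h1 := var y _ (fP z); have h2 := var z _ (fP y).
  rewrite -(ler_pM2r p0) -expr2 enorm_sqr; apply: le_trans (edot_le_enorm _ _).
  move: (f y) (f z) h1 h2 => a b.
  by rewrite !edotlrE (edotC b a); lra.
move=> y ny; apply/(surfaceP HP); split=> // /interior_polyhedronP[r r0 h].
have [yf|yf] := eqVneq (f y) y.
  apply: ny; apply/interior_polyhedronP; exists r => // z zy.
  by apply: h; rewrite yf.
have d0 : 0 < enorm (y - f y) by rewrite enorm_gt0// subr_eq0 eq_sym.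
have e0 : 0 < r / 2 / enorm (y - f y) by rewrite !divr_gt0.
have Pz : P (f y + (r / 2 / enorm (y - f y)) *: (y - f y)).
  by apply: h; rewrite addrAC subrr add0r enormZ gtr0_norm// divfK ?gt_eqF//; lra.
have := var y _ Pz; rewrite addrAC subrr add0r edotZr pmulr_rle0// leNgt.
by rewrite edot_gt0// subr_eq0 eq_sym.
Qed.

End Projection.

(** * Distances outside the interior *)

Section Distance.
Context {R : realType} {d : nat}.
Local Notation E := 'rV[R]_d.+1.
Implicit Types (x y z p q w : E) (F G : set E) (g h : R -> E).
Context {P : set E} (HP : convex_polyhedron P).

Definition reach (P : set E) (v y : E) : Prop :=
  intrinsic_dist (~` interior P) v y \is a fin_num.

(** The distance is measured among all curves outside the interior of [P]; on
    the surface this is the intrinsic distance. *)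
Definition dist (P : set E) (v y : E) : R :=
  fine (intrinsic_dist (~` interior P) v y).

Lemma idist_surface v y : surface P v -> surface P y ->
  intrinsic_dist (surface P) v y = intrinsic_dist (~` interior P) v y.
Proof.
move=> Sv Sy; apply/eqP; rewrite eq_le; apply/andP; split; last first.
  by apply: idist_subset => x /(surfaceP HP)[].
have [f [lf fS fP]] := polyhedron_retraction HP (surface_sub HP Sv).
by apply: (idist_retract lf fS); apply: fP; exact: (surface_sub HP).
Qed.

Lemma dist_ge v y : reach P v y -> enorm (y - v) <= dist P v y.
Proof. by move=> ry; rewrite -lee_fin fineK// idist_ge. Qed.

Lemma reach_segment v x y : reach P v x -> segment x y `<=` ~` interior P ->
  reach P v y.
Proof.
move=> rx /(idist_segment v) h.
rewrite /reach ge0_fin_numE ?idist_ge0//; apply: le_lt_trans h _.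
by rewrite -(fineK rx) -EFinD ltry.
Qed.

Lemma dist_along_segment v x y : reach P v x -> segment x y `<=` ~` interior P ->
  dist P v y <= dist P v x + enorm (x - y).
Proof.
move=> rx xy; have ry := reach_segment rx xy.
by rewrite -lee_fin EFinD !fineK//; exact: idist_segment.
Qed.

Lemma hyperplane_outside F x y : facet P F -> gap P F x = 0 -> gap P F y = 0 ->
  segment x y `<=` ~` interior P.
Proof.
move=> fF x0 y0 z xyz; apply: (gap_le0_not_interior HP fF).
by rewrite (gap_segment0 x0 y0 xyz).
Qed.

Lemma reach_origin v : surface P v -> reach P v v /\ dist P v v = 0.
Proof.
move=> Sv; suff e : intrinsic_dist (~` interior P) v v = 0%E by rewrite /reach /dist e.
apply/eqP; rewrite eq_le idist_ge0 andbT.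
have vv : segment v v `<=` ~` interior P.
  by rewrite segmentxx => _ ->; have /(surfaceP HP)[] := Sv.
apply: le_trans (idist_le (line_path_in vv)) _.
by apply: le_trans (length_line _ _) _; rewrite subrr enorm0.
Qed.

Lemma shortest_surface v x g (a : R) : shortest_path (surface P) g v x ->
  0 <= a -> a <= 1 -> surface P (g a).
Proof.
by move=> [[_ gS _ _] _ _] a0 a1; apply: gS; exists a => //=; rewrite in_itv/= a0.
Qed.

Lemma shortest_reach v x g (a : R) : shortest_path (surface P) g v x ->
  0 <= a -> a <= 1 -> reach P v (g a).
Proof.
move=> sg a0 a1; rewrite /reach -idist_surface.
- exact: shortest_fin sg a0 a1.
- have [[_ _ g0 _] _ _] := sg; rewrite -g0.
  exact: shortest_surface sg (lexx _) ler01.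
- exact: shortest_surface sg a0 a1.
Qed.

Lemma shortest_origin v x g : shortest_path (surface P) g v x -> surface P v.
Proof.
move=> sg; have [[_ _ g0 _] _ _] := sg; rewrite -g0.
exact: shortest_surface sg (lexx _) ler01.
Qed.

Lemma shortest_chord v x g (a b : R) : shortest_path (surface P) g v x ->
  0 <= a -> a <= b -> b <= 1 ->
  dist P v (g a) + enorm (g b - g a) <= dist P v (g b).
Proof.
move=> sg a0 ab b1; have Sv := shortest_origin sg.
have a1 := le_trans ab b1; have b0 := le_trans a0 ab.
have := shortest_tight sg a0 ab b1.
rewrite (idist_surface Sv (shortest_surface sg a0 a1)).
rewrite (idist_surface Sv (shortest_surface sg b0 b1)).
have ra := shortest_reach sg a0 a1; have rb := shortest_reach sg b0 b1.
by rewrite -(fineK ra) -(fineK rb) -EFinD lee_fin.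
Qed.

(** Where the chord avoids the interior, it is a competitor of the path. *)
Lemma shortest_chord_eq v x g (a b : R) : shortest_path (surface P) g v x ->
  0 <= a -> a <= b -> b <= 1 -> segment (g a) (g b) `<=` ~` interior P ->
  dist P v (g b) = dist P v (g a) + enorm (g b - g a).
Proof.
move=> sg a0 ab b1 out; apply/eqP; rewrite eq_le (shortest_chord sg)// andbT.
rewrite enormB; apply: dist_along_segment out.
by apply: shortest_reach sg a0 _; exact: le_trans ab b1.
Qed.

Lemma shortest_segment v x g (a b u : R) : shortest_path (surface P) g v x ->
  0 <= a -> a <= u -> u <= b -> b <= 1 ->
  segment (g a) (g b) `<=` ~` interior P -> segment (g a) (g b) (g u).
Proof.
move=> sg a0 au ub b1 out; apply: dist_segment.
have h := shortest_chord_eq sg a0 (le_trans au ub) b1 out.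
have h1 := shortest_chord sg a0 au (le_trans ub b1).
have h2 := shortest_chord sg (le_trans a0 au) ub b1.
rewrite (enormB (g a) (g u)) (enormB (g u) (g b)) (enormB (g a) (g b)); lra.
Qed.

(** The path runs on the chord by [shortest_segment], and the intermediate value
    theorem for the distance to [g b] gives every point of it. *)
Lemma shortest_covers v x g (a b : R) z : shortest_path (surface P) g v x ->
  0 <= a -> a <= b -> b <= 1 ->
  segment (g a) (g b) `<=` ~` interior P -> segment (g a) (g b) z ->
  exists u, [/\ a <= u, u <= b & g u = z].
Proof.
move=> sg a0 ab b1 out abz; have [[cg _ _ _] _ _] := sg.
have cf : {within `[a, b]%classic, continuous (fun t => enorm (g t - g b))}.
  have sub : `[a, b]%classic `<=` `[0, 1]%classic.
    by move=> t /=; rewrite !in_itv/= => /andP[t0 t1]; apply/andP; split; lra.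
  exact: (continuous_subspaceW sub (@continuous_enorm_comp _ _ _ _ (g b) cg)).
have hz := segment_dist abz.
have [|u] := @IVT R (fun t => enorm (g t - g b)) a b (enorm (z - g b)) ab cf.
  rewrite subrr enorm0 min_r ?enorm_ge0// max_l ?enorm_ge0//.
  by have := enorm_ge0 (g a - z); lra.
rewrite in_itv/= => /andP[au ub] e; exists u; split=> //.
apply: segment_same_dist (shortest_segment sg a0 au ub b1 out) abz _.
by [].
Qed.

(** By [shortest_chord] the distance grows strictly while the path moves. *)
Lemma shortest_dist_inj v x g (a b : R) : shortest_path (surface P) g v x ->
  0 <= a -> a <= 1 -> 0 <= b -> b <= 1 -> dist P v (g a) = dist P v (g b) ->
  g a = g b.
Proof.
move=> sg; wlog ab : a b / a <= b => [h|] a0 a1 b0 b1 e.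
  have [ab|/ltW ba] := leP a b; first exact: h.
  by apply: esym; apply: (h b a ba) => //; exact: esym.
have := shortest_chord sg a0 ab b1; rewrite e => h.
have /enorm_eq0/eqP : enorm (g b - g a) = 0.
  by apply/eqP; rewrite eq_le enorm_ge0 andbT; lra.
by rewrite subr_eq0 => /eqP.
Qed.

Lemma shortest_through v x y g : shortest_path (surface P) g v x ->
  segment x y `<=` surface P ->
  dist P v x + enorm (x - y) <= dist P v y ->
  exists2 h, shortest_path (surface P) h v y & trace g `<=` trace h.
Proof.
move=> sg xy le; have Sv := shortest_origin sg; have [[_ _ _ g1] _ _] := sg.
have rx : reach P v x by rewrite -g1; exact: shortest_reach sg ler01 (lexx _).
have Sx : surface P x by apply: xy; exact: segment_l.
have Sy : surface P y by apply: xy; exact: segment_r.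
have ry : reach P v y.
  by apply: reach_segment rx _ => z /xy /(surfaceP HP)[].
apply: (shortest_extend sg xy).
by rewrite !idist_surface// -(fineK rx) -(fineK ry) -EFinD lee_fin.
Qed.

End Distance.

(** * Existence of shortest paths *)

Section Existence.
Context {R : realType} {d : nat}.
Local Notation E := 'rV[R]_d.+1.
Implicit Types (x y z p q w : E) (F G : set E) (g h : R -> E) (J : seq (set E)).
Context {P : set E} (HP : convex_polyhedron P).

Definition facet_union J : set E := [set x | exists2 F, F \in J & F x].

Lemma idist_fin_path (S : set E) v x : intrinsic_dist S v x \is a fin_num ->
  exists2 g, path_in S g v x & path_length g \is a fin_num.
Proof.
rewrite ge0_fin_numE ?idist_ge0// => h.
have [_ [g pg <-] gl] := ereal_inf_lt h.
by exists g; rewrite ?ge0_fin_numE ?length_ge0.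
Qed.

(** On the union of one facet after another, an optimal last corner exists by
    compactness, since there the distance is 1-Lipschitz on each facet. *)
Lemma optimal_corner J (S : set E) v x F : facet P F ->
  {in J, forall H, facet P H} -> {in J, forall H, H `<=` S} ->
  (exists y, [/\ F y, facet_union J y & intrinsic_dist S v y \is a fin_num]) ->
  exists y, [/\ F y, facet_union J y, intrinsic_dist S v y \is a fin_num &
    forall z, F z -> facet_union J z -> intrinsic_dist S v z \is a fin_num ->
      fine (intrinsic_dist S v y) + enorm (y - x) <=
      fine (intrinsic_dist S v z) + enorm (z - x)].
Proof.
move=> fF; set phi := fun y => fine (intrinsic_dist S v y) + enorm (y - x).
have key H : facet P H -> H `<=` S ->
    (exists y, [/\ F y, H y & intrinsic_dist S v y \is a fin_num]) ->
    exists y, [/\ F y, H y, intrinsic_dist S v y \is a fin_num &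
      forall z, F z -> H z -> phi y <= phi z].
  move=> fH HS [y0 [Fy0 Hy0 y0fin]].
  have allfin z : H z -> intrinsic_dist S v z \is a fin_num.
    move=> Hz; rewrite ge0_fin_numE ?idist_ge0//.
    have zS : segment y0 z `<=` S by apply: subset_trans HS; exact: (facet_segment HP fH).
    apply: le_lt_trans (idist_segment v zS) _.
    by rewrite -(fineK y0fin) -EFinD ltry.
  have lip z w : H z -> H w ->
      fine (intrinsic_dist S v w) <= fine (intrinsic_dist S v z) + enorm (z - w).
    move=> Hz Hw; rewrite -lee_fin EFinD !fineK ?allfin//; apply: idist_segment.
    by apply: subset_trans HS; exact: (facet_segment HP fH).
  have [||||y [Fy Hy] hy] := @closed_min _ _ (F `&` H) (fun z => phi z + enorm (y0 - x)) y0 2.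
  - by [].
  - by apply: closedI; [exact: (facet_closed HP fF)|exact: (facet_closed HP fH)].
  - move=> z w [_ Hz] [_ Hw]; rewrite /phi.
    have := lip z w Hz Hw; have := lip w z Hw Hz.
    have := enorm_tri z w x; have := enorm_tri w z x.
    by rewrite (enormB w z) => *; rewrite ler_norml; lra.
  - move=> z _; rewrite /phi.
    have : 0 <= fine (intrinsic_dist S v z) by rewrite fine_ge0 ?idist_ge0.
    have := enorm_tri x z y0; rewrite (enormB x); lra.
  exists y; split=> //; first exact: allfin.
  by move=> z Fz Hz; have := hy z (conj Fz Hz); rewrite lerD2r.
elim: J => [|H J ih] fJ JS; first by move=> [y [_ []]].
have sub y : facet_union J y -> facet_union (H :: J) y.
  by move=> [G GJ Gy]; exists G; rewrite // inE GJ orbT.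
have fJ' : {in J, forall H, facet P H} by move=> G GJ; apply: fJ; rewrite inE GJ orbT.
have JS' : {in J, forall H, H `<=` S} by move=> G GJ; apply: JS; rewrite inE GJ orbT.
have fH : facet P H by apply: fJ; rewrite inE eqxx.
have HS : H `<=` S by apply: JS; rewrite inE eqxx.
have [exH|nexH] := pselect (exists y, [/\ F y, H y & intrinsic_dist S v y \is a fin_num]);
  have [exJ|nexJ] := pselect (exists y, [/\ F y, facet_union J y & intrinsic_dist S v y \is a fin_num]).
- move=> _; have [y [Fy Hy yfin hy]] := key H fH HS exH.
  have [y' [Fy' Jy' yfin' hy']] := ih fJ' JS' exJ.
  have [le|le] := leP (phi y) (phi y').
    exists y; split=> //; first by exists H; rewrite // inE eqxx.
    move=> z Fz [G]; rewrite inE => /predU1P[->|GJ] Gz zfin; first exact: hy.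
    by apply: le_trans le _; apply: hy' => //; exists G.
  exists y'; split=> //; first exact: sub.
  move=> z Fz [G]; rewrite inE => /predU1P[->|GJ] Gz zfin.
    by apply: le_trans (ltW le) _; exact: hy.
  by apply: hy' => //; exists G.
- move=> _; have [y [Fy Hy yfin hy]] := key H fH HS exH.
  exists y; split=> //; first by exists H; rewrite // inE eqxx.
  move=> z Fz [G]; rewrite inE => /predU1P[->|GJ] Gz zfin; first exact: hy.
  by case: nexJ; exists z; split=> //; exists G.
- move=> _; have [y' [Fy' Jy' yfin' hy']] := ih fJ' JS' exJ.
  exists y'; split=> //; first exact: sub.
  move=> z Fz [G]; rewrite inE => /predU1P[->|GJ] Gz zfin.
    by case: nexH; exists z.
  by apply: hy' => //; exists G.
- move=> [y [Fy [G]]]; rewrite inE => /predU1P[->|GJ] Gy yfin.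
    by case: nexH; exists y.
  by case: nexJ; exists y; split=> //; exists G.
Qed.

(** Cut a curve at its first arrival in a facet that contains its endpoint:
    before, it runs in the other facets only; afterwards a segment is at least as
    short.  So minima exist by induction on the number of facets. *)
Lemma shortest_exists_union (k : nat) J v x : (size J <= k)%N ->
  {in J, forall F, facet P F} ->
  intrinsic_dist (facet_union J) v x \is a fin_num ->
  exists g, shortest_path (facet_union J) g v x.
Proof.
elim: k J x => [|k ih] J x sJ fJ fin.
  have [g [_ gS _ _] _] := idist_fin_path fin.
  have [F] : facet_union J (g 0) by apply: gS; exists 0 => //=; rewrite in_itv/= lexx ler01.
  by move: sJ; rewrite leqn0 => /nilP ->.
have [g0 pg0 fg0] := idist_fin_path fin.
have [F FJ Fx] : facet_union J x.
  by have [_ gS _ <-] := pg0; apply: gS; exists 1 => //=; rewrite in_itv/= lexx ler01.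
have fF := fJ F FJ.
have FS : F `<=` facet_union J by move=> y Fy; exists F.
have [Fv|nFv] := pselect (F v).
  have vx : segment v x `<=` facet_union J.
    by apply: subset_trans FS; exact: (facet_segment HP fF).
  exists (line_path v x).
  have e : path_length (line_path v x) = intrinsic_dist (facet_union J) v x.
    apply/eqP; rewrite eq_le (idist_le (line_path_in vx)) andbT.
    by apply: le_trans (length_line _ _) _; rewrite enormB idist_ge.
  by split; rewrite ?e//; exact: line_path_in.
pose J' := [seq H <- J | H != F].
have fJ' : {in J', forall H, facet P H} by move=> H; rewrite mem_filter => /andP[_ /fJ].
have sJ' : (size J' <= k)%N.
  rewrite -ltnS; apply: leq_trans sJ; rewrite size_filter -(count_predC (pred1 F) J).
  rewrite -[X in (X < _)%N]add0n ltn_add2r -has_count has_pred1.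
  exact: FJ.
have arrive g : path_in (facet_union J) g v x -> path_length g \is a fin_num ->
    exists y, [/\ F y, facet_union J' y, intrinsic_dist (facet_union J') v y \is a fin_num &
     fine (intrinsic_dist (facet_union J') v y) + enorm (y - x) <= fine (path_length g)].
  move=> pg fg; have [cg gS gv gx] := pg.
  have [|b [b0 b1 Fb before]] := @first_time _ _ g F 1 cg (facet_closed HP fF) ler01 (lexx _).
    by rewrite gx.
  have bp : 0 < b.
    rewrite lt0r b0 andbT; apply/eqP => b00; apply: nFv.
    by rewrite -gv -b00.
  have gJ' t : 0 <= t -> t < b -> facet_union J' (g t).
    move=> t0 tb; have [H HJ Ht] : facet_union J (g t).
      by apply: gS; exists t => //=; rewrite in_itv/= t0 (le_trans (ltW tb)).
    exists H => //; rewrite mem_filter HJ andbT; apply/eqP => HF.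
    by apply: (before t t0 tb); rewrite -HF.
  have gbJ' : facet_union J' (g b).
    pose g' t := g (1 - t).
    have cg' : {within `[0, 1]%classic, continuous g'}.
      apply/within_continuousP => t; rewrite /= in_itv/= => t01 e e0.
      move/within_continuousP : cg => /(_ (1 - t) _ e e0)[|dl d0 h].
        by rewrite /= in_itv/=; lra.
      exists dl => // u /=; rewrite in_itv/= => u01 ut; apply: h.
        by rewrite /= in_itv/=; lra.
      by rewrite (_ : 1 - u - (1 - t) = t - u); [rewrite distrC|ring].
    have [||||H [HJ' Hb _]] := @next_set _ _ g' J' (1 - b) cg'.
    - by move=> H /fJ'; exact: (facet_closed HP).
    - by lra.
    - by lra.
    - move=> t bt t1; have [] := gJ' (1 - t); [lra|lra|].
      by move=> H HJ' Ht; exists H.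
    by move: Hb; rewrite /g' subKr => Hb; exists H.
  have glE : path_length g = (fine (path_length g))%:E by rewrite fineK.
  have := length_subpaths b0 b1 (lexx 1) glE; rewrite gx => len.
  have psub : path_in (facet_union J') (subpath g 0 b) v (g b).
    have [c1 _ c2 c3] := subpath_in pg (lexx 0) b0 b1; split=> //; last by rewrite c2.
    move=> _ [t /= + <-]; rewrite in_itv/= => /andP[t0 t1]; rewrite /subpath add0r subr0.
    have [tb|tb] := ltP (t * b) b; first by apply: gJ' => //; rewrite mulr_ge0.
    by have -> : t * b = b by nra.
  have lsub : path_length (subpath g 0 b) \is a fin_num.
    rewrite ge0_fin_numE ?length_ge0//; apply: le_lt_trans (ltry (fine (path_length g))).
    apply: le_trans len; rewrite -addeA leeDl// adde_ge0 ?length_ge0//.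
    by rewrite lee_fin enorm_ge0.
  have idfin : intrinsic_dist (facet_union J') v (g b) \is a fin_num.
    rewrite ge0_fin_numE ?idist_ge0//; apply: le_lt_trans (idist_le psub) _.
    by rewrite -ge0_fin_numE ?length_ge0.
  exists (g b); split=> //; rewrite -lee_fin EFinD fineK//.
  apply: le_trans len; rewrite -[leLHS]adde0; apply: leeD; last exact: length_ge0.
  by rewrite enormB; apply: leeD => //; exact: idist_le.
have [y1 [Fy1 Jy1 fy1 _]] := arrive g0 pg0 fg0.
have J'S : {in J', forall H, H `<=` facet_union J'} by move=> H HJ' z Hz; exists H.
have [|y [Fy Jy fy hy]] := optimal_corner x fF fJ' J'S (v := v).
  by exists y1.
have [h sh] := ih J' y sJ' fJ' fy.
have [ph eh fh] := sh.
have J'J : facet_union J' `<=` facet_union J.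
  by move=> z [H]; rewrite mem_filter => /andP[_ HJ] Hz; exists H.
have ph' : path_in (facet_union J) h v y.
  by have [c hS h0 h1] := ph; split=> //; apply: subset_trans J'J.
have yx : segment y x `<=` facet_union J.
  by apply: subset_trans FS; exact: (facet_segment HP fF).
have pc := concat_path_in ph' (line_path_in yx).
have lc : (path_length (concat_path h (line_path y x)) <=
    (fine (intrinsic_dist (facet_union J') v y) + enorm (y - x))%:E)%E.
  by apply: length_concat; [rewrite fineK// eh|exact: length_line].
exists (concat_path h (line_path y x)).
have e : path_length (concat_path h (line_path y x)) = intrinsic_dist (facet_union J) v x.
  apply/eqP; rewrite eq_le idist_le// andbT; apply: le_trans lc _.
  apply: le_ereal_inf_tmp => _ [g pg <-].
  have [fg|/negP ig] := boolP (path_length g \is a fin_num); last first.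
    suff -> : path_length g = +oo%E by rewrite leey.
    apply/eqP; rewrite -leye_eq leNgt; apply/negP => hy'; apply: ig.
    by rewrite ge0_fin_numE ?length_ge0.
  have [z [Fz Jz fz lez]] := arrive g pg fg.
  rewrite -(fineK fg) lee_fin; apply: le_trans lez; exact: hy.
by split=> //; rewrite e.
Qed.

Lemma shortest_exists v x : surface P v -> surface P x -> reach P v x ->
  exists g, shortest_path (surface P) g v x.
Proof.
move=> Sv Sx rx; have [s sF] := facets_finite HP.
have sE : surface P = facet_union s.
  apply/seteqP; split=> y.
    by move=> /(facet_cover HP)[F fF Fy]; exists F => //; apply/sF.
  by move=> [F /sF fF]; exact: (facet_surface HP fF).
have := rx; rewrite /reach -(idist_surface HP Sv Sx) sE.
by apply: (@shortest_exists_union (size s)) => // F /sF.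
Qed.

End Existence.

(** * Shortest paths cross ridges *)

Section Corners.
Context {R : realType} {d : nat}.
Local Notation E := 'rV[R]_d.+1.
Implicit Types (x y z p q w o : E) (F G : set E) (g h : R -> E).
Context {P : set E} (HP : convex_polyhedron P).

Local Notation gap := (gap P).
Local Notation normal := (normal P).
Local Notation fold := (@fold _ _ P).
Local Notation dist := (dist P).
Local Notation reach := (reach P).

Lemma gap_crossing F x y : gap F x <= 0 -> 0 <= gap F y ->
  exists2 z, segment x y z & gap F z = 0.
Proof.
move=> x0 y0; have [e|ne] := eqVneq (gap F x) 0.
  by exists x => //; exact: segment_l.
have d0 : 0 < gap F y - gap F x by rewrite subr_gt0 (lt_le_trans _ y0)// lt_neqAle ne.
exists ((1 - (- gap F x / (gap F y - gap F x))) *: x +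
  (- gap F x / (gap F y - gap F x)) *: y).
  apply/segmentP; exists (- gap F x / (gap F y - gap F x)); split=> //.
    by rewrite divr_ge0 ?oppr_ge0// ltW.
  by rewrite ler_pdivrMr// mul1r lerDr.
by rewrite gap_line; field; rewrite gt_eqF.
Qed.

(** Unrolling the wedge of two facet hyperplanes gives an outside path as short
    as the straight segment in the unrolled picture. *)
Lemma dist_fold v F F' x y : facet P F -> facet P F' ->
  0 < 1 + edot (normal F) (normal F') ->
  gap F x = 0 -> 0 <= gap F' x -> gap F' y = 0 -> 0 <= gap F y -> reach v x ->
  dist v y <= dist v x + enorm (fold F F' x - y).
Proof.
move=> fF fF' c0 x0 x1 y0 y1 rx.
have g0 := gap_fold_target HP fF' c0 x.
have g1 : gap F (fold F F' x) <= 0 by rewrite (gap_fold_source HP fF c0 x0) oppr_le0.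
have [z fyz z0] := gap_crossing g1 y1.
have z0' : gap F' z = 0 := gap_segment0 g0 y0 fyz.
rewrite -(segment_dist fyz).
have -> : enorm (fold F F' x - z) = enorm (x - z).
  by rewrite -[in LHS](fold_fix F z0') fold_dist.
have xz := hyperplane_outside HP fF x0 z0.
have zy := hyperplane_outside HP fF' z0' y0.
have := dist_along_segment rx xz; have := dist_along_segment (reach_segment rx xz) zy; lra.
Qed.

Lemma corner_straight v F F' x q y : facet P F -> facet P F' ->
  0 < 1 + edot (normal F) (normal F') ->
  gap F x = 0 -> 0 <= gap F' x -> gap F q = 0 -> gap F' q = 0 ->
  gap F' y = 0 -> 0 <= gap F y -> reach v x ->
  dist v x + enorm (x - q) + enorm (q - y) <= dist v y ->
  segment (fold F F' x) y q.
Proof.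
move=> fF fF' c0 x0 x1 q0 q0' y0 y1 rx le; apply: dist_segment.
have -> : enorm (fold F F' x - q) = enorm (x - q).
  by rewrite -[in LHS](fold_fix F q0') fold_dist.
have := dist_fold fF fF' c0 x0 x1 y0 y1 rx; lra.
Qed.

Lemma enorm_first_order x q e (t : R) : x != q -> enorm (x - (q + t *: e)) <=
  enorm (x - q) - t * edot (x - q) e / enorm (x - q) +
  t ^+ 2 * edot e e / (2 * enorm (x - q)).
Proof.
move=> xq; have n0 : 0 < enorm (x - q) by rewrite enorm_gt0// subr_eq0.
set X := enorm (x - q) in n0 *; set u := enorm _.
have uu : u ^+ 2 = X ^+ 2 - 2 * t * edot (x - q) e + t ^+ 2 * edot e e.
  rewrite !enorm_sqr.
  have -> : x - (q + t *: e) = (x - q) - t *: e by rewrite opprD addrA.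
  move: (x - q) => a; rewrite !edotlrE (edotC e a); ring.
have -> : X - t * edot (x - q) e / X + t ^+ 2 * edot e e / (2 * X) =
    (u ^+ 2 + X ^+ 2) / (2 * X) by rewrite uu; field; rewrite gt_eqF.
rewrite ler_pdivlMr ?mulr_gt0//; have := sqr_ge0 (u - X); rewrite sqrrB; lra.
Qed.

Lemma corner_estimate (s t eta C k l w : R) : 0 <= s -> 0 < t -> s = eta * t ->
  k = l - w -> 0 <= C ->
  l <= (1 - s) * (l + t ^+ 2 * C) + s * w -> eta * k <= C * t.
Proof.
move=> s0 t0 sE kE C0 h; rewrite -(ler_pM2l t0).
have tC : 0 <= s * (t ^+ 2 * C) by rewrite !mulr_ge0// ltW.
have -> : t * (eta * k) = s * k by rewrite sE; ring.
by rewrite kE; lra.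
Qed.

(** A shortest path that enters a facet [F'] from the interior side of [F] crosses
    the relative interior of a ridge.  Otherwise some inequality of [P], active at
    the corner [q], fails in a direction [e] along both hyperplanes.  Shift the
    corner by [t e]: the path unrolls to a straight line, so this costs only
    [O(t^2)], but cutting the corner through the failed half-space saves a
    multiple of [t]. *)
Lemma corner_on_ridge v F F' x q y : facet P F -> facet P F' -> F <> F' ->
  F x -> 0 < gap F' x -> F q -> F' q -> F' y -> 0 < gap F y -> reach v x ->
  dist v x + enorm (x - q) + enorm (q - y) <= dist v y ->
  ridge_nbhd (P := P) F F' q.
Proof.
move=> fF fF' ne Fx x1 Fq F'q F'y y1 rx le; apply: contrapT => nrn.
have c0 := normals_not_opposite HP fF fF' ne Fq F'q.
have [x0 q0] := (facet_gap HP fF Fx, facet_gap HP fF Fq).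
have [y0 q0'] := (facet_gap HP fF' F'y, facet_gap HP fF' F'q).
have [l [PE l0 _]] := polyhedron_list HP.
have lP c z : c \in l -> P z -> edot c.1 z <= c.2 by move=> cl; rewrite PE; exact.
have Pq := facet_sub HP fF Fq.
have [r r0 hr] : exists2 r : R, 0 < r & forall z, enorm (z - q) < r ->
    {in [seq c <- l | edot c.1 q != c.2], forall c, edot c.1 z < c.2}.
  apply: strict_nbhd => c; rewrite mem_filter => /andP[cq cl].
  by rewrite lt_neqAle cq lP.
have [z [z0 z0' zr nPz]] : exists z, [/\ gap F z = 0, gap F' z = 0,
    enorm (z - q) < r & ~ P z].
  apply: contrapT => h; apply: nrn; exists r => // z z0 z0' zr.
  by apply: contrapT => nPz; apply: h; exists z.
have [c [cl cq cz]] : exists c, [/\ c \in l, edot c.1 q = c.2 & c.2 < edot c.1 z].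
  apply: contrapT => h; apply: nPz; rewrite PE => c cl.
  rewrite leNgt; apply/negP => cz; have [cq|cq] := eqVneq (edot c.1 q) c.2.
    by apply: h; exists c.
  have := hr z zr c; rewrite mem_filter cq cl => /(_ isT); lra.
have [e eE] : exists e, e = z - q by eexists.
have eF : edot (normal F) e = 0 by rewrite eE -gapB z0 q0 subrr.
have eF' : edot (normal F') e = 0 by rewrite eE -gapB z0' q0' subrr.
have ce : 0 < edot c.1 e by rewrite eE edotBr cq subr_gt0.
have xq : x != q by apply: contraTneq x1 => ->; rewrite q0' ltxx.
have yq : y != q by apply: contraTneq y1 => ->; rewrite q0 ltxx.
have X0 : 0 < enorm (x - q) by rewrite enorm_gt0// subr_eq0.
have Y0 : 0 < enorm (y - q) by rewrite enorm_gt0// subr_eq0.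
have xy : enorm (x - y) < enorm (x - q) + enorm (y - q).
  rewrite ltNge (enormB y); apply/negP => /dist_segment xyq.
  have gx : 0 <= gap F x by rewrite x0.
  by have /eqP := gap_segment_strict xyq gx y1 q0; rewrite eq_sym (negbTE xq).
have fx : edot (fold F F' x - q) e = edot (x - q) e.
  rewrite foldE; set k := _ / _; set u := normal F + normal F'.
  have ue : edot u e = 0 by rewrite /u edotDl eF eF' addr0.
  have -> : x + k *: u - q = (x - q) + k *: u by rewrite addrAC.
  by move: (x - q) => a; rewrite edotDl edotZl ue mulr0 addr0.
have fxn : enorm (fold F F' x - q) = enorm (x - q).
  by rewrite -[in LHS](fold_fix F q0') fold_dist.
have bal : edot (x - q) e * enorm (y - q) + edot (y - q) e * enorm (x - q) = 0.
  have := corner_straight fF fF' c0 x0 (ltW x1) q0 q0' y0 (ltW y1) rx le.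
  case/segmentP=> t [t0 t1 qE].
  have tE : (1 - t) *: (fold F F' x - q) = (- t) *: (y - q).
    apply/rowP => i; move/rowP: qE => /(_ i); rewrite !mxE; lra.
  have h1 : (1 - t) * edot (x - q) e = - t * edot (y - q) e.
    by rewrite -fx -!edotZl tE.
  have h2 : (1 - t) * enorm (x - q) = t * enorm (y - q).
    have := congr1 enorm tE; rewrite !enormZ normrN fxn !ger0_norm// subr_ge0//.
  have t1' : 0 < 1 - t.
    rewrite lt0r subr_ge0 t1 andbT; apply/eqP => t10.
    by move: h2; rewrite t10 (_ : t = 1) ?mul0r ?mul1r; lra.
  apply: (mulfI (lt0r_neq0 t1')); rewrite mulr0 mulrDr !mulrA h1.
  have -> : (1 - t) * edot (y - q) e * enorm (x - q) =
    edot (y - q) e * ((1 - t) * enorm (x - q)) by ring.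
  by rewrite h2; ring.
set X := enorm (x - q) in X0 xy bal le *.
set Y := enorm (y - q) in Y0 xy bal le *.
have cx : edot c.1 x <= c.2 by apply: lP => //; exact: (facet_sub HP fF).
have cy : edot c.1 y <= c.2 by apply: lP => //; exact: (facet_sub HP fF').
pose k := edot c.1 e; pose M := (c.2 - edot c.1 x) + (c.2 - edot c.1 y).
have M0 : 0 <= M by rewrite /M; lra.
have kM : 0 < 2 * (k + M) by rewrite mulr_gt0// ltr_wpDr.
(* Cutting off the fraction [eta * t] next to the shifted corner stays beyond the
   hyperplane of [c]: the shift gains [t * k] and the cut loses at most
   [eta * t * (k + M)], which is half of it. *)
pose eta := k / (2 * (k + M)).
have eta0 : 0 < eta by rewrite divr_gt0.
have etaE : eta * (2 * (k + M)) = k by rewrite divfK// gt_eqF.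
have D0 : 0 <= edot e e := edot_ge0 e.
pose C := edot e e / (2 * X) + edot e e / (2 * Y).
have C0 : 0 <= C by rewrite addr_ge0// divr_ge0// mulr_ge0// ltW.
pose k0 := X + Y - enorm (x - y); have k00 : 0 < k0 by rewrite subr_gt0.
have bound t : 0 < t -> t <= 1 -> eta * k0 <= C * t.
  move=> t0 t1; pose s := eta * t.
  have s0 : 0 < s by rewrite mulr_gt0.
  have eta1 : eta <= 2^-1.
    by rewrite -(ler_pM2r kM) etaE; rewrite /k in M0 kM *; lra.
  have s1 : s <= 2^-1 by rewrite /s; nra.
  have [zt ztE] : exists zt, zt = q + t *: e by eexists.
  have gzF : gap F zt = 0 by rewrite ztE gapD q0 edotZr eF mulr0 subrr.
  have gzF' : gap F' zt = 0 by rewrite ztE gapD q0' edotZr eF' mulr0 subrr.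
  have [m1 m1E] : exists m1, m1 = (1 - s) *: zt + s *: x by eexists.
  have [m2 m2E] : exists m2, m2 = (1 - s) *: zt + s *: y by eexists.
  have g1 : gap F m1 = 0 by rewrite m1E gap_line gzF x0 !mulr0 addr0.
  have g2 : gap F' m2 = 0 by rewrite m2E gap_line gzF' y0 !mulr0 addr0.
  have beyond w : edot c.1 w <= c.2 -> c.2 - edot c.1 w <= M ->
      c.2 <= edot c.1 ((1 - s) *: zt + s *: w).
    move=> cw wM; rewrite !edotrE ztE !edotrE cq -/k.
    have h1 : s * (c.2 - edot c.1 w) <= s * M by rewrite ler_pM2l.
    have h2 : t * (eta * (2 * (k + M))) = t * k by rewrite etaE.
    have h3 : 0 <= (2^-1 - s) * (t * k).
      by rewrite mulr_ge0 ?subr_ge0// mulr_ge0 ?ltW.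
    have h4 : s * (2 * (k + M)) = t * k by rewrite -h2 /s; ring.
    have h5 : 0 < s * k by rewrite mulr_gt0.
    rewrite -subr_ge0.
    have -> : (1 - s) * (c.2 + t * k) + s * edot c.1 w - c.2 =
      (t * k - s * (t * k)) - s * (c.2 - edot c.1 w) by ring.
    lra.
  have out1 := hyperplane_outside HP fF x0 g1.
  have out2 : segment m1 m2 `<=` ~` interior P.
    move=> w m12; apply: (supporting_not_interior (a := c.1) (b := c.2)).
    - exact: l0.
    - by move=> p; exact: lP.
    have h1 : c.2 <= edot c.1 m1 by rewrite m1E; apply: beyond => //; rewrite /M; lra.
    have h2 : c.2 <= edot c.1 m2 by rewrite m2E; apply: beyond => //; rewrite /M; lra.
    by case/segmentP: m12 => u [u0 u1 ->]; rewrite !edotrE; move: u0 u1 h1 h2; clear; nra.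
  have out3 := hyperplane_outside HP fF' g2 y0.
  have r1 := reach_segment rx out1; have r2 := reach_segment r1 out2.
  have d1 := dist_along_segment rx out1; have d2 := dist_along_segment r1 out2.
  have d3 := dist_along_segment r2 out3.
  have e1 : enorm (x - m1) = (1 - s) * enorm (x - zt).
    have -> : x - m1 = (1 - s) *: (x - zt).
      by rewrite m1E; apply/rowP => i; rewrite !mxE; ring.
    by rewrite enormZ ger0_norm//; move: s1; clear; lra.
  have e2 : enorm (m1 - m2) = s * enorm (x - y).
    have -> : m1 - m2 = s *: (x - y).
      by rewrite m1E m2E; apply/rowP => i; rewrite !mxE; ring.
    by rewrite enormZ gtr0_norm.
  have e3 : enorm (m2 - y) = (1 - s) * enorm (y - zt).
    have -> : m2 - y = (- (1 - s)) *: (y - zt).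
      by rewrite m2E; apply/rowP => i; rewrite !mxE; ring.
    by rewrite enormZ normrN ger0_norm//; move: s1; clear; lra.
  have hx := enorm_first_order e t xq; have hy := enorm_first_order e t yq.
  rewrite -ztE -/X in hx; rewrite -ztE -/Y in hy.
  have sum : enorm (x - zt) + enorm (y - zt) <= X + Y + t ^+ 2 * C.
    have -> : X + Y + t ^+ 2 * C = (X - t * edot (x - q) e / X + t ^+ 2 * edot e e / (2 * X)) +
        (Y - t * edot (y - q) e / Y + t ^+ 2 * edot e e / (2 * Y)) +
        t * (edot (x - q) e * Y + edot (y - q) e * X) / (X * Y).
      by rewrite /C; field; rewrite !gt_eqF.
    by rewrite bal mulr0 mul0r addr0; apply: lerD.
  rewrite (enormB q) -/Y in le.
  apply: (@corner_estimate s t eta C k0 (X + Y) (enorm (x - y))) => //; first exact: ltW.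
  have : (1 - s) * (enorm (x - zt) + enorm (y - zt)) <= (1 - s) * (X + Y + t ^+ 2 * C).
    by apply: ler_wpM2l sum; move: s1; clear; lra.
  have tot : X + Y <= enorm (x - m1) + enorm (m1 - m2) + enorm (m2 - y).
    by move: d1 d2 d3 le; clear; lra.
  by move: tot; rewrite e1 e2 e3; clear; lra.
have ek : 0 < eta * k0 by rewrite mulr_gt0.
pose t := Num.min 1 (eta * k0 / 2 / (C + 1)).
have C1 : 0 < C + 1 by rewrite ltr_wpDl.
have t0 : 0 < t by rewrite lt_min ltr01 !divr_gt0.
have t1 : t <= 1 by rewrite ge_min lexx.
have tb : t * (C + 1) <= eta * k0 / 2.
  by rewrite -ler_pdivlMr// ge_min lexx orbT.
have := bound t t0 t1; lra.
Qed.

(** Near [q] the polyhedron is a wedge, so that near a point of [F'] only the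
    inequality of [F] could fail, and it is strict off the ridge. *)
Lemma enter_relint F F' q y : facet P F -> facet P F' -> F <> F' ->
  F q -> F' q -> ridge_nbhd (P := P) F F' q -> F' y -> 0 < gap F y ->
  exists2 m, segment q y m & relint F' m.
Proof.
move=> fF fF' ne Fq F'q rn F'y y1.
have [r r0 hr] := ridge_wedge HP fF fF' ne Fq F'q rn.
have d0 : 0 < enorm (y - q) + 1 by rewrite ltr_wpDl ?enorm_ge0.
pose t := Num.min 1 (r / 2 / (enorm (y - q) + 1)).
have t0 : 0 < t by rewrite lt_min ltr01 !divr_gt0.
have t1 : t <= 1 by rewrite ge_min lexx.
have [m mE] : exists m, m = (1 - t) *: q + t *: y by eexists.
have qym : segment q y m by apply/segmentP; exists t; split=> //; exact: ltW.
exists m => //; apply/(relint_facetP HP fF'); split.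
  exact: (facet_segment HP fF' F'q F'y).
have gm : 0 < gap F m by rewrite mE gap_line (facet_gap HP fF Fq); nra.
have mr : enorm (m - q) < r.
  have -> : m - q = t *: (y - q) by rewrite mE; apply/rowP => i; rewrite !mxE; ring.
  rewrite enormZ gtr0_norm//.
  have : t <= r / 2 / (enorm (y - q) + 1) by rewrite ge_min lexx orbT.
  rewrite ler_pdivlMr//; have := enorm_ge0 (y - q); nra.
have [|r' r'0 h] := @strict_nbhd _ _ [:: (normal F, (facet_data P F).2)] m.
  by move=> f; rewrite inE => /eqP -> /=; rewrite -subr_gt0.
exists (Num.min r' (r - enorm (m - q))); first by rewrite lt_min r'0 subr_gt0.
move=> z z0; rewrite lt_min => /andP[zr' zr]; apply: hr.
- apply: le_lt_trans (enorm_tri m _ _) _; lra.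
- by rewrite subr_ge0; apply/ltW/(h z zr' (normal F, _)); rewrite inE eqxx.
- by rewrite z0.
Qed.

(** Nearby targets are seen from [o] through the same hyperplane, near the same
    point: this is how estimates near one corner carry over to the next. *)
Lemma crossing_near F o p q (r : R) : facet P F -> segment o p q -> gap F q = 0 ->
  gap F o <= 0 -> gap F o < gap F p -> 0 < r ->
  exists2 e : R, 0 < e & forall y, enorm (y - p) < e -> 0 <= gap F y ->
    exists z, [/\ segment o y z, gap F z = 0 & enorm (z - q) < r].
Proof.
move=> fF /segmentP[t [t0 t1 qE]] q0 o0 op r0.
pose D := gap F p - gap F o; have D0 : 0 < D by rewrite subr_gt0.
pose N := 1 + 2 / D * (enorm (p - o) + 1).
have N0 : 0 < N.
  have := mulr_ge0 (divr_ge0 (ler0n R 2) (ltW D0)) (addr_ge0 (enorm_ge0 (p - o)) ler01).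
  by rewrite /N; lra.
exists (Num.min (Num.min 1 (D / 2)) (r / N)); first by rewrite !lt_min ltr01 !divr_gt0.
move=> y; rewrite !lt_min => /andP[/andP[y1 yD] yN] y0.
have n1 : enorm (normal F) = 1 by rewrite /enorm (normal_unit HP fF) sqrtr1.
have gl : `|gap F y - gap F p| <= enorm (y - p).
  have := edot_le_enorm (normal F) (p - y); have := edot_ge_enorm (normal F) (p - y).
  by rewrite n1 mul1r -gapB (enormB p) => *; rewrite ler_norml; lra.
have gyo : D / 2 < gap F y - gap F o.
  move: gl; rewrite ler_norml => /andP[h _]; rewrite /D in yD *; lra.
have yo0 : 0 < gap F y - gap F o by apply: lt_trans gyo; rewrite divr_gt0.
pose lam := - t * (gap F y - gap F p) / (gap F y - gap F o).
have lamE : lam * (gap F y - gap F o) = - t * (gap F y - gap F p).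
  by rewrite /lam divfK// gt_eqF.
have tq : (1 - t) * gap F o + t * gap F p = 0 by rewrite -gap_line -qE.
have [z zE] : exists z, z = (1 - (t + lam)) *: o + (t + lam) *: y by eexists.
have z0 : gap F z = 0 by rewrite zE gap_line; lra.
exists z; split=> //.
  apply/segmentP; exists (t + lam); split=> //.
    rewrite -(pmulr_lge0 _ yo0) mulrDl lamE; lra.
  rewrite -(ler_pM2r yo0) mulrDl lamE; lra.
have -> : z - q = t *: (y - p) + lam *: (y - o).
  by rewrite zE qE; apply/rowP => i; rewrite !mxE; ring.
apply: le_lt_trans (enormD _ _) _; rewrite !enormZ (ger0_norm t0).
have ey := enorm_ge0 (y - p); have eo := enorm_ge0 (y - o).
have lamb : `|lam| <= 2 / D * enorm (y - p).
  rewrite /lam normrM normfV (gtr0_norm yo0) ler_pdivrMr// normrM normrN (ger0_norm t0).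
  have h1 : t * `|gap F y - gap F p| <= enorm (y - p).
    by apply: le_trans gl; rewrite ler_piMl.
  apply: le_trans h1 _.
  have h2 : 2 / D * enorm (y - p) * (D / 2) <= 2 / D * enorm (y - p) * (gap F y - gap F o).
    apply: ler_wpM2l; last exact: ltW.
    by apply: mulr_ge0 => //; apply: divr_ge0 => //; exact: ltW.
  apply: le_trans h2; rewrite le_eqVlt; apply/orP; left; apply/eqP.
  by field; rewrite gt_eqF.
have yo : enorm (y - o) <= enorm (p - o) + 1.
  by apply: le_trans (enorm_tri p _ _) _; lra.
rewrite ltr_pdivlMr// in yN; apply: le_lt_trans yN.
have h3 : `|lam| * enorm (y - o) <= 2 / D * enorm (y - p) * (enorm (p - o) + 1).
  by apply: ler_pM.
have h4 : t * enorm (y - p) <= enorm (y - p) by rewrite ler_piMl.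
by rewrite /N; lra.
Qed.

End Corners.

(** * Polygons that unroll to a segment *)

Section Chains.
Context {R : realType} {d : nat}.
Local Notation E := 'rV[R]_d.+1.
Implicit Types (x y z p q w o : E) (F G A B : set E) (g h : R -> E) (L : seq (set E)).
Context {P : set E} (HP : convex_polyhedron P).

Local Notation gap := (gap P).
Local Notation fold := (@fold _ _ P).
Local Notation dist := (dist P).
Local Notation reach := (reach P).

(** Polygons in the surface that unroll to a straight segment: [chain v F o p A]
    when such a polygon [A] from [v] ends at [p] in the facet [F], and its
    unrolling into the hyperplane of [F] is the segment from [o] to [p]. *)
Inductive chain (v : E) : set E -> E -> E -> set E -> Prop :=
| chain_start F p : facet P F -> relint F v -> F p -> chain v F v p (segment v p)
| chain_step F F' o q p A : chain v F o q A -> share_ridge P F F' -> F' q -> F' p ->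
    0 < gap F p -> ridge_nbhd (P := P) F F' q -> segment (fold F F' o) p q ->
    chain v F' (fold F F' o) p (A `|` segment q p).

Lemma chain_facet v F o p A : chain v F o p A -> [/\ facet P F, F p & gap F o = 0].
Proof.
case=> [G p' fG /relint_sub Gv Gp|G G' o' q p' A' _ sr G'q G'p _ _ _].
  by split=> //; exact: (facet_gap HP fG).
have c0 := share_ridge_not_opposite HP sr.
by case: sr => fG fG' _ _; split=> //; exact: (gap_fold_target HP fG' c0).
Qed.

(** The source is in the relative interior of the first facet; in a later facet
    the last segment starts at a ridge and leaves it. *)
Lemma chain_relint v F o p A : chain v F o p A -> exists2 m, segment o p m & relint F m.
Proof.
case=> [G p' fG Gv Gp|G G' o' q p' A' ch sr G'q G'p gp rn st].
  by exists v => //; exact: segment_l.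
have [_ Gq _] := chain_facet ch; case: (sr) => fG fG' ne _.
have [m qpm mG'] := enter_relint HP fG fG' ne Gq G'q rn G'p gp.
exists m => //; rewrite segment_sym in st *; rewrite segment_sym in qpm.
exact: segment_sub st _ qpm.
Qed.

(** Folding the segments from [o] to nearby targets back along the chain gives
    paths of the same length. *)
Lemma chain_support v F o p A : chain v F o p A -> exists2 r : R, 0 < r &
  forall y, gap F y = 0 -> enorm (y - p) < r -> reach v y /\ dist v y <= enorm (o - y).
Proof.
elim=> [G p' fG /relint_sub Gv Gp|G G' o' q p' A' ch [r r0 hr] sr G'q G'p gp rn st].
  have [rv dv] := reach_origin HP (facet_surface HP fG Gv).
  exists 1 => // y y0 _.
  have out := hyperplane_outside HP fG (facet_gap HP fG Gv) y0.
  split; first exact: reach_segment rv out.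
  by have := dist_along_segment rv out; rewrite dv add0r.
have [_ Gq o0] := chain_facet ch; have c0 := share_ridge_not_opposite HP sr.
case: (sr) => fG fG' ne _; have q0 := facet_gap HP fG Gq.
have fo0 := gap_fold_target HP fG' c0 o'.
have fo1 : gap G (fold G G' o') <= 0.
  rewrite leNgt; apply/negP => h; move: st => /segmentP[t [t0 t1 qE]].
  by move: q0; rewrite qE gap_line; nra.
have [|e e0 he] := crossing_near HP fG st q0 fo1 _ r0; first exact: le_lt_trans gp.
have [|e' e'0 he'] := @strict_nbhd _ _ [:: (normal P G, (facet_data P G).2)] p'.
  by move=> f; rewrite inE => /eqP -> /=; rewrite -subr_gt0.
exists (Num.min e e'); first by rewrite lt_min e0.
move=> y y0; rewrite lt_min => /andP[ye ye'].
have gy : 0 <= gap G y.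
  by rewrite subr_ge0; apply/ltW/(he' y ye' (normal P G, _)); rewrite inE eqxx.
have [z [oyz z0 zr]] := he y ye gy.
have z0' := gap_segment0 fo0 y0 oyz.
have [rz dz] := hr z z0 zr.
have out := hyperplane_outside HP fG' z0' y0.
split; first exact: reach_segment rz out.
rewrite -(segment_dist oyz).
have -> : enorm (fold G G' o' - z) = enorm (o' - z).
  by rewrite -[in LHS](fold_fix G z0') fold_dist.
have := dist_along_segment rz out; lra.
Qed.

(** Along the ray from [o] to [p] the polyhedron is left for the last time, going
    backwards, at a single point. *)
Lemma chain_last_corner F F' q q' o p : facet P F -> facet P F' ->
  segment o p q -> segment o p q' -> gap F q = 0 -> 0 < gap F p ->
  gap F' q' = 0 -> 0 < gap F' p -> P q -> P q' -> q = q'.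
Proof.
move=> fF fF' /segmentP[t [t0 t1 qE]] /segmentP[s [s0 s1 q'E]] q0 gp q0' gp' Pq Pq'.
have g1 := gap_ge0 HP fF Pq'; have g2 := gap_ge0 HP fF' Pq.
rewrite qE gap_line in q0; rewrite qE gap_line in g2.
rewrite q'E gap_line in q0'; rewrite q'E gap_line in g1.
rewrite qE q'E; suff -> : t = s by [].
have key (t' s' a b : R) : s' <= 1 -> t' < s' -> 0 < b ->
    (1 - s') * a + s' * b = 0 -> 0 <= (1 - t') * a + t' * b -> False.
  move=> h1 h2 b0 e h; have h3 : 0 <= 1 - s' by lra.
  have := mulr_ge0 h3 h.
  have -> : (1 - s') * ((1 - t') * a + t' * b) =
    (1 - t') * ((1 - s') * a + s' * b) + (t' - s') * b by ring.
  by rewrite e mulr0 add0r; nra.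
have [ts|ts|//] := ltgtP t s; first by case: (key _ _ _ _ s1 ts gp' q0' g2).
by case: (key _ _ _ _ t1 ts gp q0 g1).
Qed.

Lemma chain_inv v F o p B : chain v F o p B ->
  [/\ o = v, relint F v & B = segment v p] \/
  exists G o' q A, [/\ chain v G o' q A, share_ridge P G F, F q,
    [/\ 0 < gap G p, ridge_nbhd (P := P) G F q, o = fold G F o' & segment o p q] &
    B = A `|` segment q p].
Proof.
by case=> [G p' _ Gv _|G G' o' q p' A ch sr G'q _ gp rn st]; [left|
  right; exists G, o', q, A].
Qed.

Lemma chain_step_origin v F G q p : facet P F -> facet P G -> G <> F -> G q ->
  0 < gap G p -> relint F v -> segment v p q -> False.
Proof.
move=> fF fG ne Gq gp Fv st; have Fv' := relint_sub Fv.
have gv := gap_ge0 HP fG (facet_sub HP fF Fv').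
have qv := gap_segment_strict st gv gp (facet_gap HP fG Gq).
by apply: ne; apply/esym/(relint_facet_eq HP fF fG Fv); rewrite -qv.
Qed.

(** Unrolled chains determine the polygon: read backwards, the segment towards
    [o] can leave the facet only at one point, and there into only one facet. *)
Lemma chain_unique v F o p A B : chain v F o p A -> chain v F o p B -> A = B.
Proof.
move=> ch; elim: ch B => {F o p A}.
  move=> F p fF Fv Fp B /chain_inv[[_ _ ->]//|].
  move=> [G [ o' [q [A [ch sr _ [gp _ oE st] _]]]]].
  case: (sr) => fG _ ne _; have [_ Gq _] := chain_facet ch.
  by case: (chain_step_origin fF fG ne Gq gp Fv st).
move=> F F' o q p A ch ih sr F'q F'p gp rn st B.
case: (sr) => fF fF' ne _; have [_ Fq o0] := chain_facet ch.
case/chain_inv=> [[oE F'v _]|].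
  by rewrite oE in st; case: (chain_step_origin fF' fF ne Fq gp F'v st).
move=> [G [ o' [q' [A' [ch' sr' _ [gp' rn' oE st'] ->]]]]].
case: (sr') => fG _ ne' _; have [_ Gq' o0'] := chain_facet ch'.
have qq : q = q'.
  apply: (chain_last_corner fF fG st st' _ gp _ gp').
  - exact: (facet_gap HP fF).
  - exact: (facet_gap HP fG).
  - exact: (facet_sub HP fF).
  - exact: (facet_sub HP fG).
rewrite -{}qq in ch' Gq' *.
have GF : G = F by case: (ridge_two_facets HP fF fF' ne Fq F'q rn fG Gq').
rewrite GF in ch' oE o0'; have c0 := share_ridge_not_opposite HP sr.
have ow : o = o'.
  by rewrite -(foldK HP fF fF' c0 o0) oE (foldK HP fF fF' c0 o0').
by rewrite -ow in ch'; rewrite (ih _ ch').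
Qed.

End Chains.

(** * Unfolding a shortest path *)

Section Unfolding.
Context {R : realType} {d : nat}.
Local Notation E := 'rV[R]_d.+1.
Implicit Types (x y z p q w o : E) (F G A B : set E) (g h : R -> E) (L : seq (set E)).
Context {P : set E} (HP : convex_polyhedron P).

Local Notation gap := (gap P).
Local Notation fold := (@fold _ _ P).
Local Notation dist := (dist P).
Local Notation reach := (reach P).

Definition linked_facets L := forall i, (i.+1 < size L)%N ->
  share_ridge P (nth set0 L i) (nth set0 L i.+1).

Lemma linked_rcons L F F' : linked_facets (rcons (rcons L F) F') ->
  linked_facets (rcons L F) /\ share_ridge P F F'.
Proof.
move=> h; split=> [i iL|].
  have := h i; rewrite size_rcons ltnS (ltnW iL) !(nth_rcons _ (rcons L F)).
  by rewrite iL (ltnW iL) => /(_ isT).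
have := h (size L); rewrite !size_rcons ltnSn => /(_ isT).
rewrite nth_rcons size_rcons ltnSn nth_rcons ltnn eqxx.
by rewrite nth_rcons size_rcons ltnn eqxx.
Qed.

Lemma folding_seq_rcons L F F' y : folding_seq P (rcons (rcons L F) F') y =
  folding P F F' (folding_seq P (rcons L F) y).
Proof.
elim: L y => [//|G L ih] y; rewrite !rcons_cons /=.
by case: L ih => [//|H L] ih /=; rewrite -ih.
Qed.

Lemma folding_seq_image L : (0 < size L)%N -> linked_facets L ->
  folding_seq P L @` affine_hull (head set0 L) = affine_hull (last set0 L).
Proof.
elim/last_ind: L => // L F' ih _.
case/lastP: L ih => [_ _|L F ih] /=; first by rewrite image_id.
move=> /linked_rcons[lL sr]; rewrite last_rcons.
have [fF fF' ne _] := sr.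
have := ih _ lL; rewrite size_rcons last_rcons => /(_ isT) im.
have -> : head set0 (rcons (rcons L F) F') = head set0 (rcons L F) by case: (L).
have [hphi _ _ _] := fold_is_folding HP sr.
rewrite -hphi -im; apply/seteqP; split=> [_ [y hy <-]|_ [_ [y hy <-] <-]].
  exists (folding_seq P (rcons L F) y); first by exists y.
  rewrite folding_seq_rcons foldingE//.
  have : affine_hull F (folding_seq P (rcons L F) y) by rewrite -im; exists y.
  by rewrite (facet_hull HP fF).
exists y => //; rewrite folding_seq_rcons foldingE//.
have : affine_hull F (folding_seq P (rcons L F) y) by rewrite -im; exists y.
by rewrite (facet_hull HP fF).
Qed.

(** Appending a facet folds the unrolled path once more and adds the part of the
    path in the new facet. *)
Lemma unfolding_last_rcons g L F F' : linked_facets (rcons (rcons L F) F') ->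
  unfolding_last P g (rcons (rcons L F) F') =
  fold F F' @` unfolding_last P g (rcons L F) `|` (trace g `&` F').
Proof.
move=> lN; have [lM sr] := linked_rcons lN; have [fF fF' _ _] := sr.
have imM := folding_seq_image _ lM.
have imN := folding_seq_image _ lN.
rewrite !size_rcons !last_rcons in imM imN.
have {imM} imM := imM isT; have {imN} imN := imN isT.
set M := rcons L F in lN lM imM imN *; set N := rcons M F'.
have hd : head set0 N = head set0 M by rewrite /N /M; case: (L).
have fN y : affine_hull (head set0 M) y ->
    folding_seq P N y = fold F F' (folding_seq P M y).
  move=> hy; rewrite folding_seq_rcons foldingE//.
  have : affine_hull F (folding_seq P M y) by rewrite -imM; exists y.
  by rewrite (facet_hull HP fF).
have tk i : (i < size M)%N -> take i.+1 N = take i.+1 M /\ nth set0 N i = nth set0 M i.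
  by move=> iM; rewrite /N -cats1 takel_cat// nth_cat iM.
have lastN : take (size M).+1 N = N /\ nth set0 N (size M) = F'.
  by rewrite /N -(size_rcons M F') take_size nth_rcons ltnn eqxx.
apply/seteqP; split.
  move=> _ [y [hy [i iN tr]] <-]; rewrite hd in hy.
  move: iN; rewrite size_rcons ltnS leq_eqVlt => /predU1P[iE|iM].
    by right; move: tr; rewrite iE; case: lastN => -> ->.
  left; exists (folding_seq P M y); last by rewrite fN.
  exists y => //; split=> //; exists i => //.
  by have [<- <-] := tk i iM.
move=> z [[_ [y [hy [i iM tr]] <-] <-]|[gz F'z]].
  exists y; last by rewrite fN.
  split; first by rewrite hd.
  exists i; first by rewrite size_rcons ltnS ltnW.
  by have [-> ->] := tk i iM.
have : affine_hull F' z by exact: affine_hull_sub.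
rewrite -imN => -[y hy yz]; exists y => //; split=> //.
exists (size M); first by rewrite (size_rcons M).
by case: lastN => -> ->; rewrite yz.
Qed.

Section OnePath.
Context {v x : E} {g : R -> E} (sg : shortest_path (surface P) g v x).
Context {L : seq (set E)} {t : nat -> R}.
Context (t0 : t 0%N = 0) (t1 : t (size L) = 1).
Context (tL : forall i, (i < size L)%N ->
  [/\ facet P (nth set0 L i), t i < t i.+1,
      g @` `[t i, t i.+1]%classic `<=` nth set0 L i
    & g @` `[t i, t i.+1]%classic `&` relint (nth set0 L i) !=set0]).
Context (lk : linked_facets L).
Context (vF : exists2 F, facet P F & relint F v).

Local Notation F_ i := (nth set0 L i).
Local Notation p_ i := (g (t i)).

Lemma seq_nonempty : (0 < size L)%N.
Proof.
rewrite lt0n; apply/eqP => s0; move: t1; rewrite s0 t0 => /eqP.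
by rewrite eq_sym oner_eq0.
Qed.

Lemma times_le i j : (i <= j)%N -> (j <= size L)%N -> t i <= t j.
Proof.
elim: j => [|j ih]; first by rewrite leqn0 => /eqP ->.
rewrite leq_eqVlt => /predU1P[->//|ij] jL.
apply: le_trans (ih ij (ltnW jL)) _.
by apply/ltW; case: (tL jL).
Qed.

Lemma times_ge0 i : (i <= size L)%N -> 0 <= t i.
Proof. by rewrite -t0; exact: times_le. Qed.

Lemma times_le1 i : (i <= size L)%N -> t i <= 1.
Proof. by move=> iL; rewrite -t1; exact: times_le. Qed.

Lemma seq_facet i : (i < size L)%N -> facet P (F_ i).
Proof. by move=> /tL[]. Qed.

Lemma seq_in i (u : R) : (i < size L)%N -> t i <= u -> u <= t i.+1 -> F_ i (g u).
Proof.
by move=> /tL[_ _ h _] h1 h2; apply: h; exists u => //=; rewrite in_itv/= h1.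
Qed.

Lemma seq_in_l i : (i < size L)%N -> F_ i (p_ i).
Proof. by move=> iL; apply: seq_in => //; exact: times_le. Qed.

Lemma seq_in_r i : (i < size L)%N -> F_ i (p_ i.+1).
Proof. by move=> iL; apply: seq_in => //; exact: times_le. Qed.

Lemma facet_outside F y z : facet P F -> F y -> F z -> segment y z `<=` ~` interior P.
Proof.
move=> fF Fy Fz; apply: (hyperplane_outside HP fF); exact: (facet_gap HP fF).
Qed.

Lemma seq_relint i : (i < size L)%N ->
  exists u, [/\ t i <= u, u <= t i.+1 & relint (F_ i) (g u)].
Proof.
move=> /tL[_ _ _ [_ [[u /= + <-] h]]]; rewrite in_itv/= => /andP[h1 h2].
by exists u.
Qed.

Lemma in_facet_segment F (a b u : R) : facet P F -> 0 <= a -> a <= u -> u <= b ->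
  b <= 1 -> F (g a) -> F (g b) -> segment (g a) (g b) (g u).
Proof.
move=> fF a0 au ub b1 Fa Fb; apply: (shortest_segment HP sg) => //.
exact: facet_outside fF Fa Fb.
Qed.

Lemma distinct_gap F F' y : facet P F -> facet P F' -> F <> F' -> relint F y -> 0 < gap F' y.
Proof.
move=> fF fF' ne yF; have Py := facet_sub HP fF (relint_sub yF).
rewrite lt0r (gap_ge0 HP fF' Py) andbT; apply/eqP => y0; apply: ne.
by apply: (relint_facet_eq HP fF fF' yF); apply/(facetE HP fF').
Qed.

Lemma seq_next_gap i : (i.+1 < size L)%N -> 0 < gap (F_ i) (p_ i.+2).
Proof.
move=> iL; have [fF fF' ne _] := lk iL.
have [u [h1 h2 hu]] := seq_relint iL.
have gu := distinct_gap fF' fF (nesym ne) hu.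
have ge := gap_ge0 HP fF (facet_sub HP fF' (seq_in_r iL)).
rewrite lt0r ge andbT; apply/eqP => e0.
have p0 := facet_gap HP fF (seq_in_r (ltnW iL)).
have seg := in_facet_segment fF' (times_ge0 (ltnW iL)) h1 h2 (times_le1 iL)
  (seq_in_l iL) (seq_in_r iL).
by move: gu; rewrite (gap_segment0 p0 e0 seg) ltxx.
Qed.

Lemma seq_prev_gap i : (i.+1 < size L)%N -> 0 < gap (F_ i.+1) (p_ i).
Proof.
move=> iL; have [fF fF' ne _] := lk iL; have iL' := ltnW iL.
have [u [h1 h2 hu]] := seq_relint iL'.
have gu := distinct_gap fF fF' ne hu.
have ge := gap_ge0 HP fF' (facet_sub HP fF (seq_in_l iL')).
rewrite lt0r ge andbT; apply/eqP => e0.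
have p0 := facet_gap HP fF' (seq_in_l iL).
have seg := in_facet_segment fF (times_ge0 (ltnW iL')) h1 h2 (times_le1 iL')
  (seq_in_l iL') (seq_in_r iL').
by move: gu; rewrite (gap_segment0 e0 p0 seg) ltxx.
Qed.

Lemma seq_reach i : (i <= size L)%N -> reach v (p_ i).
Proof.
by move=> iL; apply: (shortest_reach HP sg); [exact: times_ge0|exact: times_le1].
Qed.

Lemma seq_dist i : (i < size L)%N ->
  dist v (p_ i.+1) = dist v (p_ i) + enorm (p_ i - p_ i.+1).
Proof.
move=> iL; rewrite (enormB (p_ i)).
apply: (shortest_chord_eq HP sg); [exact: times_ge0 (ltnW iL)|exact: times_le|exact: times_le1|].
exact: facet_outside (seq_facet iL) (seq_in_l iL) (seq_in_r iL).
Qed.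

Lemma seq_ridge_nbhd i : (i.+1 < size L)%N ->
  ridge_nbhd (P := P) (F_ i) (F_ i.+1) (p_ i.+1).
Proof.
move=> iL; have [fF fF' ne _] := lk iL; have iL' := ltnW iL.
apply: (corner_on_ridge HP (v := v) fF fF' ne (seq_in_l iL') (seq_prev_gap iL)
  (seq_in_r iL') (seq_in_l iL) (seq_in_r iL) (seq_next_gap iL)).
- exact: seq_reach (ltnW iL').
- by rewrite (seq_dist iL) (seq_dist iL').
Qed.

Definition unrolled i := folding_seq P (take i.+1 L) v.

Lemma first_facet_relint : relint (F_ 0) v.
Proof.
have [F fF vF'] := vF; have fF0 := seq_facet seq_nonempty.
have F0v : F_ 0 v.
  by have := seq_in_l seq_nonempty; rewrite t0; have [[_ _ -> _] _ _] := sg.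
by rewrite -(relint_facet_eq HP fF fF0 vF' F0v).
Qed.

Lemma unrolled0 : unrolled 0 = v.
Proof. by rewrite /unrolled; case: (L) seq_nonempty => // G [|H M] _ /=. Qed.

Lemma take_rcons2 i : (i.+1 < size L)%N ->
  take i.+2 L = rcons (rcons (take i L) (F_ i)) (F_ i.+1) /\
  take i.+1 L = rcons (take i L) (F_ i).
Proof.
by move=> iL; rewrite (take_nth set0 iL) (take_nth set0 (ltnW iL)).
Qed.

(** The source unrolled along the first facets: the path so far unrolls to the
    segment from there. *)
Lemma unrolled_spec i : (i < size L)%N -> [/\ gap (F_ i) (unrolled i) = 0,
  segment (unrolled i) (p_ i.+1) (p_ i),
  enorm (unrolled i - p_ i.+1) = dist v (p_ i.+1) &
  ((i.+1 < size L)%N -> unrolled i.+1 = fold (F_ i) (F_ i.+1) (unrolled i))].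
Proof.
have step j : (j.+1 < size L)%N -> gap (F_ j) (unrolled j) = 0 ->
    unrolled j.+1 = fold (F_ j) (F_ j.+1) (unrolled j).
  move=> jL o0; rewrite /unrolled; have [-> e] := take_rcons2 jL.
  by rewrite folding_seq_rcons -e -/(unrolled j) foldingE//; exact: lk.
elim: i => [|i ih] iL.
  have vp : p_ 0 = v by rewrite t0; have [[_ _ -> _] _ _] := sg.
  have g0 : gap (F_ 0) v = 0.
    exact/(facet_gap HP (seq_facet iL))/relint_sub/first_facet_relint.
  rewrite unrolled0 vp; split=> //; first exact: segment_l.
    rewrite (seq_dist iL) vp; have [_ ->] := reach_origin HP (shortest_origin sg).
    by rewrite add0r.
  by move=> iL'; rewrite (step _ iL') unrolled0.
have iL' := ltnW iL; have [ o0 st de _] := ih iL'.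
have [fF fF' ne _] := lk iL; have c0 := share_ridge_not_opposite HP (lk iL).
have q0 := facet_gap HP fF (seq_in_r iL'); have q0' := facet_gap HP fF' (seq_in_l iL).
have x0 := facet_gap HP fF (seq_in_l iL').
have oE := step i iL o0.
have oE0 : gap (F_ i.+1) (unrolled i.+1) = 0 by rewrite oE; exact: gap_fold_target.
have st1 : segment (fold (F_ i) (F_ i.+1) (p_ i)) (p_ i.+2) (p_ i.+1).
  apply: (corner_straight HP fF fF' c0 x0 (ltW (seq_prev_gap iL)) q0 q0'
    (facet_gap HP fF' (seq_in_r iL)) (ltW (seq_next_gap iL)) (seq_reach (ltnW iL'))).
  by rewrite (seq_dist iL) (seq_dist iL').
have st2 : segment (fold (F_ i) (F_ i.+1) (unrolled i)) (p_ i.+1)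
    (fold (F_ i) (F_ i.+1) (p_ i)).
  by rewrite -[X in segment _ X _](fold_fix (F_ i) q0'); exact: fold_segment.
have ne1 : fold (F_ i) (F_ i.+1) (p_ i) != p_ i.+1.
  apply/eqP => e; have := gap_fold_source HP fF c0 x0.
  by rewrite e q0; have := seq_prev_gap iL; lra.
have st3 := segment_extend st2 ne1 st1.
split=> //; first by rewrite oE.
- rewrite oE -(segment_dist st3) (seq_dist iL) -de.
  by rewrite -[X in enorm (_ - X) + _](fold_fix (F_ i) q0') fold_dist.
- by move=> iL2; exact: step.
Qed.

(** A path that comes back to the facet has followed a chord of it, but in between
    it visited the relative interior of another facet. *)
Lemma trace_in_facet i (u : R) : (i < size L)%N -> 0 <= u -> u <= 1 -> F_ i (g u) ->
  segment (p_ i) (p_ i.+1) (g u).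
Proof.
move=> iL u0 u1 Fu; have fF := seq_facet iL.
have [ut|tu] := leP u (t i.+1); last first.
  have pE : g u = p_ i.+1; last by rewrite pE; exact: segment_r.
  have iL1 : (i.+1 < size L)%N.
    rewrite ltn_neqAle iL andbT; apply/eqP => e.
    by move: tu; rewrite e t1 ltNge u1.
  have [w [w1 w2 hw]] := seq_relint iL1.
  have fF' := seq_facet iL1; have [_ _ ne _] := lk iL1.
  have gw := distinct_gap fF' fF (nesym ne) hw.
  have [wu|uw] := leP w u.
    have := in_facet_segment fF (times_ge0 (ltnW iL1)) w1 wu u1 (seq_in_r iL) Fu.
    by move=> /(gap_segment0 (facet_gap HP fF (seq_in_r iL)) (facet_gap HP fF Fu)) h; move: gw; rewrite h ltxx.
  have st := in_facet_segment fF' (times_ge0 (ltnW iL1)) (ltW tu) (ltW uw)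
    (le_trans w2 (times_le1 iL1)) (seq_in_l iL1) (seq_in iL1 w1 w2).
  have p0 : 0 <= gap (F_ i) (p_ i.+1) by rewrite (facet_gap HP fF (seq_in_r iL)).
  exact: gap_segment_strict st p0 gw (facet_gap HP fF Fu).
have [tu|ut'] := leP (t i) u.
  exact: (in_facet_segment fF (times_ge0 (ltnW iL)) tu ut (times_le1 iL) (seq_in_l iL) (seq_in_r iL)).
have pE : g u = p_ i; last by rewrite pE; exact: segment_l.
case: i iL Fu fF ut ut' => [|i] iL Fu fF ut ut'; first by move: ut'; rewrite t0 ltNge u0.
have iL1 := ltnW iL.
have [w [w1 w2 hw]] := seq_relint iL1.
have fF' := seq_facet iL1; have [_ _ ne _] := lk iL.
have gw := distinct_gap fF' fF ne hw.
have [uw|wu] := leP u w.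
  have := in_facet_segment fF u0 uw w2 (times_le1 iL1) Fu (seq_in_l iL).
  by move=> /(gap_segment0 (facet_gap HP fF Fu) (facet_gap HP fF (seq_in_l iL))) h; move: gw; rewrite h ltxx.
have st := in_facet_segment fF' (le_trans (times_ge0 (ltnW iL1)) w1) (ltW wu) (ltW ut')
    (times_le1 iL1) (seq_in iL1 w1 w2) (seq_in_r iL1).
have p0 : 0 <= gap (F_ i.+1) (p_ i.+1) by rewrite (facet_gap HP fF (seq_in_l iL)).
by rewrite segment_sym in st; exact: gap_segment_strict st p0 gw (facet_gap HP fF Fu).
Qed.

Lemma trace_facetE i : (i < size L)%N ->
  trace g `&` F_ i = segment (p_ i) (p_ i.+1).
Proof.
move=> iL; apply/seteqP; split=> [_ [[u /= + <-] Fu]|z pz].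
  by rewrite in_itv/= => /andP[u0 u1]; exact: trace_in_facet.
have fF := seq_facet iL.
have [|u [h1 h2 <-]] := shortest_covers HP sg (times_ge0 (ltnW iL)) (times_le (leqnSn i) iL)
    (times_le1 iL) _ pz.
  exact: facet_outside fF (seq_in_l iL) (seq_in_r iL).
split; last exact: seq_in.
exists u => //=; rewrite in_itv/= (le_trans (times_ge0 (ltnW iL)) h1).
by rewrite (le_trans h2 (times_le1 iL)).
Qed.

Lemma unfolding_last_take i : (i < size L)%N ->
  unfolding_last P g (take i.+1 L) = segment (unrolled i) (p_ i.+1).
Proof.
elim: i => [|i ih] iL.
  have vp : p_ 0 = v by rewrite t0; have [[_ _ -> _] _ _] := sg.
  rewrite unrolled0 -{1}vp -(trace_facetE iL).
  have -> : take 1 L = [:: F_ 0] by case: (L) iL => //= G M _; rewrite take0.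
  rewrite /unfolding_last /= image_id; apply/seteqP; split=> y.
    by move=> [_ [[|//] _]].
  move=> [gy Fy]; split; first exact: affine_hull_sub.
  by exists 0%N.
have iL' := ltnW iL; have [ o0 st _ oE] := unrolled_spec iL'.
have [e2 e1] := take_rcons2 iL.
have lN : linked_facets (rcons (rcons (take i L) (F_ i)) (F_ i.+1)).
  rewrite -e2 => j; rewrite (size_takel iL) => jL.
  rewrite !nth_take//; last exact: ltnW.
  by apply: lk; exact: leq_trans jL iL.
rewrite e2 unfolding_last_rcons// -e1 (ih iL') fold_image_segment (trace_facetE iL).
rewrite -(oE iL) (fold_fix (F_ i) (facet_gap HP (seq_facet iL) (seq_in_l iL))).
have [_ st' _ _] := unrolled_spec iL.
by rewrite -segment_cat.
Qed.

Lemma chain_take i : (i < size L)%N ->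
  chain (P := P) v (F_ i) (unrolled i) (p_ i.+1) (g @` `[0, t i.+1]%classic).
Proof.
have img j : (j < size L)%N -> g @` `[t j, t j.+1]%classic = segment (p_ j) (p_ j.+1).
  move=> iL; have fF := seq_facet iL; apply/seteqP; split=> [_ [u /= + <-]|z pz].
    rewrite in_itv/= => /andP[h1 h2]; apply: trace_in_facet => //.
    - exact: le_trans (times_ge0 (ltnW iL)) h1.
    - exact: le_trans h2 (times_le1 iL).
    - exact: seq_in.
  have [|u [h1 h2 <-]] := shortest_covers HP sg (times_ge0 (ltnW iL)) (times_le (leqnSn j) iL)
    (times_le1 iL) _ pz.
    exact: facet_outside fF (seq_in_l iL) (seq_in_r iL).
  by exists u => //=; rewrite in_itv/= h1.
elim: i => [|i ih] iL.
  have vp : p_ 0 = v by rewrite t0; have [[_ _ -> _] _ _] := sg.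
  have := img 0%N iL; rewrite t0 => ->; rewrite -t0 vp unrolled0.
  apply: chain_start; [exact: seq_facet|exact: first_facet_relint|exact: seq_in_r].
have iL' := ltnW iL; have [ o0 st _ oE] := unrolled_spec iL'.
have -> : g @` `[0, t i.+2]%classic = g @` `[0, t i.+1]%classic `|` segment (p_ i.+1) (p_ i.+2).
  rewrite -(img _ iL) -image_setU; congr (g @` _); apply/seteqP; split=> u /=.
    rewrite !in_itv/= => /andP[u0 u2]; have [ut|ut] := leP u (t i.+1).
      by left; rewrite u0.
    by right; rewrite (ltW ut).
  have := times_ge0 iL'; have := times_le (leqnSn i.+1) iL.
  by rewrite !in_itv/= => h1 h2 [] /andP[h3 h4]; apply/andP; split; lra.
have [_ st' _ _] := unrolled_spec iL; rewrite (oE iL) in st' *.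
apply: (chain_step (ih iL')) => //.
- exact: lk.
- exact: seq_in_l.
- exact: seq_in_r.
- exact: seq_next_gap.
- exact: seq_ridge_nbhd.
Qed.

(** The chord argument of [trace_in_facet] excludes a second visit to a facet. *)
Lemma seq_uniq : uniq L.
Proof.
apply/(uniqP set0) => i j; rewrite !inE.
wlog ij : i j / (i < j)%N => [h iL jL e|iL jL e].
  by have [ij|ij|//] := ltngtP i j; [exact: h|apply/esym/h].
exfalso; have i1L : (i.+1 < size L)%N := leq_ltn_trans ij jL.
have fF := seq_facet iL; have fF' := seq_facet i1L; have [_ _ ne _] := lk i1L.
have i1j : (i.+2 <= j)%N.
  by rewrite ltn_neqAle ij andbT; apply/eqP => ij'; apply: ne; rewrite ij'.
have [w [w1 w2 hw]] := seq_relint i1L.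
have wj : w <= t j by apply: le_trans w2 (times_le i1j (ltnW jL)).
have Fj : F_ i (p_ j) by rewrite e; exact: seq_in_l.
have iw : t i <= w := le_trans (times_le (leqnSn i) iL) w1.
have := in_facet_segment fF (times_ge0 (ltnW iL)) iw wj (times_le1 (ltnW jL)) (seq_in_l iL) Fj.
move=> /(gap_segment0 (facet_gap HP fF (seq_in_l iL)) (facet_gap HP fF Fj)).
by have := distinct_gap fF' fF (nesym ne) hw; lra.
Qed.

End OnePath.
End Unfolding.

(** * Source images *)

Section SourceImages.
Context {R : realType} {d : nat}.
Local Notation E := 'rV[R]_d.+1.
Implicit Types (x y z p q w o : E) (F G A B : set E) (g h : R -> E) (L : seq (set E)).
Context {P : set E} (HP : convex_polyhedron P).

Local Notation gap := (gap P).
Local Notation fold := (@fold _ _ P).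
Local Notation dist := (dist P).
Local Notation reach := (reach P).

Context {v : E} (vF : exists2 F, facet P F & relint F v).

Lemma facet_sequence_spec x g L : shortest_path (surface P) g v x ->
  facet_sequence P g L -> [/\ chain (P := P) v (last set0 L) (folding_seq P L v) x (trace g),
    enorm (folding_seq P L v - x) = dist v x,
    unfolding_last P g L = segment (folding_seq P L v) x,
    uniq L & linked_facets (P := P) L].
Proof.
move=> sg [t [t0 t1 tL lk]]; have [[_ _ _ gx] _ _] := sg.
have s0 := seq_nonempty t0 t1; have iL : ((size L).-1 < size L)%N by rewrite prednK.
have tk : take (size L).-1.+1 L = L by rewrite prednK// take_size.
have := chain_take HP sg t0 t1 tL lk vF iL.
have := unfolding_last_take HP sg t0 t1 tL lk vF iL.
have [_ _ + _] := unrolled_spec HP sg t0 t1 tL lk vF iL.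
rewrite /unrolled tk nth_last !prednK// t1 gx => h1 h2 h3; split=> //.
exact: (seq_uniq HP sg t0 t1 tL lk).
Qed.

Lemma chain_beyond F1 o x A F : chain (P := P) v F1 o x A -> facet P F -> F1 <> F ->
  F x -> 0 < gap F o.
Proof.
move=> ch fF ne Fx; have [f1 _ _] := chain_facet HP ch.
have [m /segmentP[t [t0 t1 mE]] m1] := chain_relint HP ch.
have := distinct_gap HP f1 fF ne m1.
by rewrite mE gap_line (facet_gap HP fF Fx) mulr0 addr0; nra.
Qed.

(** The path meets the appended facet only at its endpoint. *)
Lemma facet_sequence_append x g L F : shortest_path (surface P) g v x ->
  facet_sequence P g L -> share_ridge P (last set0 L) F -> F x ->
  [/\ folding_seq P (rcons L F) v = fold (last set0 L) F (folding_seq P L v),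
    enorm (folding_seq P (rcons L F) v - x) = dist v x &
    unfolding_last P g (rcons L F) = segment (folding_seq P (rcons L F) v) x].
Proof.
move=> sg fs sr Fx; have [ch dE uE _ lk'] := facet_sequence_spec sg fs.
have [f1 fF ne _] := sr; have [_ F1x o0] := chain_facet HP ch.
have [t [t0 t1 tL lk]] := fs; have [[_ _ _ gx] _ _] := sg.
have s0 := seq_nonempty t0 t1; have iL : ((size L).-1 < size L)%N by rewrite prednK.
have LE : exists L0, L = rcons L0 (last set0 L).
  by case/lastP: (L) s0 => // L0 H _; rewrite last_rcons; exists L0.
case: LE => L0 LE.
have oE : folding_seq P (rcons L F) v = fold (last set0 L) F (folding_seq P L v).
  by rewrite {1}LE folding_seq_rcons -LE foldingE.
have x0 := facet_gap HP fF Fx.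
have lN : linked_facets (P := P) (rcons (rcons L0 (last set0 L)) F).
  rewrite -LE => i; rewrite size_rcons ltnS leq_eqVlt => /predU1P[iE|iL1].
    rewrite !nth_rcons -iE ltnSn eqxx ltnn; move: (iE) => /(congr1 predn) /= ->.
    by rewrite nth_last.
  by rewrite !nth_rcons iL1 (ltnW iL1); exact: lk'.
split=> //.
  rewrite oE -[X in _ - X](fold_fix (last set0 L) x0) fold_dist//.
  - exact: (share_ridge_not_opposite HP sr).
  - exact: (facet_gap HP f1).
rewrite {1}LE unfolding_last_rcons// -LE uE fold_image_segment -oE (fold_fix _ x0).
apply/seteqP; split=> [z [//|[[u /= + <-] Fu]]|z]; last by left.
rewrite in_itv/= => /andP[u0 u1].
suff -> : g u = x by exact: segment_r.
have [w [w1 w2 hw]] := seq_relint tL iL.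
rewrite prednK// t1 in w2; rewrite nth_last in hw.
have wge : 0 <= w by apply: le_trans w1; exact: (times_ge0 t0 tL (ltnW iL)).
have gw := distinct_gap HP f1 fF ne hw.
have Fx1 : F (g 1) by rewrite gx.
have F1x1 : last set0 L (g 1) by rewrite gx.
have [uw|wu] := leP u w.
  have := in_facet_segment HP sg fF u0 uw w2 (lexx 1) Fu Fx1.
  by move=> /(gap_segment0 (facet_gap HP fF Fu) (facet_gap HP fF Fx1)) h; move: gw; rewrite h ltxx.
have st := in_facet_segment HP sg f1 wge (ltW wu) u1 (lexx 1) (relint_sub hw) F1x1.
rewrite segment_sym gx in st.
by apply: (gap_segment_strict st) (facet_gap HP fF Fu); rewrite ?x0.
Qed.

(** [o] is an image of the source for [F], seen from [x] along the polygon [A];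
    in the second case [F] is appended to the facets that the polygon runs in. *)
Definition visible F o x A := chain (P := P) v F o x A \/ exists F1 o1,
  [/\ chain (P := P) v F1 o1 x A, share_ridge P F1 F, F x & o = fold F1 F o1].

Lemma facet_sequence_visible x g F L : facet P F ->
  shortest_path (surface P) g v x -> facet_sequence_to P g F x L ->
  [/\ visible F (folding_seq P L v) x (trace g),
    enorm (folding_seq P L v - x) = dist v x &
    unfolding_last P g L = segment (folding_seq P L v) x].
Proof.
move=> fF sg [[fs <-]|[L' [fs ne -> [G [rG Gx GF GL]]]]].
  by have [ch h1 h2 _ _] := facet_sequence_spec sg fs; split=> //; left.
have [ch _ _ _ _] := facet_sequence_spec sg fs; have [f1 F1x _] := chain_facet HP ch.
have sr : share_ridge P (last set0 L') F by split=> //; exists G.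
have [h1 h2 h3] := facet_sequence_append sg fs sr (GF _ Gx); split=> //.
right; exists (last set0 L'), (folding_seq P L' v); split=> //; exact: GF.
Qed.

Lemma visible_facet F o x A : visible F o x A -> [/\ facet P F, F x & gap F o = 0].
Proof.
case=> [/(chain_facet HP)//|[F1 [ o1 [ch sr Fx ->]]]].
have c0 := share_ridge_not_opposite HP sr; case: sr => f1 fF _ _; split=> //.
exact: gap_fold_target.
Qed.

Lemma visible_appended_gap F F1 o1 x A : chain (P := P) v F1 o1 x A ->
  share_ridge P F1 F -> F x -> gap F1 (fold F1 F o1) < 0.
Proof.
move=> ch sr Fx; have c0 := share_ridge_not_opposite HP sr.
case: sr => f1 fF ne _; have [_ _ o0] := chain_facet HP ch.
by rewrite (gap_fold_source HP f1 c0 o0) oppr_lt0; exact: chain_beyond ch fF ne Fx.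
Qed.

(** As [chain_support], with the segments folded once more when [F] was only
    appended. *)
Lemma visible_support F o x A : visible F o x A -> exists2 r : R, 0 < r &
  forall y, F y -> enorm (y - x) < r -> reach v y /\ dist v y <= enorm (o - y).
Proof.
move=> vis; have [fF Fx _] := visible_facet vis.
case: vis => [ch|[F1 [ o1 [ch sr _ oE]]]].
  have [r r0 hr] := chain_support HP ch; exists r => // y Fy; apply: hr.
  exact: (facet_gap HP fF).
have gneg := visible_appended_gap ch sr Fx; rewrite -oE in gneg.
have c0 := share_ridge_not_opposite HP sr; case: (sr) => f1 _ ne _.
have [_ F1x o10] := chain_facet HP ch; have x0 := facet_gap HP f1 F1x.
have [r r0 hr] := chain_support HP ch.
have [|e e0 he] := crossing_near HP f1 (segment_r o x) x0 (ltW gneg) _ r0.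
  by rewrite x0.
exists e => // y Fy ye.
have [z [ oyz z0 zr]] := he y ye (gap_ge0 HP f1 (facet_sub HP fF Fy)).
have fo0 : gap F o = 0 by rewrite oE; exact: gap_fold_target.
have y0 := facet_gap HP fF Fy; have z0' := gap_segment0 fo0 y0 oyz.
have [rz dz] := hr z z0 zr.
have out := hyperplane_outside HP fF z0' y0.
split; first exact: reach_segment rz out.
rewrite -(segment_dist oyz).
have -> : enorm (o - z) = enorm (o1 - z).
  by rewrite oE -[in LHS](fold_fix F1 z0') fold_dist.
have := dist_along_segment rz out; lra.
Qed.

(** An open facet, or an open ridge seen from one of its two facets. *)
Definition open_cell F w := relint F w \/ exists F',
  [/\ facet P F', F' <> F, F w, F' w & ridge_nbhd (P := P) F F' w].

Lemma open_cell_in F w : open_cell F w -> F w.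
Proof. by case=> [/relint_sub//|[F' []]]. Qed.

Lemma visible_unique F o x A B : facet P F -> open_cell F x ->
  visible F o x A -> visible F o x B -> A = B.
Proof.
move=> fF oc; have Fx := open_cell_in oc.
have mixed A' B' : chain (P := P) v F o x A' ->
    (exists F1 o1, [/\ chain (P := P) v F1 o1 x B', share_ridge P F1 F, F x & o = fold F1 F o1]) -> False.
  move=> ch [F1 [ o1 [ch1 sr _ oE]]]; have := visible_appended_gap ch1 sr Fx.
  rewrite -oE; case: (sr) => f1 _ ne _; have [_ F1x _] := chain_facet HP ch1.
  by have := chain_beyond ch f1 (nesym ne) F1x; lra.
move=> [ch|v1] [ch'|v2].
- exact: (chain_unique HP ch ch').
- by case: (mixed _ _ ch v2).
- by case: (mixed _ _ ch' v1).
case: v1 => F1 [ o1 [ch1 sr1 _ oE1]]; case: v2 => F2 [ o2 [ch2 sr2 _ oE2]].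
have [f1 F1x o10] := chain_facet HP ch1; have [f2 F2x o20] := chain_facet HP ch2.
case: (sr1) (sr2) => _ _ ne1 _ [_ _ ne2 _].
case: oc => [xF|[F' [fF' ne' _ F'x rn]]].
  by case: ne1; apply/esym; exact: (relint_facet_eq HP fF f1 xF F1x).
have two H : facet P H -> H x -> H <> F -> H = F'.
  move=> fH Hx neH.
  by case: (ridge_two_facets HP fF fF' (nesym ne') Fx F'x rn fH Hx).
have e1 := two _ f1 F1x ne1; have e2 := two _ f2 F2x ne2.
rewrite e1 in ch1 oE1 sr1 o10; rewrite e2 in ch2 oE2 o20.
have c0 := share_ridge_not_opposite HP sr1.
have ow : o1 = o2 by rewrite -(foldK HP fF' fF c0 o10) -oE1 oE2 (foldK HP fF' fF c0 o20).
by rewrite -ow in ch2; exact: (chain_unique HP ch1 ch2).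
Qed.

Lemma segment_end_inj a b x : segment a x = segment b x -> a = b.
Proof.
move=> e; have h1 : segment a x b by rewrite e; exact: segment_l.
have h2 : segment b x a by rewrite -e; exact: segment_l.
have := segment_dist h1; have := segment_dist h2; rewrite (enormB b a) => u w.
have /enorm_eq0/eqP : enorm (a - b) = 0 by lra.
by rewrite subr_eq0 => /eqP.
Qed.

Lemma source_image_spec F o : facet P F -> source_images P v F o -> exists x A,
  [/\ F x, visible F o x A, enorm (o - x) = dist v x & reach v x].
Proof.
move=> fF [_ [x [g [L [[Fx _] sg fs uE]]]]].
have [vis dE uE'] := facet_sequence_visible fF sg fs.
have -> : o = folding_seq P L v by apply: (@segment_end_inj _ _ x); rewrite -uE.
exists x, (trace g); split=> //.
by have [[_ _ _ <-] _ _] := sg; exact: (shortest_reach HP sg ler01 (lexx _)).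
Qed.

(** A shortest path leaving the facet [F] for good at time [b] continues through
    a facet sharing a ridge with [F]. *)
Lemma facet_sequence_from (n : nat) (J : seq (set E)) x g F (s : R) : (size J <= n)%N ->
  shortest_path (surface P) g v x -> facet P F -> 0 <= s -> s < 1 -> F (g s) ->
  (exists u, [/\ s < u, u <= 1 & F (g u)]) ->
  (exists m, [/\ s <= m, m <= 1 & relint F (g m)]) ->
  (forall H, facet P H -> (exists u, [/\ s < u, u <= 1 & H (g u)]) -> H \in J) ->
  exists L (t : nat -> R), [/\ t 0%N = s, t (size L) = 1, head set0 L = F,
    forall i, (i < size L)%N ->
     [/\ facet P (nth set0 L i), t i < t i.+1,
      g @` `[t i, t i.+1]%classic `<=` nth set0 L i
    & g @` `[t i, t i.+1]%classic `&` relint (nth set0 L i) !=set0]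
   & linked_facets (P := P) L].
Proof.
elim: n J F s => [|n ih] J F s sJ sg fF s0 s1 Fs [u [su u1 Fu]] [m [sm m1 Fm]] hJ.
  have : F \in J by apply: hJ => //; exists u.
  by move: sJ; rewrite leqn0 => /nilP ->.
have [[cg gS _ gx] _ _] := sg.
have [b [sb b1 Fb after]] := last_time cg (facet_closed HP fF) s0 (ltW s1) Fs.
have ub : u <= b by rewrite leNgt; apply/negP => bu; exact: after bu u1 Fu.
have mb : m <= b by rewrite leNgt; apply/negP => bm; exact: after bm m1 (relint_sub Fm).
have sb' : s < b by exact: lt_le_trans ub.
have stretch : g @` `[s, b]%classic `<=` F.
  move=> _ [w /= + <-]; rewrite in_itv/= => /andP[sw wb].
  apply: (facet_segment HP fF Fs Fb).
  exact: (in_facet_segment HP sg fF s0 sw wb b1 Fs Fb).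
have meets : g @` `[s, b]%classic `&` relint F !=set0.
  by exists (g m); split=> //; exists m => //=; rewrite in_itv/= sm.
have [b1E|b1E] := eqVneq b 1.
  exists [:: F], (fun i => if i is 0%N then s else b); split=> //.
  by case=> [_|i]; [split|rewrite /= ltnS ltn0].
have {b1E}b1' : b < 1 by rewrite lt_neqAle b1E.
have b0 : 0 <= b by exact: le_trans sb.
have [fs fsP] := facets_finite HP.
have [||||H [HJ Hb [w [bw w1 Hw]]]] := @next_set _ _ g fs b cg.
- by move=> H /fsP; exact: (facet_closed HP).
- by [].
- by [].
- move=> w bw w1; have [|H fH Hw] := facet_cover HP (x := g w).
    by apply: gS; exists w => //=; rewrite in_itv/= w1 andbT; lra.
  by exists H => //; apply/fsP.
have fH : facet P H by apply/fsP.
have ne : F <> H by move=> FH; apply: (after w bw w1); rewrite FH.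
have gHm := distinct_gap HP fF fH ne Fm.
have gFw : 0 < gap F (g w).
  have Pw := facet_sub HP fH Hw.
  rewrite lt0r (gap_ge0 HP fF Pw) andbT; apply/eqP => w0.
  by apply: (after w bw w1); apply/(facetE HP fF).
have m0 : 0 <= m by exact: le_trans sm.
have rn : ridge_nbhd (P := P) F H (g b).
  apply: (corner_on_ridge HP (v := v) fF fH ne (relint_sub Fm) gHm Fb Hb Hw gFw).
    exact: (shortest_reach HP sg m0 m1).
  have h1 := shortest_chord HP sg m0 mb b1.
  have h2 := shortest_chord HP sg b0 (ltW bw) w1.
  rewrite (enormB (g m)) (enormB (g b) (g w)); lra.
have [sr _] := ridge_nbhd_share HP fF fH ne Fb Hb rn.
have [m' bwm Hm'] := enter_relint HP fF fH ne Fb Hb rn Hw gFw.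
have [|u' [bu' uw' um']] := shortest_covers HP sg b0 (ltW bw) w1 _ bwm.
  exact: (facet_outside HP fH Hb Hw).
have FJ : F \in J by apply: hJ => //; exists u.
have [||||L [t [t0 t1 hd tL lk]]] := ih [seq G <- J | G != F] H b _ sg fH b0 b1' Hb.
- rewrite -ltnS; apply: leq_trans sJ; rewrite size_filter -(count_predC (pred1 F) J).
  by rewrite -[X in (X < _)%N]add0n ltn_add2r -has_count has_pred1.
- by exists w.
- by exists u'; rewrite um'; split=> //; exact: le_trans w1.
- move=> G fG [w' [bw' w1' Gw']]; rewrite mem_filter; apply/andP; split.
    by apply/eqP => GF; apply: (after w' bw' w1'); rewrite -GF.
  by apply: hJ => //; exists w'; split=> //; exact: lt_trans bw'.
exists (F :: L), (fun i => if i is j.+1 then t j else s); split=> //.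
- by case=> [_|i iL] /=; [rewrite t0|exact: tL].
- case=> [|i] iL /=; last exact: lk.
  by case: (L) hd iL => //= G L' ->.
Qed.

(** As [v] is in the relative interior of a facet, the path starts with a stretch
    in it; then [facet_sequence_from] applies. *)
Lemma facet_sequence_exists x g : shortest_path (surface P) g v x ->
  exists L, facet_sequence P g L.
Proof.
move=> sg; have [F fF Fv] := vF; have [[cg gS gv gx] _ _] := sg.
have [fs fsP] := facets_finite HP.
have [||||L [t [t0 t1 _ tL lk]]] :=
   @facet_sequence_from (size fs) fs x g F 0 (leqnn _) sg fF (lexx 0) ltr01.
- by rewrite gv; exact: relint_sub.
- apply: contrapT => none.
  have [||||H [HJ Hb [w [bw w1 Hw]]]] := @next_set _ _ g fs 0 cg.
  + by move=> H /fsP; exact: (facet_closed HP).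
  + by [].
  + by [].
  + move=> w bw w1; have [|H fH Hw] := facet_cover HP (x := g w).
      by apply: gS; exists w => //=; rewrite in_itv/= w1 andbT; lra.
    by exists H => //; apply/fsP.
  rewrite gv in Hb; apply: none; exists w; split=> //.
  by rewrite (relint_facet_eq HP fF _ Fv Hb)//; apply/fsP.
- by exists 0; rewrite gv lexx ler01.
- by move=> H fH _; apply/fsP.
by exists L, t.
Qed.

(** If the last facet of the path is not [F], then [w] is on the ridge between the
    two, and [F] is appended to the facet sequence. *)
Lemma source_image_exists F w g : facet P F -> open_cell F w ->
  shortest_path (surface P) g v w -> exists o,
  [/\ source_images P v F o, visible F o w (trace g) & enorm (o - w) = dist v w].
Proof.
move=> fF oc sg; have Fw := open_cell_in oc.
have nlow : ~ low_skeleton P w.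
  case: oc => [wF|[F' [fF' ne' _ F'w rn]]]; first exact: (relint_facet_not_low HP fF).
  exact: (ridge_nbhd_not_low HP fF fF' (nesym ne') Fw F'w rn).
have [L fs] := facet_sequence_exists sg.
have [ch _ _ _ _] := facet_sequence_spec sg fs; have [f1 F1w _] := chain_facet HP ch.
suff [M fsM] : exists M, facet_sequence_to P g F w M.
  have [vis dE uE] := facet_sequence_visible fF sg fsM.
  exists (folding_seq P M v); split=> //; split.
    by rewrite (facet_hull HP fF); have [] := visible_facet vis.
  by exists w, g, M.
have [e|ne] := pselect (last set0 L = F); first by exists L; left.
exists (rcons L F); right; exists L; split=> //.
case: oc => [wF|[F' [fF' ne' _ F'w rn]]].
  by case: ne; apply/esym; exact: (relint_facet_eq HP fF f1 wF F1w).
have [_ [G [rG GF GF' Gw]]] := ridge_nbhd_share HP fF fF' (nesym ne') Fw F'w rn.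
exists G; split=> //.
by case: (ridge_two_facets HP fF fF' (nesym ne') Fw F'w rn f1 F1w) => [//|->].
Qed.

(** Facet sequences of shortest paths do not repeat, so there are finitely many
    of them, hence finitely many source images. *)
Lemma source_images_finite F : facet P F ->
  exists s : seq E, forall o, source_images P v F o -> o \in s.
Proof.
move=> fF; have [fs fsP] := facets_finite HP.
(* All sequences of at most [n] facets. *)
pose words := fix words (n : nat) : seq (seq (set E)) :=
  if n is n'.+1 then [::] :: [seq G :: L | G <- fs, L <- words n'] else [:: [::]].
have wordsP n L : (size L <= n)%N -> {in L, forall G, facet P G} -> L \in words n.
  elim: n L => [|n ih] [|G L] //= sL fL.
  rewrite inE; apply/orP; right; apply: allpairs_f.
    by apply/fsP/fL; rewrite inE eqxx.
  by apply: ih => // H HL; apply: fL; rewrite inE HL orbT.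
exists [seq folding_seq P L v | L <- words (size fs).+1] => o.
move=> [_ [x [g [L [[Fx _] sg fsL uE]]]]].
have [vis _ uE'] := facet_sequence_visible fF sg fsL.
have -> : o = folding_seq P L v by apply: (@segment_end_inj _ _ x); rewrite -uE.
apply: (map_f (fun L => folding_seq P L v)); apply: wordsP.
  have bound M : facet_sequence P g M -> (size M <= size fs)%N.
    move=> fsM; have [_ _ _ uM _] := facet_sequence_spec sg fsM.
    apply: uniq_leq_size => // G /(nthP set0)[i iM <-].
    by case: fsM => t [_ _ tM _]; apply/fsP; case: (tM i iM).
  case: fsL => [[fsL _]|[L' [fsL' _ -> _]]]; first exact/leqW/bound.
  by rewrite size_rcons ltnS bound.
have allf M : facet_sequence P g M -> {in M, forall G, facet P G}.
  by move=> [t [_ _ tM _]] G /(nthP set0)[i iM <-]; case: (tM i iM).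
case: fsL => [[fsL _]|[L' [fsL' _ -> _]]]; first exact: allf.
by move=> G; rewrite mem_rcons inE => /predU1P[->//|]; exact: allf.
Qed.

End SourceImages.

(** * Source images are never too close *)

Section Concavity.
Context {R : realType}.

Lemma lipschitz_within (f : R -> R) (K : R) :
  (forall s t, 0 <= s <= 1 -> 0 <= t <= 1 -> `|f s - f t| <= K * `|s - t|) ->
  {within `[0, 1]%classic, continuous f}.
Proof.
move=> lf; rewrite continuous_subspace_in => t; rewrite inE /= in_itv/= => t01.
move=> B /nbhs_ballP[e /= e0 hB].
rewrite nbhs_simpl /= {1}/nbhs /= /nbhs_subspace; case: ifPn => [_|]; last first.
  by rewrite notin_setE /= in_itv/= t01.
have c0 : 0 < `|K| + 1 by rewrite ltr_wpDl.
apply/nbhs_ballP; exists (e / (`|K| + 1)); first by rewrite /= divr_gt0.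
move=> s; rewrite -ball_normE /ball_ /= ltr_pdivlMr// => ts; rewrite in_itv/= => s01.
apply: hB; rewrite -ball_normE /ball_ /=; apply: le_lt_trans (lf _ _ t01 s01) _.
apply: le_lt_trans ts; rewrite mulrC ler_wpM2l//.
by have := ler_norm K; lra.
Qed.

(** A function supported from above at every point by an affine function that
    touches it there is concave, so it lies below the support at its left end.
    Otherwise subtract its chord and add a small strictly concave term: at the
    interior minimum of the result the support is violated on one side. *)
Lemma below_left_support (f : R -> R) (K k0 : R) :
  (forall s t, 0 <= s <= 1 -> 0 <= t <= 1 -> `|f s - f t| <= K * `|s - t|) ->
  (forall t, 0 < t < 1 -> exists k, exists2 r, 0 < r & forall s, 0 <= s <= 1 ->
    `|s - t| < r -> f s <= f t + k * (s - t)) ->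
  (exists2 r, 0 < r & forall s, 0 <= s <= 1 -> s < r -> f s <= f 0 + k0 * s) ->
  f 1 <= f 0 + k0.
Proof.
move=> lf sup [r0 r00 sup0]; rewrite leNgt; apply/negP => h.
have [c cE] : exists c, c = f 1 - f 0 by eexists.
have [e eE] : exists e, e = (c - k0) / 2 by eexists.
have e0 : 0 < e by rewrite eE divr_gt0// cE; lra.
pose psi t := f t - f 0 - c * t + e * (t * (1 - t)).
have lpsi s t : 0 <= s <= 1 -> 0 <= t <= 1 ->
    `|psi s - psi t| <= (K + `|c| + e) * `|s - t|.
  move=> s01 t01; have := lf s t s01 t01 => l1.
  have -> : psi s - psi t = (f s - f t) - c * (s - t) + e * (1 - s - t) * (s - t).
    by rewrite /psi; ring.
  have -> : (K + `|c| + e) * `|s - t| = K * `|s - t| + `|c| * `|s - t| + e * `|s - t| by ring.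
  apply: le_trans (ler_normD _ _) _; apply: lerD.
    by apply: le_trans (ler_normB _ _) _; rewrite normrM; apply: lerD.
  rewrite !normrM (gtr0_norm e0) -mulrA ler_pM2l//.
  by rewrite ler_piMl// ler_norml; lra.
have [t] := EVT_min ler01 (lipschitz_within lpsi).
rewrite in_itv/= => t01 tmin.
have psi0 : psi 0 = 0 by rewrite /psi; ring.
have psi1 : psi 1 = 0 by rewrite /psi cE; ring.
have neg : psi t < 0.
  pose s := Num.min (1 / 2) (r0 / 2).
  have s0 : 0 < s by rewrite lt_min !divr_gt0.
  have s1 : s <= 1 / 2 by rewrite ge_min lexx.
  have sr : s <= r0 / 2 by rewrite ge_min lexx orbT.
  have s01 : 0 <= s <= 1 by apply/andP; split; lra.
  have := tmin s; rewrite in_itv/= => /(_ s01) le; apply: (le_lt_trans le).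
  have := sup0 s s01; have -> : s < r0 by lra.
  move=> /(_ isT) fs; rewrite /psi.
  have ck : c = k0 + 2 * e by rewrite eE; field.
  have : 0 < e * s by rewrite mulr_gt0.
  have : 0 <= e * (s * s) by rewrite !mulr_ge0// ltW.
  rewrite ck; lra.
have t0 : 0 < t.
  rewrite lt0r; case/andP: t01 => -> _; rewrite andbT; apply/eqP => t0.
  by move: neg; rewrite t0 psi0 ltxx.
have t1 : t < 1.
  rewrite lt_neqAle; case/andP: t01 => _ ->; rewrite andbT; apply/eqP => t1.
  by move: neg; rewrite t1 psi1 ltxx.
have [|k [r rp supt]] := sup t; first by rewrite t0.
pose u := Num.min (r / 2) (Num.min t (1 - t)).
have u0 : 0 < u by rewrite !lt_min divr_gt0//= t0 subr_gt0.
have ur : u <= r / 2 by rewrite ge_min lexx.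
have ut : u <= t by rewrite !ge_min lexx/= orbT.
have ut1 : u <= 1 - t by rewrite !ge_min lexx/= !orbT.
have a1 : 0 <= t + u <= 1 by apply/andP; split; lra.
have a2 : 0 <= t - u <= 1 by apply/andP; split; lra.
have := supt _ a1; rewrite addrAC subrr add0r gtr0_norm//.
have -> : u < r by lra.
move=> /(_ isT) b1.
have := supt _ a2; rewrite addrAC subrr add0r normrN gtr0_norm//.
have -> : u < r by lra.
move=> /(_ isT) b2.
have := tmin (t + u); rewrite in_itv/= => /(_ a1) m1.
have := tmin (t - u); rewrite in_itv/= => /(_ a2) m2.
have : 0 < e * (u * u) by rewrite !mulr_gt0.
move: m1 m2; rewrite /psi; lra.
Qed.

End Concavity.

Section Mount.
Context {R : realType} {d : nat}.
Local Notation E := 'rV[R]_d.+1.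
Implicit Types (x y z p q w o : E) (F G A B : set E) (g h : R -> E) (L : seq (set E)).
Context {P : set E} (HP : convex_polyhedron P).

Local Notation gap := (gap P).
Local Notation fold := (@fold _ _ P).
Local Notation dist := (dist P).
Local Notation reach := (reach P).

Context {v : E} (vF : exists2 F, facet P F & relint F v).

Definition is_image F o := exists x A,
  [/\ visible (P := P) (v := v) F o x A, enorm (o - x) = dist v x & reach v x].

Lemma source_image_is_image F o : facet P F -> source_images P v F o -> is_image F o.
Proof.
by move=> fF /(source_image_spec HP vF fF)[x [A [_ vis dE rx]]]; exists x, A.
Qed.

Lemma origin_surface : surface P v.
Proof. by case: vF => F fF /relint_sub; exact: (facet_surface HP fF). Qed.

Lemma reach_facet F x y : facet P F -> F x -> F y -> reach v x -> reach v y.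
Proof. by move=> fF Fx Fy rx; apply: (reach_segment rx); exact: (facet_outside HP fF). Qed.

Lemma dist_facet F x y : facet P F -> F x -> F y -> reach v x ->
  dist v y <= dist v x + enorm (x - y).
Proof. by move=> fF Fx Fy rx; apply: (dist_along_segment rx); exact: (facet_outside HP fF). Qed.

Lemma image_exists F w : facet P F -> open_cell (P := P) F w -> reach v w -> exists o A,
  [/\ source_images P v F o, visible (P := P) (v := v) F o w A & enorm (o - w) = dist v w].
Proof.
move=> fF oc rw; have Fw := open_cell_in oc.
have [g sg] := shortest_exists HP origin_surface (facet_surface HP fF Fw) rw.
have [ o [h1 h2 h3]] := source_image_exists HP vF fF oc sg.
by exists o, (trace g).
Qed.

Lemma edot_along x y o (s : R) :
  edot (o - ((1 - s) *: x + s *: y)) (o - ((1 - s) *: x + s *: y)) =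
  edot (o - x) (o - x) - 2 * s * edot (o - x) (y - x) + s ^+ 2 * edot (y - x) (y - x).
Proof.
have -> : o - ((1 - s) *: x + s *: y) = (o - x) - s *: (y - x).
  by apply/rowP => i; rewrite !mxE; ring.
by move: (o - x) (y - x) => a b; rewrite !edotlrE (edotC b a); ring.
Qed.

Lemma enorm_line x y (s t : R) :
  enorm ((1 - s) *: x + s *: y - ((1 - t) *: x + t *: y)) = `|s - t| * enorm (y - x).
Proof.
rewrite -enormZ; congr enorm.
by apply/rowP => i; rewrite !mxE; ring.
Qed.

Lemma line_in x y (t : R) (F : set E) : 0 <= t <= 1 -> segment x y `<=` F ->
  F ((1 - t) *: x + t *: y).
Proof. by move=> /andP[t0 t1] h; apply/h/segmentP; exists t. Qed.

(** No source image for a facet is closer to a point of it than the source is on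
    the surface.  Along a segment from a point [x] where [o] is seen,
    [dist ^ 2 - t ^ 2 |y - x| ^ 2] is supported from above at each point by the
    affine function coming from an image seen there; so it stays below the one
    coming from [o]. *)
Lemma image_dist_relint F o y : facet P F -> is_image F o -> relint F y ->
  dist v y <= enorm (o - y).
Proof.
move=> fF [x [A [vis dE rx]]] yF; have [_ Fx _] := visible_facet HP vis.
have Fy := relint_sub yF; have xyF := facet_segment HP fF Fx Fy.
pose c (t : R) := (1 - t) *: x + t *: y.
have cF t : 0 <= t <= 1 -> F (c t) by move=> t01; exact: line_in.
have rc t : 0 <= t <= 1 -> reach v (c t) by move=> /cF Fc; exact: (reach_facet fF Fx Fc).
pose D := edot (y - x) (y - x).
pose f t := dist v (c t) ^+ 2 - t ^+ 2 * D.
have lip s t : 0 <= s <= 1 -> 0 <= t <= 1 ->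
    dist v (c s) <= dist v (c t) + `|s - t| * enorm (y - x).
  move=> s01 t01; rewrite -enorm_line enormB.
  exact: (dist_facet fF (cF t t01) (cF s s01) (rc t t01)).
have dge t : 0 <= t <= 1 -> 0 <= dist v (c t).
  by move=> t01; apply: le_trans (dist_ge (rc t t01)); exact: enorm_ge0.
pose M := dist v x + enorm (y - x).
have dle t : 0 <= t <= 1 -> dist v (c t) <= M.
  move=> t01; have z01 : 0 <= (0 : R) <= 1 by rewrite lexx ler01.
  have := lip t 0 t01 z01; rewrite subr0 /c subr0 scale1r scale0r addr0.
  case/andP: (t01) => t0 t1; rewrite (ger0_norm t0) => h.
  by have := enorm_ge0 (y - x); rewrite /M; nra.
have c0 : c 0 = x by rewrite /c subr0 scale1r scale0r addr0.
have c1 : c 1 = y by rewrite /c subrr scale0r scale1r add0r.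
have support t o' : 0 <= t <= 1 -> enorm (o' - c t) = dist v (c t) ->
    (exists2 r : R, 0 < r & forall z, F z -> enorm (z - c t) < r ->
      reach v z /\ dist v z <= enorm (o' - z)) ->
    exists2 r : R, 0 < r & forall s, 0 <= s <= 1 -> `|s - t| < r ->
      f s <= f t + (- 2 * edot (o' - x) (y - x)) * (s - t).
  move=> t01 eo [r r0 hr]; have n0 : 0 < enorm (y - x) + 1 by rewrite ltr_wpDl ?enorm_ge0.
  exists (r / (enorm (y - x) + 1)); first by rewrite divr_gt0.
  move=> s s01; rewrite ltr_pdivlMr// => st.
  have [|_ ds] := hr (c s) (cF s s01).
    rewrite enorm_line; apply: le_lt_trans st; rewrite ler_wpM2l//; lra.
  have d2 : dist v (c s) ^+ 2 <= enorm (o' - c s) ^+ 2.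
    by rewrite ler_pXn2r ?nnegrE ?enorm_ge0// dge.
  rewrite /f -eo; rewrite enorm_sqr in d2; rewrite enorm_sqr.
  by move: d2; rewrite /c !edot_along -/D; lra.
have [K lf] : exists K, forall s t, 0 <= s <= 1 -> 0 <= t <= 1 -> `|f s - f t| <= K * `|s - t|.
  exists (2 * M * enorm (y - x) + 2 * D) => s t s01 t01; rewrite /f.
  have -> : dist v (c s) ^+ 2 - s ^+ 2 * D - (dist v (c t) ^+ 2 - t ^+ 2 * D) =
    (dist v (c s) + dist v (c t)) * (dist v (c s) - dist v (c t)) - (s + t) * D * (s - t).
    by ring.
  have D0 : 0 <= D := edot_ge0 _.
  apply: le_trans (ler_normB _ _) _; rewrite [leRHS]mulrDl; apply: lerD; rewrite normrM.
    have -> : 2 * M * enorm (y - x) * `|s - t| = 2 * M * (`|s - t| * enorm (y - x)) by ring.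
    apply: ler_pM => //.
      have := dle s s01; have := dle t t01; have := dge s s01; have := dge t t01.
      by move=> ? ? ? ?; rewrite ger0_norm; lra.
    have := lip s t s01 t01; have := lip t s t01 s01; rewrite (distrC t s) => h1 h2.
    by rewrite ler_norml; lra.
  rewrite ler_wpM2r// normrM (ger0_norm D0) ler_wpM2r//.
  by case/andP: s01 => s0 s1; case/andP: t01 => t0 t1; rewrite ger0_norm; lra.
have := @below_left_support _ f K (- 2 * edot (o - x) (y - x)) lf.
have -> : f 1 = dist v y ^+ 2 - D by rewrite /f c1 expr1n mul1r.
have -> : f 0 = edot (o - x) (o - x) by rewrite /f c0 -dE enorm_sqr; ring.
move=> key; have {key} : dist v y ^+ 2 - D <= edot (o - x) (o - x) + - 2 * edot (o - x) (y - x).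
  apply: key.
    move=> t /andP[t0 t1]; have t01 : 0 <= t <= 1 by rewrite !ltW.
    have ctF : relint F (c t).
      have -> : c t = (1 - (1 - t)) *: y + (1 - t) *: x by rewrite /c subKr addrC.
      by apply: (relint_line HP fF) => //; lra.
    have [ o' [A' [_ vis' dE']]] := image_exists fF (or_introl ctF) (rc t t01).
    exists (- 2 * edot (o' - x) (y - x)).
    exact: support t01 dE' (visible_support HP vis').
  have z01 : 0 <= (0 : R) <= 1 by rewrite lexx ler01.
  have [||r r0 hr] := @support 0 o z01; rewrite ?c0//; first exact: (visible_support HP vis).
  exists r => // s s01 sr; have := hr s s01; case/andP: (s01) => s0 _.
  rewrite subr0 (ger0_norm s0) => /(_ sr).
  by rewrite /f c0 -dE enorm_sqr; lra.
have := edot_along x y o 1; rewrite subrr scale0r add0r scale1r expr1n mul1r mulr1 -/D => e h.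
have d0 : 0 <= dist v y by rewrite -c1 dge// ler01 lexx.
by rewrite -(ler_pXn2r (n := 2)) ?nnegrE ?enorm_ge0// enorm_sqr e; lra.
Qed.

(** Boundary points of [F] are limits of relative interior points. *)
Lemma image_dist F o y : facet P F -> is_image F o -> F y ->
  reach v y /\ dist v y <= enorm (o - y).
Proof.
move=> fF im Fy; have [x [A [vis dE rx]]] := im; have [_ Fx _] := visible_facet HP vis.
have ry := reach_facet fF Fx Fy rx; split=> //.
have [p pF] := facet_relint_point HP fF.
apply/ler_addgt0Pr => e e0.
have n0 : 0 < enorm (p - y) + 1 by rewrite ltr_wpDl ?enorm_ge0.
pose t := Num.min 1 (e / 2 / (enorm (p - y) + 1)).
have t0 : 0 < t by rewrite lt_min ltr01 !divr_gt0.
have t1 : t <= 1 by rewrite ge_min lexx.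
have [z zE] : exists z, z = (1 - (1 - t)) *: p + (1 - t) *: y by eexists.
have zF : relint F z.
  by rewrite zE; apply: (relint_line HP fF pF Fy); lra.
have zy : enorm (z - y) <= e / 2.
  have -> : z - y = t *: (p - y) by rewrite zE; apply/rowP => i; rewrite !mxE; ring.
  rewrite enormZ gtr0_norm//.
  have : t <= e / 2 / (enorm (p - y) + 1) by rewrite ge_min lexx orbT.
  rewrite ler_pdivlMr//; have := enorm_ge0 (p - y); nra.
have Fz := relint_sub zF; have rz := reach_facet fF Fx Fz rx.
have h1 := dist_facet fF Fz Fy rz; have h2 := image_dist_relint fF im zF.
have := enorm_tri y o z; rewrite (enormB y z); lra.
Qed.

(** If the distances to [o] are right at both ends of a segment, they are right in
    between: compare with an image seen in between. *)
Lemma image_equality F o x w z : facet P F -> F x -> F w -> is_image F o ->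
  enorm (o - x) = dist v x -> enorm (o - w) = dist v w ->
  segment x w z -> open_cell (P := P) F z -> enorm (o - z) = dist v z.
Proof.
move=> fF Fx Fw im ox ow xwz oc; have Fz := open_cell_in oc.
have [rz le] := image_dist fF im Fz.
apply/eqP; rewrite eq_le le andbT.
have [ o' [A' [src' _ <-]]] := image_exists fF oc rz.
have im' := source_image_is_image fF src'.
have [_ lx] := image_dist fF im' Fx; have [_ lw] := image_dist fF im' Fw.
rewrite -ox in lx; rewrite -ow in lw.
have sq (a b : E) : enorm a <= enorm b -> edot a a <= edot b b.
  by move=> h; rewrite -!enorm_sqr ler_pXn2r ?nnegrE ?enorm_ge0.
apply: enorm_le_sqr; case/segmentP: xwz => t [t0 t1 ->].
have := sq _ _ lx; have := sq _ _ lw; rewrite !edot_along.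
have := edot_along x w o 1; have := edot_along x w o' 1.
rewrite subrr scale0r add0r scale1r expr1n mul1r mulr1 => -> ->.
move: (edot (o - x) (o - x)) (edot (o' - x) (o' - x)) => a a'.
move: (edot (o - x) (w - x)) (edot (o' - x) (w - x)) => b b'.
move: (edot (w - x) (w - x)) => D h1 h2.
have : 0 <= (1 - t) * (a' - a) by rewrite mulr_ge0// subr_ge0.
have : 0 <= t * (a' - 2 * b' - (a - 2 * b)) by rewrite mulr_ge0//; lra.
lra.
Qed.

End Mount.

(** * Shortest paths in the direction of a source image *)

Section AcrossRidge.
Context {R : realType} {d : nat}.
Local Notation E := 'rV[R]_d.+1.
Implicit Types (x y z p q w o : E) (F G A B : set E) (g h : R -> E) (L : seq (set E)).
Context {P : set E} (HP : convex_polyhedron P).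

Local Notation gap := (gap P).
Local Notation normal := (normal P).
Local Notation fold := (@fold _ _ P).
Local Notation dist := (dist P).
Local Notation reach := (reach P).

Context {v : E} (vF : exists2 F, facet P F & relint F v).
Local Notation is_image := (is_image (P := P) (v := v)).
Local Notation ridge_nbhd := (ridge_nbhd (P := P)).
Local Notation open_cell := (open_cell (P := P)).
Local Notation visible := (visible (P := P) (v := v)).

Lemma ridge_nbhd_line F F' w x (t : R) : facet P F -> facet P F' ->
  F w -> F' w -> ridge_nbhd F F' w -> F x -> F' x -> 0 <= t -> t < 1 ->
  ridge_nbhd F F' ((1 - t) *: w + t *: x).
Proof.
move=> fF fF' Fw F'w [r r0 h] Fx F'x t0 t1.
have t1' : 0 < 1 - t by rewrite subr_gt0.
exists ((1 - t) * r); first by rewrite mulr_gt0.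
move=> z z0 z0' zr; pose z' := w + (1 - t)^-1 *: (z - ((1 - t) *: w + t *: x)).
have -> : z = (1 - t) *: z' + t *: x.
  by apply/rowP => i; rewrite !mxE; field; rewrite gt_eqF.
apply: (polyhedronT_convex HP) => //; [exact: ltW| |exact: (facet_sub HP fF)].
have g0 H : facet P H -> H w -> H x -> gap H z = 0 -> gap H z' = 0.
  move=> fH Hw Hx zH; rewrite gapD edotZr -gapB gap_line zH !(facet_gap HP fH)//; ring.
apply: h; [exact: g0|exact: g0|].
by rewrite addrAC subrr add0r enormZ gtr0_norm ?invr_gt0// mulrC ltr_pdivrMr// mulrC.
Qed.

Lemma ridge_nbhd_near F F' w : ridge_nbhd F F' w -> exists2 r : R, 0 < r &
  forall z, enorm (z - w) < r -> ridge_nbhd F F' z.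
Proof.
move=> [r r0 h]; exists r => // z zr; exists (r - enorm (z - w)); first by rewrite subr_gt0.
move=> y y0 y0' yz; apply: h => //; apply: le_lt_trans (enorm_tri z _ _) _; lra.
Qed.

(** Near [w] the polyhedron is a wedge, so that the points of [F] are either on
    the ridge or in the relative interior. *)
Lemma near_open_cell F F' w : facet P F -> facet P F' -> F' <> F -> F w -> F' w ->
  ridge_nbhd F F' w -> exists2 r : R, 0 < r &
    forall z, F z -> enorm (z - w) < r -> open_cell F z.
Proof.
move=> fF fF' ne Fw F'w rn.
have [r r0 hr] := ridge_wedge HP fF fF' (nesym ne) Fw F'w rn.
have [r' r'0 hr'] := ridge_nbhd_near rn.
exists (Num.min r r'); first by rewrite lt_min r0.
move=> z Fz; rewrite lt_min => /andP[zr zr'].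
have Pz := facet_sub HP fF Fz; have [z0|z0] := eqVneq (gap F' z) 0.
  right; exists F'; split=> //; last exact: hr'.
  by apply/(facetE HP fF').
have zp : 0 < gap F' z by rewrite lt0r z0 (gap_ge0 HP fF').
left; apply/(relint_facetP HP fF); split=> //.
have [|e e0 he] := @strict_nbhd _ _ [:: (normal F', (facet_data P F').2)] z.
  by move=> f; rewrite inE => /eqP -> /=; rewrite -subr_gt0.
exists (Num.min e (r - enorm (z - w))); first by rewrite lt_min e0 subr_gt0.
move=> y y0; rewrite lt_min => /andP[ye yr]; apply: hr.
- apply: le_lt_trans (enorm_tri z _ _) _; lra.
- by rewrite y0.
- by rewrite subr_ge0; apply/ltW/(he y ye (normal F', _)); rewrite inE eqxx.
Qed.

(** At a point of the ridge, appending [F'] to the facet sequence, or removing it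
    from its end, changes the image by the folding map. *)
Lemma visible_across F F' o x A : facet P F' -> F' <> F -> F' x ->
  ridge_nbhd F F' x -> visible F o x A -> visible F' (fold F F' o) x A.
Proof.
move=> fF' ne F'x rn vis; have [fF Fx _] := visible_facet HP vis.
have [sr _] := ridge_nbhd_share HP fF fF' (nesym ne) Fx F'x rn.
case: vis => [ch|[F1 [ o1 [ch sr1 _ ->]]]]; first by right; exists F, o.
have [f1 F1x o10] := chain_facet HP ch; case: (sr1) => _ _ ne1 _.
have e : F1 = F'.
  by case: (ridge_two_facets HP fF fF' (nesym ne) Fx F'x rn f1 F1x).
rewrite e in ch o10 sr1 *; left.
by rewrite (foldK HP fF' fF (share_ridge_not_opposite HP sr1) o10).
Qed.

Lemma ray_inj a b z y : segment a y z -> segment b y z -> z != y ->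
  enorm (a - z) = enorm (b - z) -> a = b.
Proof.
move=> /segmentP[t [t0 t1 zE]] /segmentP[s [s0 s1 zE']] zy e.
have n0 : 0 < enorm (z - y) by rewrite enorm_gt0// subr_eq0.
have key c u : 0 <= u -> u <= 1 -> z = (1 - u) *: c + u *: y ->
    0 < 1 - u /\ c - z = (u / (1 - u)) *: (z - y).
  move=> u0 u1 zc; have u1' : 0 < 1 - u.
    rewrite lt0r subr_ge0 u1 andbT; apply: contra_neq zy => h.
    by rewrite zc h (_ : u = 1) ?scale0r ?add0r ?scale1r//; lra.
  split=> //; rewrite {2}zc; apply: (scalerI (a := 1 - u)); first by rewrite gt_eqF.
  by apply/rowP => i; move/rowP: zc => /(_ i); rewrite !mxE => ->; field; rewrite gt_eqF.
have [t1' ea] := key a t t0 t1 zE; have [s1' eb] := key b s s0 s1 zE'.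
move: e; rewrite ea eb !enormZ !ger0_norm ?divr_ge0// ?ltW// => /(mulIf (lt0r_neq0 n0)) e.
by rewrite -(subrK z a) -(subrK z b) ea eb e.
Qed.

(** A shortest outside path has no corner off [P], where it could be cut.  So an
    image [o] unrolled from a third facet [H] through a point [x] of the ridge,
    and lying beyond [F'], is too close to the points of the ridge near [x]. *)
Lemma no_corner_outside F F' H o1 x w A : facet P F -> facet P F' -> F' <> F ->
  chain (P := P) v H o1 x A -> share_ridge P H F -> F x -> F' x ->
  F w -> F' w -> 0 < gap H w -> gap F' (fold H F o1) < 0 ->
  (forall s : R, 0 < s -> s <= 1 ->
    enorm (fold H F o1 - ((1 - s) *: x + s *: w)) = dist v ((1 - s) *: x + s *: w)) ->
  False.
Proof.
move=> fF fF' ne ch sr Fx F'x Fw F'w gw go eq.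
have [fH Hx o10] := chain_facet HP ch; have c0 := share_ridge_not_opposite HP sr.
have oH := visible_appended_gap HP ch sr Fx; set o := fold H F o1 in go eq oH.
have x0 := facet_gap HP fH Hx.
have of0 : gap F o = 0 by exact: gap_fold_target.
have [r r0 hr] := chain_support HP ch.
have [|e e0 he] := crossing_near HP fH (segment_r o x) x0 (ltW oH) _ r0.
  by rewrite x0.
have n0 : 0 < enorm (w - x) + 1 by rewrite ltr_wpDl ?enorm_ge0.
pose s := Num.min 1 (e / 2 / (enorm (w - x) + 1)).
have s0 : 0 < s by rewrite lt_min ltr01 !divr_gt0.
have s1 : s <= 1 by rewrite ge_min lexx.
have [z zE] : exists z, z = (1 - s) *: x + s *: w by eexists.
have zx : enorm (z - x) < e.
  have -> : z - x = s *: (w - x) by rewrite zE; apply/rowP => i; rewrite !mxE; ring.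
  rewrite enormZ gtr0_norm//.
  have : s <= e / 2 / (enorm (w - x) + 1) by rewrite ge_min lexx orbT.
  rewrite ler_pdivlMr//; have := enorm_ge0 (w - x); nra.
have gz : 0 < gap H z by rewrite zE gap_line x0 mulr0 add0r mulr_gt0.
have zF' : gap F' z = 0 by rewrite zE gap_line !(facet_gap HP fF')// !mulr0 addr0.
have zF : gap F z = 0 by rewrite zE gap_line !(facet_gap HP fF)// !mulr0 addr0.
have [c [ ozc cH cx]] := he z zx (ltW gz).
have cF : gap F c = 0 := gap_segment0 of0 zF ozc.
have gc : gap F' c < 0.
  case/segmentP: (ozc) => u [u0 u1 cE]; rewrite cE gap_line zF' mulr0 addr0.
  rewrite nmulr_llt0// subr_gt0 lt_neqAle u1 andbT; apply/eqP => u1'.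
  by move: gz; rewrite -cH cE u1' subrr scale0r scale1r add0r ltxx.
(* The path over [o1], [c] and [z] is off [P] at [c]: as cutting the fraction [l]
   of both legs does not shorten it, it does not turn there. *)
have nPc : ~ P c by move/(gap_ge0 HP fF'); rewrite leNgt gc.
have [rho rho0 hrho] := closed_avoid (polyhedron_closed HP) nPc.
pose m := Num.min rho (r - enorm (c - x)).
have m0 : 0 < m by rewrite lt_min rho0 subr_gt0.
pose K := enorm (z - c) + enorm (o1 - c) + 1.
have zc0 := enorm_ge0 (z - c); have oc0 := enorm_ge0 (o1 - c).
have K0 : 0 < K by rewrite /K; lra.
pose l := Num.min 1 (m / 2 / K).
have l0 : 0 < l by rewrite lt_min ltr01 !divr_gt0.
have l1 : l <= 1 by rewrite ge_min lexx.
have lK : l * K <= m / 2 by rewrite -ler_pdivlMr// ge_min lexx orbT.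
have mrho : m <= rho by rewrite ge_min lexx.
have mr : m <= r - enorm (c - x) by rewrite ge_min lexx orbT.
have [m1 m1E] : exists m1, m1 = (1 - l) *: c + l *: o1 by eexists.
have [m2 m2E] : exists m2, m2 = (1 - l) *: c + l *: z by eexists.
have m1c : enorm (m1 - c) = l * enorm (o1 - c).
  have -> : m1 - c = l *: (o1 - c) by rewrite m1E; apply/rowP => i; rewrite !mxE; ring.
  by rewrite enormZ gtr0_norm.
have m2c : enorm (m2 - c) = l * enorm (z - c).
  have -> : m2 - c = l *: (z - c) by rewrite m2E; apply/rowP => i; rewrite !mxE; ring.
  by rewrite enormZ gtr0_norm.
have b1 : l * enorm (o1 - c) <= m / 2.
  have : 0 <= l * enorm (z - c) by rewrite mulr_ge0// ltW.
  by move: lK; rewrite /K; lra.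
have b2 : l * enorm (z - c) <= m / 2.
  have : 0 <= l * enorm (o1 - c) by rewrite mulr_ge0// ltW.
  by move: lK; rewrite /K; lra.
have [rm1 dm1] : reach v m1 /\ dist v m1 <= enorm (o1 - m1).
  apply: hr; first by rewrite m1E gap_line cH o10 !mulr0 addr0.
  by apply: le_lt_trans (enorm_tri c _ _) _; rewrite m1c; lra.
have out12 : segment m1 m2 `<=` ~` interior P.
  move=> y /segmentP[u [u0 u1 yE]] /(@interior_subset _ P); apply: hrho.
  have -> : y - c = (1 - u) *: (m1 - c) + u *: (m2 - c).
    by rewrite yE; apply/rowP => i; rewrite !mxE; ring.
  apply: le_lt_trans (enormD _ _) _; rewrite !enormZ !ger0_norm ?subr_ge0// m1c m2c.
  apply: (@le_lt_trans _ _ (m / 2)); last by move: m0 mrho; clear; lra.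
  by move: u0 u1 b1 b2; clear; nra.
have m2F : gap F m2 = 0 by rewrite m2E gap_line cF zF !mulr0 addr0.
have out2 := hyperplane_outside HP fF m2F zF.
have d2 := dist_along_segment rm1 out12.
have d3 := dist_along_segment (reach_segment rm1 out12) out2.
have e1 : enorm (o1 - m1) = (1 - l) * enorm (o1 - c).
  have -> : o1 - m1 = (1 - l) *: (o1 - c).
    by rewrite m1E; apply/rowP => i; rewrite !mxE; ring.
  by rewrite enormZ ger0_norm ?subr_ge0.
have e2 : enorm (m1 - m2) = l * enorm (o1 - z).
  have -> : m1 - m2 = l *: (o1 - z) by rewrite m1E m2E; apply/rowP => i; rewrite !mxE; ring.
  by rewrite enormZ gtr0_norm.
have e3 : enorm (m2 - z) = (1 - l) * enorm (c - z).
  have -> : m2 - z = (1 - l) *: (c - z).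
    by rewrite m2E; apply/rowP => i; rewrite !mxE; ring.
  by rewrite enormZ ger0_norm ?subr_ge0.
have dz := eq s s0 s1; rewrite -zE in dz.
have oc : enorm (o - c) = enorm (o1 - c).
  by rewrite -[in LHS](fold_fix H cF) fold_dist.
have seg : segment o1 z c.
  apply: dist_segment; rewrite -(ler_pM2l l0).
  have := segment_dist ozc; rewrite oc dz; lra.
have o1g : 0 <= gap H o1 by rewrite o10.
have co1 := gap_segment_strict seg o1g gz cH.
by move: oH; rewrite (gap_fold_source HP fH c0 o10) -co1 cF oppr0 ltxx.
Qed.

(** Let [o] be seen from [x].  If [x] is on the ridge, then [o] was unrolled from
    [F'], by [no_corner_outside].  If not, let [y] be a point between [w] and [x],
    near [w]: the segment from [o] to [y] crosses the ridge in a point [z] near [w].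
    An image realizing the distance to [z] is also nearest to [y], in the same
    direction, hence it is [o]; so [o] is seen from [z] on the ridge. *)
Lemma image_across F F' o w : facet P F -> facet P F' -> F' <> F -> F w -> F' w ->
  ridge_nbhd F F' w -> is_image F o -> enorm (o - w) = dist v w -> gap F' o < 0 ->
  is_image F' (fold F F' o).
Proof.
move=> fF fF' ne Fw F'w rn im ow go.
have [x [A [vis dE rx]]] := im; have [_ Fx of0] := visible_facet HP vis.
have [sr _] := ridge_nbhd_share HP fF fF' (nesym ne) Fw F'w rn.
have c0 := share_ridge_not_opposite HP sr.
have Px := facet_sub HP fF Fx.
have [x0'|x0'] := eqVneq (gap F' x) 0.
  have F'x : F' x by apply/(facetE HP fF').
  case: vis => [ch|[H [ o1 [ch sr1 _ oE]]]].
    by have := chain_beyond HP ch fF' (nesym ne) F'x; lra.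
  have [fH Hx o10] := chain_facet HP ch.
  have c1 := share_ridge_not_opposite HP sr1.
  have [HF'|HF'] := pselect (H = F').
    rewrite HF' in ch oE c1 o10.
    have o1E : fold F F' o = o1 by rewrite oE; exact: foldK.
    exists x, A; rewrite o1E; split=> //; first by left.
    by rewrite -dE oE -[X in _ = enorm (_ - X)](fold_fix F' (facet_gap HP fF Fx)) fold_dist.
  exfalso; have gw : 0 < gap H w.
    rewrite lt0r (gap_ge0 HP fH (facet_sub HP fF Fw)) andbT; apply/eqP => w0.
    have Hw : H w by apply/(facetE HP fH); split=> //; exact: (facet_sub HP fF).
    case: (ridge_two_facets HP fF fF' (nesym ne) Fw F'w rn fH Hw) => //.
    by case: sr1.
  rewrite oE in go ow im dE.
  apply: (no_corner_outside fF fF' ne ch sr1 Fx F'x Fw F'w gw go).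
  move=> s s0 s1; apply: (image_equality HP vF fF Fx Fw im dE ow).
    by apply/segmentP; exists s; split=> //; exact: ltW.
  have zE : (1 - s) *: x + s *: w = (1 - (1 - s)) *: w + (1 - s) *: x.
    by rewrite subKr addrC.
  have seg : segment x w ((1 - s) *: x + s *: w).
    by apply/segmentP; exists s; split=> //; exact: ltW.
  right; exists F'; split=> //.
  - exact: (facet_segment HP fF Fx Fw).
  - exact: (facet_segment HP fF' F'x F'w).
  - by rewrite zE; apply: ridge_nbhd_line => //; lra.
have gx : 0 < gap F' x by rewrite lt0r x0' (gap_ge0 HP fF').
have [r r0 hr] := ridge_nbhd_near rn.
have [r1 r10 hr1] := near_open_cell fF fF' ne Fw F'w rn.
have w0' := facet_gap HP fF' F'w.
have [|e e0 he] := crossing_near HP fF' (segment_r o w) w0' (ltW go) _ r0.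
  by rewrite w0'.
have n0 : 0 < enorm (x - w) + 1 by rewrite ltr_wpDl ?enorm_ge0.
pose q := Num.min e r1; have q0 : 0 < q by rewrite lt_min e0.
pose t := Num.min 1 (q / 2 / (enorm (x - w) + 1)).
have t0 : 0 < t by rewrite lt_min ltr01 !divr_gt0.
have t1 : t <= 1 by rewrite ge_min lexx.
have [y yE] : exists y, y = (1 - t) *: w + t *: x by eexists.
have yw : enorm (y - w) < q.
  have -> : y - w = t *: (x - w) by rewrite yE; apply/rowP => i; rewrite !mxE; ring.
  rewrite enormZ gtr0_norm//.
  have : t <= q / 2 / (enorm (x - w) + 1) by rewrite ge_min lexx orbT.
  rewrite ler_pdivlMr//; have := enorm_ge0 (x - w); nra.
move: yw; rewrite lt_min => /andP[ye yr1].
have wxy : segment x w y.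
  by rewrite segment_sym yE; apply/segmentP; exists t; split=> //; exact: ltW.
have Fy : F y := facet_segment HP fF Fx Fw wxy.
have oy := image_equality HP vF fF Fx Fw im dE ow wxy (hr1 y Fy yr1).
have gy : 0 < gap F' y by rewrite yE gap_line w0' mulr0 add0r mulr_gt0.
have [z [ oyz z0' zw]] := he y ye (ltW gy).
have y0 := facet_gap HP fF Fy; have z0 : gap F z = 0 := gap_segment0 of0 y0 oyz.
have rnz := hr z zw.
have Pz : P z by case: rnz => rz rz0; apply=> //; rewrite subrr enorm0.
have Fz : F z by apply/(facetE HP fF).
have F'z : F' z by apply/(facetE HP fF').
have [rz dz] := image_dist HP vF fF im Fz.
have [|o' [A' [src' vis' dE']]] := image_exists HP vF (w := z) fF _ rz.
  by right; exists F'.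
have im' := source_image_is_image HP vF fF src'.
have [_ dy'] := image_dist HP vF fF im' Fy.
have zy : z != y by apply: contraTneq gy => <-; rewrite z0' ltxx.
have seg' : segment o' y z.
  apply: dist_segment; have := segment_dist oyz; rewrite oy dE'; lra.
have oo' : enorm (o' - z) = enorm (o - z).
  have := segment_dist oyz; have := segment_dist seg'.
  rewrite oy => h1 h2; apply/eqP; rewrite eq_le dE' dz /=.
  by rewrite -dE'; lra.
have oE := ray_inj seg' oyz zy oo'.
rewrite oE in vis' dE'; exists z, A'; split=> //.
  exact: visible_across vis'.
by rewrite -dE' -[X in enorm (_ - X) = _](fold_fix F z0') fold_dist.
Qed.

(** A point of the surface near [w], in the direction of [o] unrolled around [w]:
    in [F], or behind the ridge in the other facet. *)
Definition step_back F o w (t : R) c := F c /\ c = (1 - t) *: w + t *: o \/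
  exists F', [/\ facet P F', F' <> F, F' w, 0 < gap F c &
    c = fold F F' ((1 - t) *: w + t *: o)].

(** Just before [w], on the segment from [o], the distance to [o] has dropped by
    the length of the step, and [image_dist] bounds the distance to the source by
    it.  Behind a ridge, the same holds for the folded image. *)
Lemma image_step_back F o w : facet P F -> open_cell F w -> is_image F o ->
  enorm (o - w) = dist v w -> exists2 e : R, 0 < e & forall t, 0 < t -> t < e ->
    exists2 c, step_back F o w t c & [/\ segment c w `<=` surface P, reach v c,
      enorm (c - w) = t * enorm (o - w) & dist v c + enorm (c - w) <= dist v w].
Proof.
move=> fF oc im ow; have Fw := open_cell_in oc.
have [_ [_ [/(visible_facet HP)[_ _ of0] _ _]]] := im.
have w0 := facet_gap HP fF Fw.
pose c t := (1 - t) *: w + t *: o.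
have cF t : gap F (c t) = 0 by rewrite /c gap_line w0 of0 !mulr0 addr0.
have cw t : 0 < t -> enorm (c t - w) = t * enorm (o - w).
  move=> t0; have -> : c t - w = t *: (o - w) by apply/rowP => i; rewrite !mxE; ring.
  by rewrite enormZ gtr0_norm.
have co t : t <= 1 -> enorm (o - c t) = (1 - t) * enorm (o - w).
  move=> t1; have -> : o - c t = (1 - t) *: (o - w) by apply/rowP => i; rewrite !mxE; ring.
  by rewrite enormZ ger0_norm// subr_ge0.
have n0 : 0 < enorm (o - w) + 1 by rewrite ltr_wpDl ?enorm_ge0.
have small (r : R) : 0 < r -> exists2 e : R, 0 < e & forall t, 0 < t -> t < e ->
    t <= 1 /\ enorm (c t - w) < r.
  move=> r0; exists (Num.min 1 (r / (enorm (o - w) + 1))); first by rewrite lt_min ltr01 divr_gt0.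
  move=> t t0; rewrite lt_min ltr_pdivlMr// => /andP[t1 tr]; split; first exact: ltW.
  by rewrite (cw t t0); apply: le_lt_trans tr; rewrite ler_pM2l//; lra.
have on_surface H y : facet P H -> H y -> H w -> segment y w `<=` surface P.
  move=> fH Hy Hw; apply: subset_trans (facet_surface HP fH).
  exact: (facet_segment HP fH).
have direct t : 0 < t -> t <= 1 -> P (c t) -> exists2 c', step_back F o w t c' &
   [/\ segment c' w `<=` surface P, reach v c',
      enorm (c' - w) = t * enorm (o - w) & dist v c' + enorm (c' - w) <= dist v w].
  move=> t0 t1 Pc; have Fc : F (c t) by apply/(facetE HP fF).
  have [rc dc] := image_dist HP vF fF im Fc.
  exists (c t); first by left.
  split=> //; [exact: on_surface fF Fc Fw|exact: cw|].
  by rewrite (cw t t0) -ow; rewrite (co t t1) in dc; lra.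
case: oc => [/(relint_facetP HP fF)[_ [r r0 hr]]|[F' [fF' ne _ F'w rn]]].
  have [e e0 he] := small r r0; exists e => // t t0 te; have [t1 cr] := he t t0 te.
  by apply: direct => //; apply: hr.
have [r r0 hr] := ridge_wedge HP fF fF' (nesym ne) Fw F'w rn.
have w0' := facet_gap HP fF' F'w.
have [e e0 he] := small r r0; exists e => // t t0 te; have [t1 cr] := he t t0 te.
have gc : gap F' (c t) = t * gap F' o by rewrite /c gap_line w0' mulr0 add0r.
have [go|go] := leP 0 (gap F' o).
  by apply: direct => //; apply: hr; rewrite ?cF// gc mulr_ge0// ltW.
have [sr _] := ridge_nbhd_share HP fF fF' (nesym ne) Fw F'w rn.
have c0 := share_ridge_not_opposite HP sr.
have im' := image_across fF fF' ne Fw F'w rn im ow go.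
have gF : gap F (fold F F' (c t)) = - (t * gap F' o).
  by rewrite (gap_fold_source HP fF c0 (cF t)) gc.
have gFp : 0 < gap F (fold F F' (c t)) by rewrite gF oppr_gt0 pmulr_rlt0.
have gF' := gap_fold_target HP fF' c0 (c t).
have cw' : enorm (fold F F' (c t) - w) = t * enorm (o - w).
  by rewrite -[X in enorm (_ - X)](fold_fix F w0') fold_dist// cw.
have Pc' : P (fold F F' (c t)).
  by apply: hr; [rewrite cw' -(cw t t0)|exact: ltW|rewrite gF'].
have F'c' : F' (fold F F' (c t)) by apply/(facetE HP fF').
have [rc dc] := image_dist HP vF fF' im' F'c'.
rewrite fold_dist// (co t t1) in dc.
exists (fold F F' (c t)); first by right; exists F'.
by split=> //; [exact: on_surface fF' F'c' F'w|rewrite cw' -ow; lra].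
Qed.

(** Whether [c] is in [F] or behind the ridge depends on [c] only, and folding is
    injective. *)
Lemma step_back_inj F o o' w (t : R) c : facet P F -> open_cell F w -> gap F o = 0 ->
  gap F o' = 0 -> 0 < t -> step_back F o w t c -> step_back F o' w t c -> o = o'.
Proof.
move=> fF oc o0 o0' t0; have Fw := open_cell_in oc; have w0 := facet_gap HP fF Fw.
have line : (1 - t) *: w + t *: o = (1 - t) *: w + t *: o' -> o = o'.
  by move=> /addrI /scalerI; apply; rewrite gt_eqF.
move=> [[Fc cE]|[F1 [f1 ne1 F1w gc cE]]] [[Fc' cE']|[F2 [f2 ne2 F2w gc' cE']]].
- by apply: line; rewrite -cE -cE'.
- by move: gc'; rewrite (facet_gap HP fF Fc) ltxx.
- by move: gc; rewrite (facet_gap HP fF Fc') ltxx.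
have F12 : F2 = F1.
  case: oc => [wF|[F' [fF' ne' _ F'w rn]]].
    by case: ne1; apply/esym; exact: (relint_facet_eq HP fF f1 wF F1w).
  have two := ridge_two_facets HP fF fF' (nesym ne') Fw F'w rn.
  by case: (two _ f1 F1w) => // ->; case: (two _ f2 F2w).
rewrite F12 in cE'; have c0 := normals_not_opposite HP fF f1 (nesym ne1) Fw F1w.
have g0 q : gap F q = 0 -> gap F ((1 - t) *: w + t *: q) = 0.
  by move=> q0; rewrite gap_line w0 q0 !mulr0 addr0.
have e1 := foldK HP fF f1 c0 (g0 _ o0); have e2 := foldK HP fF f1 c0 (g0 _ o0').
by rewrite -cE in e1; rewrite -cE' e1 in e2; apply: line.
Qed.

End AcrossRidge.

(** * Voronoi diagrams of finitely many sites *)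

Section Voronoi.
Context {R : realType} {d : nat}.
Local Notation E := 'rV[R]_d.+1.
Implicit Types (x y z p w nu : E) (Y : set E).
Context {a : E} (b : R) (a0 : a != 0).
Let T : set E := [set x | edot a x = b].

Lemma bisector_le nu nu' x : (edot (2 *: (nu' - nu)) x <= edot nu' nu' - edot nu nu) =
  (enorm (x - nu) <= enorm (x - nu')).
Proof.
have sq q : enorm (x - q) ^+ 2 = edot x x - 2 * edot q x + edot q q.
  by rewrite enorm_sqr !edotlrE (edotC x q); ring.
rewrite -[RHS]ler_sqr ?nnegrE ?enorm_ge0// !sq !edotlrE.
by apply/idP/idP; lra.
Qed.

Lemma bisector_eq nu nu' x : enorm (x - nu) = enorm (x - nu') ->
  edot (2 *: (nu' - nu)) x = edot nu' nu' - edot nu nu.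
Proof.
move=> h; apply/eqP; rewrite eq_le bisector_le h lexx/=.
have := bisector_le nu' nu x; rewrite h lexx !edotlrE; lra.
Qed.

Lemma bisector_center nu nu' : nu' != nu ->
  edot (2 *: (nu' - nu)) nu < edot nu' nu' - edot nu nu.
Proof.
move=> ne; have : 0 < edot (nu' - nu) (nu' - nu) by rewrite edot_gt0// subr_eq0.
by rewrite !edotlrE (edotC nu nu'); lra.
Qed.

Lemma voronoi_cellE Y (s : seq E) nu : (forall y, Y y -> y \in s) ->
  exists l : seq (E * R),
  [/\ voronoi_cell T Y nu = T `&` polyhedron l,
      {in l, forall c, exists nu', [/\ Y nu', nu' != nu, c.1 = 2 *: (nu' - nu)
                                      & c.2 = edot nu' nu' - edot nu nu]} &
      forall nu', Y nu' -> nu' != nu ->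
        (2 *: (nu' - nu), edot nu' nu' - edot nu nu) \in l].
Proof.
move=> Ys; pose bis nu' := (2 *: (nu' - nu), edot nu' nu' - edot nu nu).
pose l := [seq bis nu' | nu' <- s & (nu' != nu) && `[< Y nu' >]].
have lY nu' : Y nu' -> nu' != nu -> bis nu' \in l.
  move=> Yn ne; apply/mapP; exists nu' => //.
  by rewrite mem_filter ne Ys// andbT; apply/asboolP.
have Yl : {in l, forall c, exists nu', [/\ Y nu', nu' != nu & c = bis nu']}.
  move=> c /mapP[nu']; rewrite mem_filter => /andP[/andP[ne /asboolP Yn] _] ->.
  by exists nu'.
exists l; split=> //; last first.
  by move=> c /Yl[nu' [Yn ne ->]]; exists nu'.
apply/seteqP; split=> [x [Tx h]|x [Tx h]]; split=> //.
  by move=> c /Yl[nu' [Yn ne ->]]; rewrite bisector_le; exact: h.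
move=> nu' Yn; have [->//|ne] := eqVneq nu' nu.
by rewrite -bisector_le; exact: (h _ (lY _ Yn ne)).
Qed.

(** The point [w] lies on a facet of the Voronoi cell of [nu], and the
    hyperplane of that facet is the bisector of [nu] and another site; the
    difference of the two sites is parallel to the ambient hyperplane, so the
    bisector cuts it transversally. *)
Lemma equidistant_voronoi Y (s : seq E) w nu nu' : (forall y, Y y -> y \in s) ->
  Y `<=` T -> T w -> Y nu -> Y nu' -> nu <> nu' ->
  enorm (w - nu) = enorm (w - nu') ->
  (forall y, Y y -> enorm (w - nu) <= enorm (w - y)) ->
  voronoi_codim1 (d := d) T Y w.
Proof.
move=> Ys YT Tw Yn Yn' ne eqd mn; have [l [cell lY Yl]] := voronoi_cellE nu Ys.
have aff x y (t : R) : T x -> T y -> T ((1 - t) *: x + t *: y).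
  by rewrite /T /= => Tx Ty; rewrite !edotrE Tx Ty; ring.
have [_ lw] : (T `&` polyhedron l) w by rewrite -cell.
have ne' : nu' != nu by apply/eqP/nesym.
have hp : {in l, forall c, edot c.1 w = c.2 -> edot c.1 nu < c.2}.
  by move=> c /lY[q [_ qn -> ->]] _; exact: bisector_center.
have act : exists2 c, c \in l & edot c.1 w = c.2.
  by eexists; [exact: Yl Yn' ne'|exact: bisector_eq].
have [c [z [r [cl cw Tz cz [r0 hr]]]]] := facet_through aff Tw (YT _ Yn) lw hp act.
pose C := voronoi_cell T Y nu `&` [set x | edot c.1 x = c.2].
exists C; last by split=> //; split.
have [q [Yq qn c1 _]] := lY c cl.
have ac : edot a c.1 = 0.
  by have := YT _ Yq; have := YT _ Yn; rewrite /T /= c1 !edotrE => -> ->; ring.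
have c0 : c.1 != 0 by rewrite c1 scaler_eq0 subr_eq0 negb_or qn andbT pnatr_eq0.
have ind : independent a c.1.
  move=> u t h; have aa := edot_gt0 a0; have cc := edot_gt0 c0.
  have := congr1 (edot a) h; have := congr1 (edot c.1) h.
  rewrite !edotrE (edotC c.1 a) ac ?edot0r !mulr0 add0r addr0.
  move=> tc ua; split; apply/eqP; [move/eqP: ua|move/eqP: tc];
    by rewrite mulf_eq0 (gt_eqF aa, gt_eqF cc) orbF.
split; first exists nu => //.
  split; first by exists w; split=> //; split.
  exists c.1, c.2; split=> // x; rewrite cell => -[_ lx]; exact: lx.
exists (\rank (kermx (row_mx a^T c.1^T))).
  apply: (has_dim_nbhd (z := z) (r := r)) => //.
  - by split=> //; rewrite cell; split=> //; apply: hr => //; rewrite subrr enorm0.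
  - by move=> x [[Tx _] cx]; apply/kermx2P; rewrite !edotBr Tz Tx cz cx !subrr.
  - move=> y /kermx2P[]; rewrite !edotBr Tz cz => /subr0_eq Ty /subr0_eq cy yr.
    by split=> //; rewrite cell; split=> //; exact: hr.
rewrite rank_kermx2//.
have : (2 <= d.+1)%N by rewrite -(rank_col_mx2 ind) rank_leq_col.
by case: (d).
Qed.

(** A point with a single nearest site is interior to its cell, so that a
    hyperplane supporting the cell there contains all of it. *)
Lemma voronoi_equidistant Y (s : seq E) w : (forall y, Y y -> y \in s) ->
  voronoi_codim1 (d := d) T Y w -> exists nu nu',
  [/\ Y nu, Y nu', nu <> nu', enorm (w - nu) = enorm (w - nu') &
      forall y, Y y -> enorm (w - nu) <= enorm (w - y)].
Proof.
move=> Ys [C [[nu Yn [_ [u [k [sup CE]]]]] [j Cj jd]] Cw].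
have [l [cell lY Yl]] := voronoi_cellE nu Ys.
rewrite CE in Cw; have [[Tw mn] uw] := Cw.
apply: contrapT => none.
have [r r0 hr] : exists2 r : R, 0 < r & forall y, enorm (y - w) < r ->
    {in l, forall c, edot c.1 y < c.2}.
  apply: strict_nbhd => c cl; have [q [Yq qn c1 c2]] := lY c cl.
  rewrite lt_neqAle c1 c2 bisector_le (mn _ Yq) andbT; apply/negP => /eqP e.
  apply: none; exists nu, q; split=> //; first by apply/nesym/eqP.
  apply/eqP; rewrite eq_le (mn _ Yq)/= -bisector_le.
  by move: e; rewrite !edotlrE; lra.
have near_cell y : T y -> enorm (y - w) < r -> voronoi_cell T Y nu y.
  by move=> Ty yr; rewrite cell; split=> // c cl; exact/ltW/(hr y yr).
have flat_face y : T y -> edot u (y - w) = 0.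
  move=> Ty; apply: (edot_local_max r0) => t tr.
  have /sup : voronoi_cell T Y nu (w + t *: (y - w)).
    apply: near_cell; last by rewrite addrAC subrr add0r.
    by rewrite /T /= !edotrE Tw Ty; ring.
  by rewrite edotDr uw; lra.
have Cd : has_dim C (\rank (kermx a^T)).
  rewrite CE; apply: (has_dim_nbhd (z := w) (r := r)) => //.
  - by move=> x [[Tx _] _]; apply/kermx1P; rewrite edotBr Tx Tw subrr.
  - move=> y /kermx1P; rewrite edotBr Tw => /subr0_eq Ty yr; split; first exact: near_cell.
    by have := flat_face y Ty; rewrite edotBr uw => /subr0_eq.
have := has_dim_inj Cj Cd; rewrite rank_kermx1//= => jE.
by move: jd; rewrite jE => /eqP; rewrite eqn_leq ltnn.
Qed.

End Voronoi.

(** * Cut points and the Voronoi diagram *)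

Section CutPoints.
Context {R : realType} {d : nat}.
Local Notation E := 'rV[R]_d.+1.
Implicit Types (x y c o w : E) (F : set E).
Context {P : set E} (HP : convex_polyhedron P) {v : E}.
Context (vF : exists2 F0, facet P F0 & relint F0 v).
Local Notation reach := (reach P).
Local Notation dist := (dist P).
Local Notation src := (source_images P v).

Lemma source_image_minimal F o o' w : facet P F -> F w -> src F o' ->
  enorm (o - w) = dist v w -> enorm (w - o) <= enorm (w - o').
Proof.
move=> fF Fw so' e.
have [_] := image_dist HP vF fF (source_image_is_image HP vF fF so') Fw.
by rewrite -e (enormB o) (enormB o').
Qed.

(** Shortest paths with different traces unroll from different images, both at
    the distance of [w] to the source. *)
Lemma cut_point_voronoi F w : facet P F -> open_cell (P := P) F w ->
  cut_points P v w -> voronoi_codim1 (affine_hull F) (src F) w.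
Proof.
move=> fF oc [_ [g [h [sg sh gh]]]]; have Fw := open_cell_in oc.
have [ o [so vo eo]] := source_image_exists HP vF fF oc sg.
have [ o' [so' vo' eo']] := source_image_exists HP vF fF oc sh.
have oo' : o <> o' by move=> e; apply: gh; rewrite -e in vo'; exact: visible_unique vo vo'.
have [s ss] := source_images_finite HP vF fF.
have hull : affine_hull F = [set x | edot (normal P F) x = (facet_data P F).2].
  rewrite (facet_hull HP fF); apply/seteqP.
  by split=> x; rewrite /gap /= => h0; lra.
rewrite hull; apply: (equidistant_voronoi (normal_neq0 HP fF) ss _ _ so so' oo').
- by move=> x [+ _]; rewrite hull.
- by have := affine_hull_sub Fw; rewrite hull.
- by rewrite enormB eo enormB eo'.
- by move=> y sy; exact: source_image_minimal sy eo.
Qed.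

(** Two equally near source images are the unfoldings of shortest paths to [w]
    that arrive along different segments. *)
Lemma voronoi_cut_point F w : facet P F -> open_cell (P := P) F w ->
  voronoi_codim1 (affine_hull F) (src F) w -> cut_points P v w.
Proof.
move=> fF oc; have Fw := open_cell_in oc.
have hull : affine_hull F = [set x | edot (normal P F) x = (facet_data P F).2].
  rewrite (facet_hull HP fF); apply/seteqP.
  by split=> x; rewrite /gap /= => h0; lra.
have [s ss] := source_images_finite HP vF fF.
rewrite hull => /(voronoi_equidistant (normal_neq0 HP fF) ss)[ o [ o' [so so' oo' eqd mn]]].
have im := source_image_is_image HP vF fF so.
have im' := source_image_is_image HP vF fF so'.
have [rw dw] := image_dist HP vF fF im Fw.
have od : enorm (o - w) = dist v w.
  apply/eqP; rewrite eq_le dw andbT.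
  have [q [A [sq _ <-]]] := image_exists HP vF fF oc rw.
  by rewrite (enormB o) (enormB q); exact: mn.
have od' : enorm (o' - w) = dist v w by rewrite -od enormB -eqd enormB.
have [e e0 he] := image_step_back HP vF fF oc im od.
have [e' e0' he'] := image_step_back HP vF fF oc im' od'.
have [t [t0 te te']] : exists t, [/\ 0 < t, t < e & t < e'].
  by exists (Num.min e e' / 2); split; [|move: e0 e0'..]; rewrite /Num.min; case: ifP; lra.
have [c sc [cw rc cn cd]] := he t t0 te.
have [c' sc' [cw' rc' cn' cd']] := he' t t0 te'.
have Sv := origin_surface HP vF.
have seg0 x y : segment x y `<=` surface P -> surface P x.
  by apply; exact: segment_l.
have dist_before x : segment x w `<=` surface P -> reach v x ->
    dist v x + enorm (x - w) <= dist v w -> dist v x = dist v w - enorm (x - w).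
  move=> xw rx dx; have : dist v w <= dist v x + enorm (x - w).
    by apply: dist_along_segment => // q /xw /(surfaceP HP)[].
  lra.
have [p sp] := shortest_exists HP Sv (seg0 _ _ cw) rc.
have [p' sp'] := shortest_exists HP Sv (seg0 _ _ cw') rc'.
have [g sg pg] := shortest_through HP sp cw cd.
have [h sh ph] := shortest_through HP sp' cw' cd'.
have end_trace q x : shortest_path (surface P) q v x -> trace q x.
  by case=> -[_ _ _ q1] _ _; exists 1 => //; rewrite /= in_itv/= ler01 lexx.
split; first exact: (facet_surface HP fF).
exists g, h; split=> // gh; apply: oo'.
have [i /=] := pg _ (end_trace _ _ sp); rewrite in_itv/= => /andP[i0 i1] gi.
have := ph _ (end_trace _ _ sp'); rewrite -gh => -[j /=].
rewrite in_itv/= => /andP[j0 j1] gj.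
have cc' : c = c'.
  rewrite -gi -gj; apply: (shortest_dist_inj HP sg) => //; rewrite gi gj.
  by rewrite (dist_before c)// (dist_before c')// cn cn' od od'.
have o0 q : src F q -> gap P F q = 0 by case=> + _; rewrite (facet_hull HP fF).
by rewrite cc' in sc; exact: (step_back_inj HP fF oc (o0 _ so) (o0 _ so') t0 sc sc').
Qed.

End CutPoints.

Theorem theorem2p9 (R : realType) (d : nat) (P : set 'rV[R]_d.+1)
    (v : 'rV[R]_d.+1) (F : set 'rV[R]_d.+1) :
  convex_polyhedron P ->
  (exists2 F0, facet P F0 & relint F0 v) ->
  facet P F ->
  let V := voronoi_codim1 (affine_hull F) (source_images P v F) in
  relint F `&` cut_points P v = relint F `&` V /\
  (forall G, ridge P G -> G `<=` F ->
     relint G `&` cut_points P v = relint G `&` V).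
Proof.
move=> HP vF fF V.
have cell w : open_cell (P := P) F w -> cut_points P v w <-> V w.
  by move=> oc; split; [exact: cut_point_voronoi|exact: voronoi_cut_point].
have on_cells A : (forall w, A w -> open_cell (P := P) F w) ->
    A `&` cut_points P v = A `&` V.
  by move=> h; apply/seteqP; split=> w [Aw /(cell w (h w Aw))].
split=> [|G rG GF]; apply: on_cells => w; first by left.
move=> Gw; have [F' [fF' ne GF' nb]] := ridge_other_facet HP fF rG GF Gw.
by right; exists F'; split=> //; [apply: GF|apply: GF']; exact: relint_sub Gw.
Qed.
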